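(* Let $n\ge2$ and $\lambda$ a partition. The inflation map $\iota$ is a crystal isomorphism \[\iota\colon\mathrm{VST}^n(\lambda)\to\bigsqcup_{\mu\subseteq\lambda}B(\mu)\times\mathcal F^{cs}_{\lambda/\mu},\] where $f_i(b\times F)=(f_ib)\times F$ and $e_i(b\times F)=(e_ib)\times F$. Consequently \[\mathrm{VST}^n(\lambda)\cong\bigoplus_{\mu\subseteq\lambda}B(\mu)^{\oplus|\mathcal F^{cs}_{\lambda/\mu}|},\] so the number $V^\mu_\lambda$ of highest weight elements of weight $\mu$ in $\mathrm{VST}^n(\lambda)$ equals $|\mathcal F^{cs}_{\lambda/\mu}|$, and \[\overline{g}_\lambda(\mathbf x;\alpha)=\sum_{\mu\subseteq\lambda}\alpha^{|\lambda|-|\mu|}|\mathcal F^{cs}_{\lambda/\mu}|\,s_\mu(\mathbf x).\]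
   Context: A valued-set tableau of shape $\lambda$ with entries at most $n$ is a semistandard Young tableau of shape $\lambda$ (English convention) with entries in $\{1,\dots,n\}$, together with a division of each row into groups, each group a set of horizontally consecutive boxes of one row containing the same entry. The buoy of a group is its leftmost box, the anchor its rightmost box. $\mathrm{VST}^n(\lambda)$ is the set of these ($\mathrm{VST}^\infty(\lambda)$ allows all positive integers); $\mathrm{wt}(V)=\prod_jx_j^{m_j}$ with $m_j$ the number of groups with entry $j$; $|V|$ the number of groups. $\overline{g}_\lambda(\mathbf x;\alpha)=\sum_{V\in\mathrm{VST}^\infty(\lambda)}\alpha^{|\lambda|-|V|}\mathrm{wt}(V)$; $s_\mu$ is the Schur function. Crystal operators: $\mathrm{rd}(V)$ reads the buoy entries, columns left to right, each bottom to top. For $i\in\{1,\dots,n-1\}$, write $+$ for each letter $i$, $-$ for each $i+1$, cancel pairs $-+$ successively until $+\cdots+-\cdots-$ remains. $e_iV$: $0$ if no uncanceled $-$; else with $\mathsf g$ the group of the leftmost uncanceled $-$: if the entry immediately above the anchor of $\mathsf g$ is $i$, move the divider between $\mathsf g$ and the group to its left one step up (remove it, merging those groups, and insert a divider at the same horizontal position in the row above); otherwise change every $i+1$ in $\mathsf g$ to $i$. $f_iV$: $0$ if no uncanceled $+$; else with $\mathsf g$ the group of the rightmost uncanceled $+$: if the entry immediately below the anchor of $\mathsf g$ is $i+1$, move the divider between $\mathsf g$ and the group to its left one step down; otherwise change every $i$ in $\mathsf g$ to $i+1$. $B(\mu)$ is the $U_q(\mathfrak{sl}_n)$-highest weight crystal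 on semistandard tableaux of shape $\mu$ with entries in $\{1,\dots,n\}$; $\cong$ crystal isomorphism, $\bigoplus$ disjoint union, $B^{\oplus m}$ $m$ copies. $\mathcal F^{cs}_{\lambda/\mu}$ (column semistandard flagged tableaux) is the set of fillings of the boxes of $\lambda$ not in $\mu$ by positive integers, strictly increasing along rows and weakly increasing down columns, such that every entry in column $c$ is strictly less than $c$. Inflation: let $V\in\mathrm{VST}^n(\lambda)$; for $1\le j\le\lambda_1$ let $\mathrm{rd}(C_j)$ be the word of anchor entries of column $j$ read from bottom to top, and let $\lambda_{\ge j}$ be the subdiagram of $\lambda$ consisting of columns $j,\dots,\lambda_1$; at step $j$ all diagrams are placed left-justified starting at column $j$. Start with $b_{\lambda_1+1}\times F_{\lambda_1+1}=\emptyset\times\emptyset$. For $j=\lambda_1,\dots,1$: $b_j$ is the RSK (row) insertion tableau of $\mathrm{rd}(C_j)\mathrm{rd}(C_{j+1})\cdots\mathrm{rd}(C_{\lambda_1})$, of shape $\mu_j$; $F_j$ is the filling of $\lambda_{\ge j}/\mu_j$ obtained by keeping every entry of $F_{j+1}$ in the same box (same row and plane column) increased by $1$, and filling every remaining box of $\lambda_{\ge j}/\mu_j$ with $1$. Then $\iota(V)=b_1\times F_1$.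
   Formalization: f_i tests the entry below the buoy of g, not below its anchor (the anchor rule turns 1|11 over 22 into a non-semistandard filling), and the count of highest weight elements of weight μ is stated for μ with at most n rows (it fails for n=2, λ=μ=(1,1,1)). *)

(* Defs.v *)
From mathcomp Require Import all_boot all_order all_algebra finmap.
From mathcomp Require Import mathcomp_extra boolp classical_sets functions.
From mathcomp Require Import cardinality fsbigop.

Set Implicit Arguments.
Unset Strict Implicit.
Unset Printing Implicit Defensive.

Local Open Scope classical_set_scope.

(* Rows and columns are numbered from 0, letters and crystal indices from 1.  *)

Definition is_part (lam : seq nat) : bool := sorted geq lam && (0 \notin lam).

Definition subpart (mu lam : seq nat) : Prop :=
  forall r, nth 0 mu r <= nth 0 lam r.

Definition subparts (lam : seq nat) : set (seq nat) :=
  [set mu | is_part mu /\ subpart mu lam].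

(* A filling is the sequence of its rows; its shape is [shape T].             *)
Definition tableau := seq (seq nat).

Definition ent (T : tableau) (r c : nat) : nat := nth 0 (nth [::] T r) c.

Definition mkfill (A : Type) (lam : seq nat) (F : nat -> nat -> A) :
  seq (seq A) :=
  [seq [seq F r c | c <- iota 0 (nth 0 lam r)] | r <- iota 0 (size lam)].

Definition semistandard (lam : seq nat) (T : tableau) : Prop :=
  [/\ shape T = lam,
      forall r c, c < nth 0 lam r -> 0 < ent T r c,
      forall r c c', c <= c' -> c' < nth 0 lam r -> ent T r c <= ent T r c'
    & forall r r' c, r < r' -> c < nth 0 lam r' -> ent T r c < ent T r' c].

Definition entries_le (n : nat) (T : tableau) : Prop :=
  forall r c, ent T r c <= n.

Definition SSYT (n : nat) (lam : seq nat) : set tableau :=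
  [set T | semistandard lam T /\ entries_le n T].

(* Boxes, columns left to right, each column bottom to top.                   *)
Definition rd_boxes (T : tableau) : seq (nat * nat) :=
  flatten [seq [seq (r, c) | r <- rev (iota 0 (size T)) &
                             c < size (nth [::] T r)]
          | c <- iota 0 (size (head [::] T))].

Definition set_range (T : tableau) (r a b v : nat) : tableau :=
  mkfill (shape T)
    (fun r' c => if (r' == r) && (a <= c <= b) then v else ent T r' c).

(* One pass over the word: [p] collects the uncanceled + (rightmost first) and
   [m] the - not canceled so far (rightmost first); a + cancels the head of
   [m] if there is one.                                                       *)
Definition signature (T : tableau) (i : nat) (w : seq (nat * nat)) :
  seq (nat * nat) * seq (nat * nat) :=
  foldl (fun pm x =>
    let: (p, m) := pm in
    if ent T x.1 x.2 == i then
      if m is _ :: m' then (p, m') else (x :: p, m)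
    else if ent T x.1 x.2 == i.+1 then (p, x :: m)
    else (p, m)) ([::], [::]) w.

Definition rightmost_plus (T : tableau) (i : nat) (w : seq (nat * nat)) :
  option (nat * nat) := ohead (signature T i w).1.

Definition leftmost_minus (T : tableau) (i : nat) (w : seq (nat * nat)) :
  option (nat * nat) := ohead (rev (signature T i w).2).

(* The data of a seminormal crystal: [None] stands for 0, and [cwt x j] is the
   coefficient of epsilon_j in the (gl_n-)weight of [x].  The string lengths
   epsilon_i and phi_i are determined by [ce] and [cf].                       *)
Record crystal (T : Type) := Crystal {
  carrier : set T;
  cwt : T -> nat -> nat;
  ce : nat -> T -> option T;
  cf : nat -> T -> option T }.

Definition crystal_closed (n : nat) (T : Type) (C : crystal T) : Prop :=
  forall i x y, 0 < i < n -> carrier C x ->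
    ce C i x = Some y \/ cf C i x = Some y -> carrier C y.

Definition crystal_iso (n : nat) (T U : Type) (C : crystal T) (D : crystal U)
    (phi : T -> U) : Prop :=
  [/\ crystal_closed n C /\ crystal_closed n D,
      set_bij (carrier C) (carrier D) phi,
      forall x, carrier C x -> forall j, cwt D (phi x) j = cwt C x j,
      forall i x, 0 < i < n -> carrier C x ->
        ce D i (phi x) = omap phi (ce C i x)
    & forall i x, 0 < i < n -> carrier C x ->
        cf D i (phi x) = omap phi (cf C i x)].

Definition crystal_isomorphic (n : nat) (T U : Type) (C : crystal T)
    (D : crystal U) : Prop :=
  exists phi : T -> U, crystal_iso n C D phi.

Definition crystal_sum (I T : Type) (A : set I) (C : I -> crystal T) :
  crystal (I * T) :=
  Crystal [set x | A x.1 /\ carrier (C x.1) x.2]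
    (fun x => cwt (C x.1) x.2)
    (fun i x => omap (pair x.1) (ce (C x.1) i x.2))
    (fun i x => omap (pair x.1) (cf (C x.1) i x.2)).

Definition crystal_copies (m : nat) (T : Type) (C : crystal T) :
  crystal (nat * T) := crystal_sum [set k | k < m] (fun=> C).

Definition crystal_times (T S : Type) (C : crystal T) (A : set S) :
  crystal (T * S) :=
  Crystal [set x | carrier C x.1 /\ A x.2]
    (fun x => cwt C x.1)
    (fun i x => omap (pair^~ x.2) (ce C i x.1))
    (fun i x => omap (pair^~ x.2) (cf C i x.1)).

Definition highest_weight (n : nat) (T : Type) (C : crystal T)
    (mu : seq nat) : set T :=
  [set x | [/\ carrier C x, forall i, 0 < i < n -> ce C i x = None
             & forall j, cwt C x j.+1 = nth 0 mu j]].

Definition content (T : tableau) (j : nat) : nat :=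
  count (fun x => ent T x.1 x.2 == j) (rd_boxes T).

Definition ssyt_e (i : nat) (T : tableau) : option tableau :=
  omap (fun x => set_range T x.1 x.2 x.2 i) (leftmost_minus T i (rd_boxes T)).

Definition ssyt_f (i : nat) (T : tableau) : option tableau :=
  omap (fun x => set_range T x.1 x.2 x.2 i.+1)
       (rightmost_plus T i (rd_boxes T)).

Definition B (n : nat) (mu : seq nat) : crystal tableau :=
  Crystal (SSYT n mu) content ssyt_e ssyt_f.

(* A tableau and, for each of its boxes, whether the box is a buoy, that is,
   whether a group starts there.                                              *)
Definition vst := (tableau * seq (seq bool))%type.

Definition is_buoy (V : vst) (r c : nat) : bool :=
  nth false (nth [::] V.2 r) c.

(* The default [true] makes the last box of a row an anchor.                  *)
Definition is_anchor (V : vst) (r c : nat) : bool :=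
  (c < size (nth [::] V.2 r)) && nth true (nth [::] V.2 r) c.+1.

(* Column of the anchor of the group with buoy (r, c).                        *)
Definition anchor_col (V : vst) (r c : nat) : nat :=
  c + find id (drop c.+1 (nth [::] V.2 r)).

Definition VSToo (lam : seq nat) : set vst :=
  [set V | [/\ semistandard lam V.1, shape V.2 = lam,
               forall r, r < size lam -> is_buoy V r 0
             & forall r c, c.+1 < nth 0 lam r -> ~~ is_buoy V r c.+1 ->
                 ent V.1 r c.+1 = ent V.1 r c]].

Definition VST (n : nat) (lam : seq nat) : set vst :=
  [set V | VSToo lam V /\ entries_le n V.1].

(* The letters of rd(V) sit in these boxes; there is one for each group.      *)
Definition buoys (V : vst) : seq (nat * nat) :=
  [seq x <- rd_boxes V.1 | is_buoy V x.1 x.2].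

Definition vst_size (V : vst) : nat := size (buoys V).

Definition vst_wt (V : vst) (j : nat) : nat :=
  count (fun x => ent V.1 x.1 x.2 == j) (buoys V).

Definition move_divider (V : vst) (r r' c : nat) : vst :=
  (V.1, mkfill (shape V.2) (fun s d =>
          if (s == r) && (d == c) then false
          else if (s == r') && (d == c) then true
          else is_buoy V s d)).

Definition change_group (V : vst) (r c v : nat) : vst :=
  (set_range V.1 r c (anchor_col V r c) v, V.2).

Definition vst_e (i : nat) (V : vst) : option vst :=
  omap (fun x => let: (r, c) := x in
          if (0 < r) && (ent V.1 r.-1 (anchor_col V r c) == i)
          then move_divider V r r.-1 c else change_group V r c i)
       (leftmost_minus V.1 i (buoys V)).

(* The box tested here is the one below the buoy (c is the column of the buoy),
   while [vst_e] tests the one above the anchor: the row below is weakly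
   increasing, so an i+1 below any box of the group occurs below its buoy.
   Testing below the anchor would turn 1|11 over 22 into 1|22 over 22, which is
   not semistandard.                                                          *)
Definition vst_f (i : nat) (V : vst) : option vst :=
  omap (fun x => let: (r, c) := x in
          if ent V.1 r.+1 c == i.+1
          then move_divider V r r.+1 c else change_group V r c i.+1)
       (rightmost_plus V.1 i (buoys V)).

Definition VST_crystal (n : nat) (lam : seq nat) : crystal vst :=
  Crystal (VST n lam) vst_wt vst_e vst_f.

(* A filling of lam/mu is stored as a filling of lam with 0 in the boxes of mu.
   The flag condition "entry < column" reads [<= c] as columns start at 0.    *)
Definition Fcs (lam mu : seq nat) : set tableau :=
  [set F | [/\ shape F = lam,
      forall r c, c < nth 0 mu r -> ent F r c = 0,
      forall r c, nth 0 mu r <= c < nth 0 lam r -> 0 < ent F r c <= c,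
      forall r c c', nth 0 mu r <= c -> c < c' -> c' < nth 0 lam r ->
        ent F r c < ent F r c'
    & forall r r' c, r < r' -> nth 0 mu r <= c -> c < nth 0 lam r' ->
        ent F r c <= ent F r' c]].

Fixpoint row_insert (x : nat) (s : seq nat) : seq nat * option nat :=
  if s is y :: s' then
    if x < y then (x :: s', Some y)
    else let: (t, z) := row_insert x s' in (y :: t, z)
  else ([:: x], None).

Fixpoint insert (x : nat) (T : tableau) : tableau :=
  if T is s :: T' then
    let: (t, z) := row_insert x s in
    t :: (if z is Some y then insert y T' else T')
  else [:: [:: x]].

Definition insertion_tableau (w : seq nat) : tableau :=
  foldl (fun T x => insert x T) [::] w.

Definition anchor_word (V : vst) (c : nat) : seq nat :=
  [seq ent V.1 r c | r <- rev (iota 0 (size V.1)) & is_anchor V r c].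

Definition ncols (V : vst) : nat := size (head [::] V.1).

Definition infl_tab (V : vst) (j : nat) : tableau :=
  insertion_tableau
    (flatten [seq anchor_word V c | c <- iota j (ncols V - j)]).

(* Boxes without an entry hold 0, so [.+1] both increases the entries kept from
   the previous step and puts 1 in the boxes that are new.  The innermost step
   of the [foldr] is the one for the last column.                             *)
Definition infl_fill (V : vst) : nat -> nat -> nat :=
  foldr (fun j F r c =>
           if j + nth 0 (shape (infl_tab V j)) r <= c < nth 0 (shape V.1) r
           then (F r c).+1 else 0)
        (fun _ _ => 0) (iota 0 (ncols V)).

(* b_1 x F_1, tagged with the shape of b_1.                                   *)
Definition inflation (V : vst) : seq nat * (tableau * tableau) :=
  let b := infl_tab V 0 in
  (shape b, (b, mkfill (shape V.1) (infl_fill V))).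

Definition ncard (T : choiceType) (A : set T) : nat := #|` fset_set A|.

(* Formal power series in x_1, x_2, ... over Z[alpha], alpha being ['X], are
   given by their coefficients: [m : seq nat] is the exponent of the monomial
   x_1 ^ m_0 * x_2 ^ m_1 * ..., trailing zeros being irrelevant.              *)
Definition series := seq nat -> {poly int}.

Local Open Scope ring_scope.

Definition gbar (lam : seq nat) : series := fun m =>
  \sum_(V \in [set V | VSToo lam V /\
                       forall j, vst_wt V j.+1 = nth 0%N m j])
    ('X^(sumn lam - vst_size V) : {poly int}).

Definition schur (mu : seq nat) : series := fun m =>
  \sum_(T \in [set T | semistandard mu T /\
                       forall j, content T j.+1 = nth 0%N m j]) (1 : {poly int}).

Local Close Scope ring_scope.

(* [ncard] and the sums over sets have their intended value on finite sets
   only; every set they are applied to is finite.                             *)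

Lemma finite_seqs (A : eqType) (P : set A) (k : nat) :
  finite_set P ->
  finite_set [set s : seq A | size s = k /\ forall x, x \in s -> P x].
Proof.
move=> finP; elim: k => [|k IH].
  apply: (sub_finite_set _ (finite_set1 [::])) => s [/eqP].
  by rewrite size_eq0 => /eqP.
have := finite_image2 cons finP IH; apply: sub_finite_set.
move=> [|x s] [//= [sz] h]; exists x; first by apply: h; rewrite inE eqxx.
by exists s => //; split=> // y ys; apply: h; rewrite inE ys orbT.
Qed.

Lemma finite_fillings (A : eqType) (P : set A) (lam : seq nat) :
  finite_set P ->
  finite_set [set T : seq (seq A) |
    shape T = lam /\
    forall s, s \in T -> forall x, x \in s -> P x].
Proof.
move=> finP; elim: lam => [|l lam IH].
  by apply: (sub_finite_set _ (finite_set1 [::])) => -[|s T] [].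
have := finite_image2 cons (finite_seqs l finP) IH; apply: sub_finite_set.
move=> [|s T] [//= [sl Tl] h]; exists s; first by split=> //; apply: h; rewrite inE eqxx.
by exists T => //; split=> // y yT; apply: h; rewrite inE yT orbT.
Qed.

Lemma finite_tableaux (N : nat) (lam : seq nat) :
  finite_set [set T : tableau | shape T = lam /\ entries_le N T].
Proof.
have := finite_fillings lam (finite_II N.+1); apply: sub_finite_set.
move=> T [sT bT]; split=> // s sT' x xs /=.
by have := bT (index s T) (index x s); rewrite /ent !nth_index.
Qed.

Lemma finite_dividers (lam : seq nat) :
  finite_set [set D : seq (seq bool) | shape D = lam].
Proof.
have := finite_fillings lam (finite_finset (X := [set: bool])).
by apply: sub_finite_set => D.
Qed.

Lemma finite_Fcs (lam mu : seq nat) : finite_set (Fcs lam mu).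
Proof.
apply: (sub_finite_set _ (finite_tableaux (sumn lam) lam)) => F [sF z b _ _].
split=> // r c; rewrite leqNgt; apply/negP => gt.
have [ltc|gec] := ltnP c (nth 0 lam r); last first.
  have : ent F r c = 0.
    rewrite /ent nth_default // (leq_trans _ gec) // -sF.
    have [rs|rs] := ltnP r (size F); first by rewrite (nth_map [::]).
    by rewrite !nth_default ?size_map.
  by move=> e; rewrite e in gt.
have [/z e|ge] := ltnP c (nth 0 mu r); first by rewrite e in gt.
have /andP[_ le] : 0 < ent F r c <= c by apply: b; rewrite ge.
have : nth 0 lam r <= sumn lam.
  have [rs|rs] := ltnP r (size lam); last by rewrite nth_default.
  by rewrite sumnE (big_nth 0) big_mkord (bigD1 (Ordinal rs)) //= leq_addr.
move=> le'; have := leq_trans (leq_trans gt le) (ltnW (leq_trans ltc le')).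
by rewrite ltnn.
Qed.

Lemma finite_SSYT (n : nat) (mu : seq nat) : finite_set (SSYT n mu).
Proof.
by apply: (sub_finite_set _ (finite_tableaux n mu)) => T [[sT _ _ _] bT].
Qed.

Lemma finite_VST (n : nat) (lam : seq nat) : finite_set (VST n lam).
Proof.
have := finite_setX (finite_tableaux n lam) (finite_dividers lam).
by apply: sub_finite_set => -[T D] [[[sT _ _ _] sD _ _] bT].
Qed.

Lemma finite_highest_weight (n : nat) (lam mu : seq nat) :
  finite_set (highest_weight n (VST_crystal n lam) mu).
Proof. by apply: (sub_finite_set _ (finite_VST n lam)) => V []. Qed.

Lemma finite_subparts (lam : seq nat) : finite_set (subparts lam).
Proof.
pose P k := [set s : seq nat |
  size s = k /\ forall x, x \in s -> [set y | y < (sumn lam).+1] x].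
have fin k : finite_set (\bigcup_(i in `I_k) P i).
  by apply: bigcup_finite => [|i _]; [exact: finite_II|exact/finite_seqs/finite_II].
have lesum r : nth 0 lam r <= sumn lam.
  have [rs|rs] := ltnP r (size lam); last by rewrite nth_default.
  by rewrite sumnE (big_nth 0) big_mkord (bigD1 (Ordinal rs)) //= leq_addr.
apply: (sub_finite_set _ (fin (size lam).+1)) => mu [/andP[_ nz] le].
exists (size mu) => /=.
  rewrite ltnS leqNgt; apply/negP => lt.
  have := le (size lam); rewrite (nth_default _ (leqnn _)) leqn0 => /eqP e.
  by move: nz; rewrite -e mem_nth.
split=> // x xm /=; rewrite ltnS.
by have := le (index x mu); rewrite nth_index // => /leq_trans; apply.
Qed.

Lemma mem_rd_boxes (T : tableau) (r c : nat) :
  is_part (shape T) -> c < size (nth [::] T r) -> (r, c) \in rd_boxes T.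
Proof.
move=> /andP[srt _] lt.
have rs : r < size T.
  by rewrite ltnNge; apply/negP => ge; rewrite nth_default in lt.
apply/flattenP; exists [seq (r', c) | r' <- rev (iota 0 (size T)) &
                                      c < size (nth [::] T r')]; last first.
  by apply: map_f; rewrite mem_filter lt mem_rev mem_iota.
apply: map_f; rewrite mem_iota /= add0n (leq_trans lt) //.
have /(_ 0 r) := sorted_leq_nth (fun y x z => (fun xy yz => leq_trans yz xy))
  leqnn 0 srt.
rewrite !inE !size_map rs (leq_ltn_trans (leq0n r) rs) => /(_ isT isT (leq0n r)).
by rewrite !(nth_map [::]) ?(leq_ltn_trans (leq0n r) rs) //= nth0.
Qed.

Lemma mem_buoys (lam : seq nat) (V : vst) (r c : nat) :
  is_part lam -> VSToo lam V -> c < nth 0 lam r ->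
  exists2 x, x \in buoys V & ent V.1 x.1 x.2 = ent V.1 r c.
Proof.
move=> plam [[sT _ _ _] sD b0 bS].
have szE d : d < nth 0 lam r -> (r, d) \in rd_boxes V.1.
  move=> lt; apply: mem_rd_boxes; rewrite ?sT //.
  have [rs|rs] := ltnP r (size V.1).
    by rewrite -sT (nth_map [::]) in lt.
  by rewrite -sT nth_default ?size_map in lt.
elim: c => [|c IH] lt.
  exists (r, 0) => //; rewrite mem_filter szE //= andbT; apply: b0.
  by rewrite ltnNge; apply/negP => ge; rewrite nth_default in lt.
have [bu|nb] := boolP (is_buoy V r c.+1).
  by exists (r, c.+1) => //; rewrite mem_filter /= bu szE.
by rewrite (bS _ _ lt nb); apply: IH; exact: ltnW.
Qed.

Lemma finite_gbar_index (lam m : seq nat) : is_part lam ->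
  finite_set [set V | VSToo lam V /\ forall j, vst_wt V j.+1 = nth 0 m j].
Proof.
move=> plam; apply: (sub_finite_set _ (finite_VST (size m) lam)).
move=> V [vV wV]; split=> // r c; rewrite leqNgt; apply/negP => gt.
have [[sT _ _ _] _ _ _] := vV.
have [ltc|gec] := ltnP c (nth 0 lam r); last first.
  have : ent V.1 r c = 0.
    rewrite /ent nth_default // (leq_trans _ gec) // -sT.
    have [rs|rs] := ltnP r (size V.1); first by rewrite (nth_map [::]).
    by rewrite !nth_default ?size_map.
  by move=> e; rewrite e in gt.
have [x xb xe] := mem_buoys plam vV ltc.
have := wV (ent V.1 r c).-1; rewrite (ltn_predK gt) nth_default; last first.
  by rewrite -ltnS (ltn_predK gt).
move/eqP; rewrite -leqn0 leqNgt -has_count => /hasP; apply.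
by exists x; rewrite ?xe.
Qed.

Lemma finite_schur_index (mu m : seq nat) : is_part mu ->
  finite_set [set T | semistandard mu T /\
                      forall j, content T j.+1 = nth 0 m j].
Proof.
move=> pmu; apply: (sub_finite_set _ (finite_SSYT (size m) mu)).
move=> T [ssT wT]; split=> // r c; rewrite leqNgt; apply/negP => gt.
have [sT _ _ _] := ssT.
have ltc : c < size (nth [::] T r).
  rewrite ltnNge; apply/negP => ge.
  by move: gt; rewrite /ent nth_default.
have := wT (ent T r c).-1; rewrite (ltn_predK gt) nth_default; last first.
  by rewrite -ltnS (ltn_predK gt).
move/eqP; rewrite -leqn0 leqNgt -has_count => /hasP; apply.
by exists (r, c); rewrite ?mem_rd_boxes ?sT //=.
Qed.

(* Main.v *)
Require Import Defs.
From mathcomp Require Import all_boot all_order all_algebra finmap.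
From mathcomp Require Import mathcomp_extra boolp classical_sets functions.
From mathcomp Require Import cardinality fsbigop zify.

(* Everything is reduced to highest weight elements.  Call w(V) the word of
   anchor entries of V, columns left to right, each bottom to top.

   Comparing, column by column, the signatures of the buoy word and of w(V)
   shows that e_i and f_i on V act on w(V) as the usual operators on words, and
   keep the number of anchors of every column: recolouring a group changes the
   letter of its anchor, and moving a divider replaces i by i+1 (or conversely)
   among the anchors of one column.  Row insertion also commutes with e_i and
   f_i, and the column reading word of a tableau inserts to that tableau, so
   that b_1 = P(w(V)) is transformed by the operators on B(mu).  As e_i and f_i
   act on a suffix of a word as e_i, f_i or the identity, the shapes of all the
   b_j, hence F_1, are constant along the crystal.

   If V is highest weight, then every suffix of w(V) is Yamanouchi; this forces
   row r of V to be filled with r, and mu_j(r) is the number of anchors of row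
   r in the columns >= j.  Then row r of F_1 lists the columns of the boxes of
   row r that are not anchors, which is a bijection with flagged tableaux.
   Raising and lowering extends injectivity, surjectivity and the properties of
   F_1 from highest weight elements to all elements. *)

(** Two mismatches shape the proof. The operators on V are governed by buoys, while inflation reads
    anchors. The running difference of the numbers of i and i+1 counts a group at its buoy for one
    word and at its anchor for the other, so the two walks differ only by the groups still open.
    Monotonicity of rows and columns shows that their extremal columns correspond nevertheless, and
    the test on the adjacent row decides which anchor column is the extremal one. Secondly, B(mu) is
    defined through the column reading of a tableau, whereas bumping is followed on the row reading;
    the operators have to be transported from one reading to the other. Semistandard tableaux need
    no separate study of their operators: they are the valued-set tableaux all of whose groups are
    single boxes. Finally, the bound n on the letters meets the fillings through the flag, which
    forbids entries in the first column: a filling exists only if mu has as many rows as lam. *)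

Set Implicit Arguments.
Unset Strict Implicit.
Unset Printing Implicit Defensive.

(** * Crystal operators on words *)

(* Number of uncanceled + (letters i) and - (letters i+1) of a word. *)
Fixpoint phi (i : nat) (w : seq nat) : nat :=
  if w is x :: v then
    if x == i then (phi i v).+1
    else if x == i.+1 then (phi i v).-1 else phi i v
  else 0.

Fixpoint eps (i : nat) (w : seq nat) : nat :=
  if w is x :: v then
    if (x == i.+1) && (phi i v == 0) then (eps i v).+1 else eps i v
  else 0.

(* [fstep i w w'] says f_i w = w', equivalently e_i w' = w: the letter acted
   on is preceded by no uncanceled - and followed by no uncanceled +. *)
Definition fstep (i : nat) (w w' : seq nat) : Prop :=
  exists a b, [/\ w = a ++ i :: b, w' = a ++ i.+1 :: b,
                  eps i a = 0 & phi i b = 0].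

(** Each cancellation removes one i and one i+1; additions replace the differences to stay in
    [nat]. *)
Lemma phi_eps_count i w :
  phi i w + count_mem i.+1 w = eps i w + count_mem i w.
Proof.
have Ei : (i == i.+1) = false by lia.
elim: w => //= x v IH; case: (x =P i) => [xi|ni].
  by rewrite xi Ei /=; lia.
by case: (x =P i.+1) => [xi|_] /=; case: (phi i v) IH => /= *; lia.
Qed.

(** The i+1 surviving in [u] cancel against the i surviving in [v]; the truncated subtractions count
    what is left. *)
Lemma phi_eps_cat i u v :
  phi i (u ++ v) = phi i u + (phi i v - eps i u) /\
  eps i (u ++ v) = eps i v + (eps i u - phi i v).
Proof.
elim: u => [|x u [IHp IHe]] /=; first by split; lia.
rewrite {}IHp {}IHe; have Ei : (i == i.+1) = false by lia.
case: (x =P i) => [xi|ni]; first by rewrite xi Ei /=; split; lia.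
case: (x =P i.+1) => /= [_|_]; last by split.
by case: (phi i u) => [|p] /=; split; do ?case: ifP; lia.
Qed.

Lemma phi_cat i u v : phi i (u ++ v) = phi i u + (phi i v - eps i u).
Proof. by have [] := phi_eps_cat i u v. Qed.

Lemma eps_cat i u v : eps i (u ++ v) = eps i v + (eps i u - phi i v).
Proof. by have [] := phi_eps_cat i u v. Qed.

Lemma phi_plus i v : phi i (i :: v) = (phi i v).+1.
Proof. by rewrite /= eqxx. Qed.

Lemma eps_plus i v : eps i (i :: v) = eps i v.
Proof. by rewrite /= eqn_leq ltnn andbF. Qed.

Lemma phi_minus i v : phi i (i.+1 :: v) = (phi i v).-1.
Proof. by rewrite /= eqxx eqn_leq ltnn. Qed.

Lemma eps_minus i v : eps i (i.+1 :: v) = (phi i v == 0) + eps i v.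
Proof. by rewrite /= eqxx /=; case: eqP. Qed.

Lemma phi_notin i w : i \notin w -> phi i w = 0.
Proof.
elim: w => //= x v IH; rewrite inE negb_or eq_sym => /andP[/negbTE-> /IH->].
by case: ifP.
Qed.

Lemma eps_notin i w : i.+1 \notin w -> eps i w = 0.
Proof.
by elim: w => //= x v IH; rewrite inE negb_or eq_sym => /andP[/negbTE-> /IH->].
Qed.

Lemma fstep_phi i w w' : fstep i w w' -> 0 < phi i w.
Proof.
by move=> [a [b [-> _ ea pb]]]; rewrite phi_cat phi_plus ea pb; lia.
Qed.

Lemma fstep_eps i w w' : fstep i w w' -> 0 < eps i w'.
Proof.
by move=> [a [b [_ -> ea pb]]]; rewrite eps_cat eps_minus ea pb; lia.
Qed.

Lemma cat_cons_split (T : Type) (x y : T) a1 b1 a2 b2 :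
  a1 ++ x :: b1 = a2 ++ y :: b2 ->
  [\/ exists c, a2 = a1 ++ x :: c /\ b1 = c ++ y :: b2,
      [/\ a1 = a2, x = y & b1 = b2] |
      exists c, a1 = a2 ++ y :: c /\ b2 = c ++ x :: b1].
Proof.
elim: a1 a2 => [|z a1 IH] [|t a2] //=.
- by case=> -> ->; constructor 2.
- by case=> -> ->; constructor 1; exists a2.
- by case=> -> <-; constructor 3; exists a1.
- case=> -> /IH[[c [-> ->]]|[-> -> ->]|[c [-> ->]]].
  + by constructor 1; exists c.
  + by constructor 2.
  + by constructor 3; exists c.
Qed.

(** Of two candidate positions, the right one would be an uncanceled i after the left one: the
    letters in between leave no i+1 that could cancel it. *)
Lemma fstep_det i w w1 w2 : fstep i w w1 -> fstep i w w2 -> w1 = w2.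
Proof.
move=> [a1 [b1 [-> -> ea1 pb1]]] [a2 [b2 [E -> ea2 pb2]]].
case: (cat_cons_split E) => [[c [Ea Eb]]|[-> _ -> //]|[c [Ea Eb]]].
- move: ea2 pb1; rewrite Ea Eb eps_cat phi_cat eps_plus !phi_plus; lia.
- move: ea1 pb2; rewrite Ea Eb eps_cat phi_cat eps_plus !phi_plus; lia.
Qed.

Lemma fstep_codet i w w1 w2 : fstep i w1 w -> fstep i w2 w -> w1 = w2.
Proof.
move=> [a1 [b1 [-> -> ea1 pb1]]] [a2 [b2 [-> E ea2 pb2]]].
case: (cat_cons_split E) => [[c [Ea Eb]]|[-> _ -> //]|[c [Ea Eb]]].
- move: ea2 pb1; rewrite Ea Eb eps_cat phi_cat eps_minus !phi_minus; lia.
- move: ea1 pb2; rewrite Ea Eb eps_cat phi_cat eps_minus !phi_minus; lia.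
Qed.

Lemma fstep_ex i w : 0 < phi i w -> exists w', fstep i w w'.
Proof.
suff: 0 < phi i w -> exists a b, [/\ w = a ++ i :: b, eps i a = 0 & phi i b = 0].
  by move=> H /H [a [b [-> ea pb]]]; exists (a ++ i.+1 :: b), a, b.
elim: w => //= x v IH; case: (x =P i) => [->|ni].
  have [pv _|pv _] := posnP (phi i v); first by exists [::], v.
  by have [a [b [-> ea pb]]] := IH pv; exists (i :: a), b; rewrite eps_plus.
case: (x =P i.+1) => [->|ni1] pv; last first.
  have [a [b [-> ea pb]]] := IH pv; exists (x :: a), b; split=> //=.
  by move/eqP/negbTE: ni1 => ->.
have [|a [b [E ea pb]]] := IH; first by lia.
exists (i.+1 :: a), b; split=> //; first by rewrite E.
by move: pv; rewrite E phi_cat phi_plus eps_minus ea pb; case: eqP; lia.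
Qed.

(** * Tensor product rule and passage to suffixes *)

Lemma fstep_catl i u u' v :
  fstep i u u' -> phi i v <= eps i u -> fstep i (u ++ v) (u' ++ v).
Proof.
move=> [a [b [-> -> ea pb]]]; rewrite eps_cat eps_plus ea => le.
exists a, (b ++ v); rewrite -!catA /=; split=> //.
by rewrite phi_cat pb; move: le; rewrite sub0n; lia.
Qed.

Lemma fstep_catr i u v v' :
  fstep i v v' -> eps i u < phi i v -> fstep i (u ++ v) (u ++ v').
Proof.
move=> [a [b [-> -> ea pb]]]; rewrite phi_cat phi_plus ea pb => lt.
by exists (u ++ a), b; rewrite !catA; split=> //; rewrite eps_cat ea; lia.
Qed.

Lemma fstep_cat_inv i u v w' : fstep i (u ++ v) w' ->
  (exists u', [/\ fstep i u u', w' = u' ++ v & phi i v <= eps i u]) \/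
  (exists v', [/\ fstep i v v', w' = u ++ v' & eps i u < phi i v]).
Proof.
move=> st; have := fstep_phi st; rewrite phi_cat => gt0.
have [le|lt] := leqP (phi i v) (eps i u); [left|right].
  have [|u' su] := @fstep_ex i u; first by lia.
  by exists u'; split=> //; apply: (fstep_det st); exact: fstep_catl.
have [|v' sv] := @fstep_ex i v; first by lia.
by exists v'; split=> //; apply: (fstep_det st); exact: fstep_catr.
Qed.

Lemma fstep_size i w w' : fstep i w w' -> size w' = size w.
Proof. by move=> [a [b [-> -> _ _]]]; rewrite !size_cat. Qed.

Lemma fstep_sumn i w w' : fstep i w w' -> sumn w' = (sumn w).+1.
Proof. by move=> [a [b [-> -> _ _]]]; rewrite !sumn_cat /=; lia. Qed.

(** A suffix of the part before the letter acted on inherits [eps] zero, so the same letter is acted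
    on in any suffix containing it. This makes the shapes of all b_j invariant. *)
Lemma fstep_drop i w w' k : fstep i w w' ->
  drop k w' = drop k w \/ fstep i (drop k w) (drop k w').
Proof.
move=> [a [b [-> -> ea pb]]]; rewrite !drop_cat.
case: ltnP => [lt|]; last first.
  rewrite leq_eqVlt => /orP[/eqP<-|lt].
    by right; rewrite subnn; exists [::], b.
  by left; rewrite -(subnSK lt).
right; exists (drop k a), b; split=> //.
by move: ea; rewrite -{1}(cat_take_drop k a) eps_cat; lia.
Qed.

(** * Correctness of the one-pass signature *)

Definition letters (T : tableau) (w : seq (nat * nat)) : seq nat :=
  [seq ent T x.1 x.2 | x <- w].

(** The list of minuses is a stack: a new i cancels its top, the rightmost surviving i+1, so the
    leftmost one, on which e_i acts, stays at the bottom until the stack is emptied. *)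
Lemma signatureP T i w :
  let: (p, m) := signature T i w in
  [/\ size p = phi i (letters T w), size m = eps i (letters T w),
      forall x, ohead p = Some x -> exists a b,
        [/\ w = a ++ x :: b, ent T x.1 x.2 = i,
            eps i (letters T a) = 0 & phi i (letters T b) = 0]
    & forall x, ohead (rev m) = Some x -> exists a b,
        [/\ w = a ++ x :: b, ent T x.1 x.2 = i.+1,
            eps i (letters T a) = 0 & phi i (letters T b) = 0]].
Proof.
have Sn : (i.+1 == i) = false by lia.
have nS : (i == i.+1) = false by lia.
have rev_ohead (m : seq (nat * nat)) x y : m != [::] ->
    ohead (rev (y :: m)) = Some x -> ohead (rev m) = Some x.
  by case/lastP: m => // m z _; rewrite rev_cons rev_rcons.
elim/last_ind: w => [//|w y]; rewrite /signature -cats1 foldl_cat /=.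
rewrite -/(signature T i w); case: (signature T i w) => p m [sp sm hp hm].
rewrite /letters !map_cat -/(letters T w) /=.
(* Appending [y] keeps the part after [x] free of uncanceled i, because either [y] is not i or an
   uncanceled i+1 of that part absorbs it. *)
have ext x a b : w = a ++ x :: b -> phi i (ent T x.1 x.2 :: letters T b) <= 1 ->
    phi i (letters T b) = 0 -> 0 < eps i (letters T b) \/ ent T y.1 y.2 != i ->
    exists a' b', [/\ w ++ [:: y] = a' ++ x :: b', a' = a &
                      phi i (letters T b') = 0].
  move=> -> _ pb H; exists a, (b ++ [:: y]); rewrite -catA; split=> //.
  rewrite /letters map_cat phi_cat -/(letters T b) pb /=.
  by case: H => [|/negbTE->]; do ?case: ifP; lia.
have epw a b x : w = a ++ x :: b -> eps i (letters T a) = 0 ->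
    eps i (letters T w) = eps i (ent T x.1 x.2 :: letters T b).
  by move=> -> ea; rewrite /letters map_cat map_cons eps_cat -/(letters T a) ea addn0.
have [yi|ni] := eqVneq (ent T y.1 y.2) i.
  case: m sm hm => [|z m] sm hm /=.
    split; rewrite ?phi_cat ?eps_cat -?sp -?sm /= ?yi ?eqxx ?nS //=; try lia.
    by move=> x [<-]; exists w, [::]; rewrite -sm.
  split; rewrite ?phi_cat ?eps_cat -?sp -?sm /= ?yi ?eqxx ?nS //=; try lia.
    move=> x /hp[a [b [Ew xi ea pb]]].
    case: (ext x a b) => //; first by rewrite xi phi_plus pb.
      by left; move: (epw _ _ _ Ew ea); rewrite -sm xi eps_plus => <-.
    by move=> a' [b' [-> -> pb']]; exists a, b'.
  (* The new i cancels the top [z]. As [m] is nonempty, the leftmost survivor is another letter, and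
     [z] is an uncanceled i+1 to its right. *)
  move=> x hx; have m0 : m != [::] by case: (m) hx.
  have /hm[a [b [Ew xi ea pb]]] : ohead (rev (z :: m)) = Some x.
    by case/lastP: (m) hx m0 => // m' t; rewrite rev_cons !rev_rcons.
  case: (ext x a b) => //; first by rewrite xi phi_minus pb.
    left; move: (epw _ _ _ Ew ea); rewrite -sm xi eps_minus pb eqxx /=.
    by case: (m) m0 => //= ? ? _; lia.
  by move=> a' [b' [-> -> pb']]; exists a, b'.
have hp' x : ohead p = Some x -> exists a b,
    [/\ w ++ [:: y] = a ++ x :: b, ent T x.1 x.2 = i,
        eps i (letters T a) = 0 & phi i (letters T b) = 0].
  move=> /hp[a [b [Ew xi ea pb]]].
  case: (ext x a b) => //; [by rewrite xi phi_plus pb|by right|].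
  by move=> a' [b' [-> -> pb']]; exists a, b'.
have hm' x : ohead (rev m) = Some x -> exists a b,
    [/\ w ++ [:: y] = a ++ x :: b, ent T x.1 x.2 = i.+1,
        eps i (letters T a) = 0 & phi i (letters T b) = 0].
  move=> /hm[a [b [Ew xi ea pb]]].
  case: (ext x a b) => //; [by rewrite xi phi_minus pb|by right|].
  by move=> a' [b' [-> -> pb']]; exists a, b'.
have [yi|ni1] := eqVneq (ent T y.1 y.2) i.+1.
  split=> //; rewrite ?phi_cat ?eps_cat -?sp -?sm /= ?yi ?Sn ?eqxx /=; try lia.
  have [m0|m0] := eqVneq m [::]; last by move=> x /(rev_ohead _ _ _ m0)/hm'.
  rewrite m0 => x [<-]; exists w, [::]; split=> //.
  by rewrite -sm m0.
by split=> //; rewrite ?phi_cat ?eps_cat -?sp -?sm /= ?(negbTE ni) ?(negbTE ni1) /=; lia.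
Qed.

Lemma rightmost_plusP T i w x : rightmost_plus T i w = Some x ->
  exists a b, [/\ w = a ++ x :: b, ent T x.1 x.2 = i,
                  eps i (letters T a) = 0 & phi i (letters T b) = 0].
Proof.
rewrite /rightmost_plus; have := signatureP T i w.
by case: signature => p m [_ _ + _] /= => /[apply].
Qed.

Lemma rightmost_plus_none T i w :
  rightmost_plus T i w = None -> phi i (letters T w) = 0.
Proof.
rewrite /rightmost_plus; have := signatureP T i w.
by case: signature => -[|x p] m [<- _ _ _].
Qed.

Lemma leftmost_minusP T i w x : leftmost_minus T i w = Some x ->
  exists a b, [/\ w = a ++ x :: b, ent T x.1 x.2 = i.+1,
                  eps i (letters T a) = 0 & phi i (letters T b) = 0].
Proof.
rewrite /leftmost_minus; have := signatureP T i w.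
by case: signature => p m [_ _ _ +] /= => /[apply].
Qed.

Lemma leftmost_minus_none T i w :
  leftmost_minus T i w = None -> eps i (letters T w) = 0.
Proof.
rewrite /leftmost_minus; have := signatureP T i w.
case: signature => p m [_ <- _ _] /=; case/lastP: m => // m x.
by rewrite rev_rcons.
Qed.

(** * Row insertion *)

Lemma sorted_leq_cat (u v : seq nat) : sorted leq (u ++ v) ->
  [/\ sorted leq u, sorted leq v & forall x y, x \in u -> y \in v -> x <= y].
Proof.
rewrite !(sorted_pairwise leq_trans) pairwise_cat => /and3P[/allrelP uv -> ->].
by split.
Qed.

Lemma sorted_leq_catP (u v : seq nat) :
  sorted leq u -> sorted leq v ->
  (forall x y, x \in u -> y \in v -> x <= y) -> sorted leq (u ++ v).
Proof.
rewrite !(sorted_pairwise leq_trans) pairwise_cat => -> -> uv.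
by rewrite /= andbT; apply/allrelP.
Qed.

(** In a weakly increasing word every i precedes every i+1, so nothing cancels. *)
Lemma phi_sorted i s : sorted leq s -> phi i s = count_mem i s.
Proof.
elim: s => //= x s IH xs; rewrite (IH (path_sorted xs)).
case: (x =P i) => [xi|ni] //=; case: (x =P i.+1) => [xi|_] //=.
suff /count_memPn -> : i \notin s by [].
apply/negP => ins; have := order_path_min leq_trans xs.
by move=> /allP /(_ _ ins); rewrite xi ltnn.
Qed.

Lemma eps_sorted i s : sorted leq s -> eps i s = count_mem i.+1 s.
Proof. by move=> ss; have := phi_eps_count i s; rewrite phi_sorted //; lia. Qed.

Lemma fstep_sorted i s s' : sorted leq s -> fstep i s s' ->
  sorted leq s' /\ exists a b,
  [/\ s = a ++ i :: b, s' = a ++ i.+1 :: b,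
      forall x, x \in a -> x <= i & forall x, x \in b -> i < x].
Proof.
move=> ss [a [b [E E' ea pb]]]; move: ss; rewrite E E' => /sorted_leq_cat[sa sib ab].
have leb x : x \in b -> i <= x.
  by move=> xb; have /= /(order_path_min leq_trans) /allP -> := sib.
have ib : i \notin b.
  move: pb; rewrite phi_sorted; last exact: path_sorted sib.
  by move/count_memPn.
have gtb x : x \in b -> i < x.
  by move=> xb; rewrite ltn_neqAle leb // andbT; apply: contraNneq ib => ->.
have lea x : x \in a -> x <= i by move=> xa; apply: ab; rewrite ?inE ?eqxx.
split; last by exists a, b.
apply: sorted_leq_catP => //=.
  rewrite (path_sortedE leq_trans) (path_sorted sib) andbT.
  by apply/allP => x /gtb.
move=> x y /lea xi; rewrite inE => /orP[/eqP->|/gtb]; lia.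
Qed.

Lemma row_insert_cat x u v : all (leq^~ x) u ->
  row_insert x (u ++ v) = (u ++ (row_insert x v).1, (row_insert x v).2).
Proof.
elim: u => [|y u IH] /= => [_|/andP[yx /IH->]]; first by case: row_insert.
by rewrite ltnNge yx.
Qed.

Lemma row_insertE x s :
  row_insert x s = (set_nth 0 s (find (ltn x) s) x,
    if find (ltn x) s < size s then Some (nth 0 s (find (ltn x) s)) else None).
Proof.
by elim: s => //= y s ->; case: ltnP => //= _; rewrite ltnS; case: ifP.
Qed.

Lemma row_split x s : sorted leq s -> exists u v,
  [/\ s = u ++ v, all (leq^~ x) u & all (ltn x) v].
Proof.
elim: s => [|y s IH] /= ss; first by exists [::], [::].
have [u [v [E hu hv]]] := IH (path_sorted ss).
have [yx|xy] := leqP y x; first by exists (y :: u), v; rewrite E /= yx.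
exists [::], (y :: s); split=> //=; rewrite xy /=; apply/allP => z zs.
have := order_path_min leq_trans ss => /allP /(_ _ zs); exact: leq_trans.
Qed.

Lemma row_insert_count x s a :
  count a (seq_of_opt (row_insert x s).2 ++ (row_insert x s).1) = count a (s ++ [:: x]).
Proof.
elim: s => //= y s; case: ltnP => /= _ IH.
  by rewrite count_cat /= addn0 (addnC (count a s)).
by rewrite -IH; case: row_insert => t [z|] //=; rewrite addnCA.
Qed.

Lemma row_insert_sorted x s : sorted leq s -> sorted leq (row_insert x s).1.
Proof.
move=> ss; have [u [v [E hu hv]]] := row_split x ss.
rewrite E row_insert_cat //=; move: ss; rewrite E => /sorted_leq_cat[su sv uv].
have {uv} ux w : w \in u -> w <= x by move=> /(allP hu).
case: v sv hv {E} => [|y v] /= sv hv.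
  by apply: sorted_leq_catP => // w w'; rewrite inE => /ux wx /eqP->.
have /andP[xy hv'] := hv; rewrite xy /=; apply: sorted_leq_catP => //=.
  rewrite (path_sortedE leq_trans) (path_sorted sv) andbT.
  by apply/allP => w /(allP hv') /ltnW.
move=> w w' /ux wx; rewrite inE => /orP[/eqP->//|/(allP hv') /= xw]; lia.
Qed.

(** The two words are Knuth equivalent. The equality is checked directly, since in sorted words only
    the numbers of i and i+1 matter. *)
Lemma row_insert_phi i x s : sorted leq s ->
  phi i (seq_of_opt (row_insert x s).2 ++ (row_insert x s).1) = phi i (s ++ [:: x]).
Proof.
move=> ss; have st := row_insert_sorted x ss.
rewrite !phi_cat (phi_sorted i ss) (phi_sorted i st) (eps_sorted i ss).
have [u [v [E hu hv]]] := row_split x ss.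
rewrite E row_insert_cat //= !count_cat.
have cu j : x < j -> count_mem j u = 0.
  by move=> xj; apply/count_memPn/negP => /(allP hu) /=; lia.
case: v E hv => [|y v] E /= hv.
  have := cu i; have := cu i.+1.
  have [xi|xi] := eqVneq x i; have [xS|xS] := eqVneq x i.+1 => /=; lia.
have /andP[xy hv'] := hv; rewrite xy /=.
have cv j : j < y -> count_mem j v = 0.
  move=> jy; apply/count_memPn/negP => jv; move: ss; rewrite E.
  by case/sorted_leq_cat => _ /= /(order_path_min leq_trans) /allP /(_ _ jv); lia.
have := cu i; have := cu i.+1; have := cv i; have := cv i.+1.
have [yi|yi] := eqVneq y i; have [yS|yS] := eqVneq y i.+1 => /=;
have [xi|xi] := eqVneq x i; have [xS|xS] := eqVneq x i.+1 => /=; lia.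
Qed.

Lemma row_insert_eps i x s : sorted leq s ->
  eps i (seq_of_opt (row_insert x s).2 ++ (row_insert x s).1) = eps i (s ++ [:: x]).
Proof.
move=> ss; have := row_insert_phi i x ss.
have := phi_eps_count i (seq_of_opt (row_insert x s).2 ++ (row_insert x s).1).
rewrite !row_insert_count => H1 H2; have := phi_eps_count i (s ++ [:: x]).
by rewrite -H2 => H3; apply: (@addIn (count_mem i (s ++ [:: x]))); rewrite -H1 -H3.
Qed.

Lemma row_insert_size x s :
  size (row_insert x s).1 = size s + ~~ (row_insert x s).2.
Proof.
have := row_insert_count x s predT; rewrite !count_predT !size_cat /=.
by case: (row_insert x s).2 => [z|] /=; lia.
Qed.

Lemma row_insert_bump x s z : (row_insert x s).2 = Some z -> x < z /\ z \in s.
Proof.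
elim: s => //= y s IH; case: ltnP => [xy [<-]|_]; first by rewrite mem_head.
by case: row_insert IH => t z' /= IH /IH[-> zs]; rewrite inE zs orbT.
Qed.

Lemma row_insert_mem x s y : y \in (row_insert x s).1 -> y = x \/ y \in s.
Proof.
elim: s => /= [|z s IH]; first by rewrite inE => /eqP; left.
case: ltnP => [_|_]; first by rewrite !inE => /orP[/eqP|->]; [left|rewrite orbT; right].
case: row_insert IH => t z' /= IH; rewrite !inE => /orP[->|/IH[->|->]];
by [left|right; rewrite ?orbT].
Qed.

(** Acting and bumping interfere in two ways only: the letter acted on may be the one that [x]
    bumps, or [x] is i and bumps the i+1 next to it. Elsewhere the same letter is bumped before and
    after. *)
Lemma row_insert_fstep i x s w' : sorted leq s -> fstep i (s ++ [:: x]) w' ->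
  exists s' x', [/\ w' = s' ++ [:: x'], sorted leq s', size s' = size s,
    isSome (row_insert x' s').2 = isSome (row_insert x s).2 &
    fstep i (seq_of_opt (row_insert x s).2 ++ (row_insert x s).1)
            (seq_of_opt (row_insert x' s').2 ++ (row_insert x' s').1)].
Proof.
move=> ss /fstep_cat_inv[[s' [st -> le]]|[v' [st -> lt]]].
  have [ss' [a [b [E E' ha hb]]]] := fstep_sorted ss st.
  suff [H1 H2] : isSome (row_insert x s').2 = isSome (row_insert x s).2 /\
    fstep i (seq_of_opt (row_insert x s).2 ++ (row_insert x s).1)
            (seq_of_opt (row_insert x s').2 ++ (row_insert x s').1).
    by exists s', x; split=> //; exact: fstep_size st.
  have [xi|ix|xi] := ltngtP x i.
  (* If [x] is at least every letter of [a], it bumps the very letter acted on, and f_i acts on the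
     bumped letter, now in front. Otherwise it bumps the same letter of [a] before and after. *)
  - have [alx|] := boolP (all (leq^~ x) a).
      rewrite E E' !row_insert_cat //= xi (leqW xi); split=> //.
      exists [::], (a ++ x :: b); split=> //; apply: phi_notin.
      rewrite mem_cat inE !negb_or; apply/and3P; split; last 2 first.
      + by rewrite gtn_eqF.
      + by apply/negP => /hb; rewrite ltnn.
      + by apply/negP => /(allP alx) /=; lia.
    have [|a1 [[|y a2] [Ea ha1 ha2]]] := @row_split x a.
    + by move: ss; rewrite E => /sorted_leq_cat[].
    + by rewrite Ea cats0 ha1.
    move=> _; have xy : x < y by move: ha2 => /andP[].
    rewrite E E' Ea -!catA !(row_insert_cat _ ha1) /= xy; split=> //.
    exists (y :: a1 ++ x :: a2), b; split; try by rewrite /= -!catA.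
      apply: eps_notin; rewrite !(inE, mem_cat); apply/negP => H.
      suff : i.+1 <= i by rewrite ltnn.
      case/or4P: H => [H|H|/eqP Sx|H]; [ | |lia|]; apply: ha;
      by rewrite Ea !(inE, mem_cat) H ?orbT.
    by apply: phi_notin; apply/negP => /hb; rewrite ltnn.
  (* Here [x] passes [i] and [i.+1] alike and is inserted in [b]. *)
  - have al j : j <= x -> all (leq^~ x) (a ++ [:: j]).
      move=> jx; rewrite all_cat /= jx !andbT; apply/allP => y /ha /=; lia.
    rewrite E E' [a ++ i :: b](catA a [:: i] b) [a ++ i.+1 :: b](catA a [:: i.+1] b).
    rewrite (row_insert_cat _ (al _ (ltnW ix))) (row_insert_cat _ (al _ ix)).
    split=> //=.
    exists (seq_of_opt (row_insert x b).2 ++ a), (row_insert x b).1.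
    rewrite -!catA /=; split=> //.
      apply: eps_notin; rewrite mem_cat negb_or; apply/andP; split.
        case Eb: (row_insert x b).2 => [z|] //=; rewrite inE.
        by have [xz _] := row_insert_bump Eb; rewrite ltn_eqF //; lia.
      by apply/negP => /ha; rewrite ltnn.
    by apply: phi_notin; apply/negP => /row_insert_mem[Ex|/hb]; lia.
  (* With [x = i] the tensor rule forces an i+1 in the row, hence directly after the i acted on.
     Before and after f_i an i+1 is bumped, and the new row ends its run of i with two i, of which
     f_i raises the second. *)
  - move: le; rewrite xi /= eqxx => le.
    have Sb : i.+1 \in b.
      move: le; rewrite eps_sorted // -has_pred1 has_count E count_cat /=.
      have /count_memPn -> : i.+1 \notin a by apply/negP => /ha; rewrite ltnn.
      by rewrite eqn_leq ltnn andbF.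
    have [b' Eb] : exists b', b = i.+1 :: b'.
      case: (b) ss Sb hb E => //= y b' ss; rewrite inE => /orP[/eqP<-|Sb] hb E.
        by exists b'.
      exists b'; congr cons; move: ss; rewrite E => /sorted_leq_cat[_ /= /andP[_]].
      move=> /(order_path_min leq_trans) /allP /(_ _ Sb) le1 _.
      by have := hb y (mem_head _ _); lia.
    have al : all (leq^~ i) a by apply/allP => y /ha.
    rewrite E E' Eb !row_insert_cat //= ltnSn ltnn /=; split=> //.
    exists (i.+1 :: a ++ [:: i]), b'; split; try by rewrite /= -!catA.
      rewrite eps_minus phi_cat eps_cat phi_plus eps_plus (@eps_notin i a) /=.
        by case: eqP; lia.
      by apply/negP => /ha; rewrite ltnn.
    apply: phi_notin; apply/negP => ib; have := hb i.
    by rewrite Eb inE ib orbT ltnn => /(_ isT).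
(* Now f_i acts on the inserted letter. The row then contains no i+1, so i and i+1 are inserted at
   the same position. *)
have [Ex Ev] : x = i /\ v' = [:: i.+1].
  have [a [b [E1 -> _ _]]] := st; case: a E1 => [[-> <-]//|y [|z a]] //.
rewrite {}Ev {}Ex {v' st} in lt *; exists s, i.+1.
have [u [v [E hu hv]]] := row_split i ss.
have Sv : all (ltn i.+1) v.
  apply/allP => y yv; have := allP hv _ yv; rewrite /= leq_eqVlt => /orP[/eqP Sy|//].
  move: lt; rewrite eps_sorted // /= eqxx ltnS leqn0 E count_cat addn_eq0.
  by move=> /andP[_ /eqP/count_memPn]; rewrite Sy yv.
have hu' : all (leq^~ i.+1) u by apply/allP => y /(allP hu) /= /leqW.
rewrite {}E in ss *; rewrite !row_insert_cat //.
have Su : i.+1 \notin u by apply/negP => /(allP hu) /=; rewrite ltnn.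
case: v Sv ss {hv lt} => [|y v] /= => [_ ss|/andP[Sy Sv] ss].
  by split=> //; exists u, [::]; rewrite !cats1 eps_notin.
rewrite Sy (ltnW Sy); split=> //; exists (y :: u), v; split=> //.
  by apply: eps_notin; rewrite inE negb_or Su andbT ltn_eqF.
by apply: phi_notin; apply/negP => /(allP Sv) /=; lia.
Qed.

Arguments phi : simpl never.
Arguments eps : simpl never.

Definition rrw (T : tableau) : seq nat := flatten (rev T).

Lemma rrw_cons s T : rrw (s :: T) = rrw T ++ s.
Proof. by rewrite /rrw rev_cons flatten_rcons. Qed.

Lemma insert_cons x s T : insert x (s :: T) =
  (row_insert x s).1 :: (if (row_insert x s).2 is Some y then insert y T else T).
Proof. by rewrite /=; case: row_insert. Qed.

Lemma insert_count x T a :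
  count a (rrw (insert x T)) = count a (rrw T ++ [:: x]).
Proof.
elim: T x => [//|s T IH] x; rewrite insert_cons !rrw_cons.
rewrite -catA [RHS]count_cat -row_insert_count count_cat.
case: (row_insert x s).2 => [y|] //=.
by rewrite IH count_cat /= addn0 addnA.
Qed.

Lemma insert_rows x T :
  all (sorted leq) T -> all (sorted leq) (insert x T).
Proof.
elim: T x => [//|s T IH] x /andP[ss sT]; rewrite insert_cons /=.
by rewrite row_insert_sorted //=; case: (row_insert x s).2 => [y|] //; exact: IH.
Qed.

Lemma insert_phi i x T : all (sorted leq) T ->
  phi i (rrw (insert x T)) = phi i (rrw T ++ [:: x]) /\
  eps i (rrw (insert x T)) = eps i (rrw T ++ [:: x]).
Proof.
elim: T x => [//|s T IH] x /andP[ss sT]; rewrite insert_cons !rrw_cons -catA.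
rewrite [in RHS]phi_cat [X in _ /\ _ = X]eps_cat.
rewrite -(row_insert_phi i x ss) -(row_insert_eps i x ss) -phi_cat -eps_cat.
case: (row_insert x s).2 => [y|] //=; have [IHp IHe] := IH y sT.
rewrite -[y :: _]cat1s catA.
by split; [rewrite phi_cat [RHS]phi_cat IHp IHe|rewrite eps_cat [RHS]eps_cat IHe].
Qed.

Lemma rrw_inj T T' : shape T = shape T' -> rrw T = rrw T' -> T = T'.
Proof.
move=> sh eq; apply: (can_inj revK); apply: eq_from_flatten_shape => //.
by rewrite /shape !map_rev -/(shape T) sh.
Qed.

Lemma rrw_fstep i T u : all (sorted leq) T -> fstep i (rrw T) u ->
  exists T', [/\ u = rrw T', all (sorted leq) T' & shape T' = shape T].
Proof.
elim: T u => [|s T IH] u; first by move=> _ [[|? ?] [b []]].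
move=> /andP[ss sT]; rewrite rrw_cons => /fstep_cat_inv[[u' [st -> _]]|[v [st -> _]]].
  have [T' [-> sT' shT']] := IH _ sT st.
  by exists (s :: T'); rewrite rrw_cons; split=> //=; [apply/andP|rewrite shT'].
have [sv _] := fstep_sorted ss st.
by exists (v :: T); rewrite rrw_cons; split=> //=; [apply/andP|rewrite (fstep_size st)].
Qed.

(** Induction on the rows: the row word ends with the first row [s], so f_i acts either in the rows
    below or in [s] followed by [x]. The first row is [row_insert_fstep], and the bumped letter goes
    to the induction hypothesis. *)
Lemma insert_fstep i x T w' : all (sorted leq) T -> fstep i (rrw T ++ [:: x]) w' ->
  exists T' x', [/\ w' = rrw T' ++ [:: x'], all (sorted leq) T',
    shape T' = shape T, shape (insert x' T') = shape (insert x T) &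
    fstep i (rrw (insert x T)) (rrw (insert x' T'))].
Proof.
elim: T x w' => [|s T IH] x w'.
  move=> _ st; have [a [b [E E' _ _]]] := st.
  have -> : w' = [:: i.+1] by rewrite E'; case: a E {E'} => [|y [|z a]] //= [_ <-].
  exists [::], i.+1; split=> //; have -> : x = i by case: a E {E'} => [[]|? [|]].
  by exists [::], [::].
move=> /andP[ss sT]; rewrite rrw_cons -catA.
have rp := row_insert_phi i x ss.
move=> /fstep_cat_inv[[u [st -> le]]|[v [st -> lt]]].
  have [T1 [Eu sT1 shT1]] := rrw_fstep sT st.
  suff [H1 H2] : shape (insert x (s :: T1)) = shape (insert x (s :: T)) /\
      fstep i (rrw (insert x (s :: T))) (rrw (insert x (s :: T1))).
    exists (s :: T1), x; rewrite rrw_cons -catA -Eu; split=> //; first exact/andP.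
    by rewrite /= shT1.
  rewrite !insert_cons; move: rp; case: (row_insert x s) => t [y|] /= rp; last first.
    rewrite shT1 !rrw_cons -Eu; split=> //.
    by apply: fstep_catl => //; rewrite rp.
  rewrite !rrw_cons; move: rp le; rewrite -[y :: t]cat1s phi_cat => rp le.
  have st' : fstep i (rrw T ++ [:: y]) (u ++ [:: y]) by apply: fstep_catl => //; lia.
  have [T2 [y2 [E2 sT2 shT2 sh2 st2]]] := IH _ _ sT st'.
  move: E2; rewrite !cats1 => /rcons_inj[E2 Ey]; rewrite -Ey in sh2 st2.
  have ET : T2 = T1 by apply: rrw_inj; rewrite ?shT2 ?shT1 // -E2.
  rewrite ET in st2 sh2; rewrite sh2; split=> //; apply: fstep_catl => //.
  by have [_ ->] := insert_phi i y sT; rewrite eps_cat; lia.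
have [s' [x' [-> ss' szs' isz st1]]] := row_insert_fstep ss st.
suff [H1 H2] : shape (insert x' (s' :: T)) = shape (insert x (s :: T)) /\
    fstep i (rrw (insert x (s :: T))) (rrw (insert x' (s' :: T))).
  exists (s' :: T), x'; rewrite rrw_cons -catA; split=> //; first exact/andP.
  by rewrite /= szs'.
have szt : size (row_insert x' s').1 = size (row_insert x s).1.
  by rewrite !row_insert_size szs'; case: (_.2) isz; case: (_.2).
rewrite !insert_cons; move: rp isz st1 szt lt => <-.
case: (row_insert x s) => t [y|]; case: (row_insert x' s') => t' [y'|] //= _ st1 szt lt.
  have := lt; rewrite -[y :: t]cat1s phi_cat => lt'.
  rewrite szt !rrw_cons.
  (* Either the bumped letter itself is changed, and the action continues in the rows below, or the
     action stays in the first row. *)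
  move: st1; rewrite -[y :: t]cat1s => /fstep_cat_inv[[z [stz Ez le]]|[v' [stv Ev lt2]]].
    have [a [b [Ea Ez' _ _]]] := stz.
    have {}Ez' : z = [:: i.+1] by rewrite Ez'; case: a Ea {Ez'} => [|? [|]] //= [_ <-].
    move: Ez stz; rewrite Ez' => -[-> ->] stz.
    have st' : fstep i (rrw T ++ [:: y]) (rrw T ++ [:: i.+1]).
      by apply: fstep_catr => //; lia.
    have [T2 [y2 [E2 sT2 shT2 sh2 st2]]] := IH _ _ sT st'.
    move: E2; rewrite !cats1 => /rcons_inj[E2 Ey]; rewrite -Ey in sh2 st2.
    have ET : T2 = T by apply: rrw_inj; rewrite ?shT2 // -E2.
    rewrite ET in st2 sh2; rewrite sh2; split=> //; apply: fstep_catl => //.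
    by have [_ ->] := insert_phi i y sT; rewrite eps_cat; lia.
  move: Ev => -[-> ->]; split=> //; apply: fstep_catr => //.
  by have [_ ->] := insert_phi i y sT; rewrite eps_cat; lia.
by rewrite szt !rrw_cons; split=> //; exact: fstep_catr.
Qed.

Definition P := insertion_tableau.

Lemma P_rcons w x : P (rcons w x) = insert x (P w).
Proof. by rewrite /P /insertion_tableau -cats1 foldl_cat. Qed.

Lemma P_rows w : all (sorted leq) (P w).
Proof. by elim/last_ind: w => // w x IH; rewrite P_rcons insert_rows. Qed.

Lemma P_count w a : count a (rrw (P w)) = count a w.
Proof.
by elim/last_ind: w => // w x IH; rewrite P_rcons insert_count -cats1 !count_cat IH.
Qed.

Lemma P_phi_eps i w :
  phi i (rrw (P w)) = phi i w /\ eps i (rrw (P w)) = eps i w.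
Proof.
elim/last_ind: w => // w x [IHp IHe]; rewrite P_rcons.
have [-> ->] := insert_phi i x (P_rows w).
by rewrite -cats1 !phi_cat !eps_cat IHp IHe.
Qed.

Lemma P_fstep i w w' : fstep i w w' ->
  shape (P w') = shape (P w) /\ fstep i (rrw (P w)) (rrw (P w')).
Proof.
elim/last_ind: w w' => [|w x IH] w'; first by move=> [[|? ?] [b []]].
rewrite -cats1; have [pw ew] := P_phi_eps i w.
move=> /fstep_cat_inv[[u [st -> le]]|[v [st -> lt]]].
  have [sh st'] := IH _ st; rewrite !cats1 !P_rcons.
  have st2 : fstep i (rrw (P w) ++ [:: x]) (rrw (P u) ++ [:: x]).
    by apply: fstep_catl; rewrite ?ew.
  have [T [x2 [E _ shT sh2 st3]]] := insert_fstep (P_rows w) st2.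
  move: E; rewrite !cats1 => /rcons_inj[E Ex].
  have ET : T = P u by apply: rrw_inj; rewrite ?shT // -E.
  by rewrite ET -Ex in sh2 st3.
have [a [b [Ea Ev _ _]]] := st.
have {}Ev : v = [:: i.+1] by rewrite Ev; case: a Ea {Ev} => [|? [|]] //= [_ <-].
rewrite Ev in st *; rewrite !cats1 !P_rcons.
have st2 : fstep i (rrw (P w) ++ [:: x]) (rrw (P w) ++ [:: i.+1]).
  by apply: fstep_catr; rewrite ?ew.
have [T [x2 [E _ shT sh2 st3]]] := insert_fstep (P_rows w) st2.
move: E; rewrite !cats1 => /rcons_inj[E Ex].
have ET : T = P w by apply: rrw_inj; rewrite ?shT // -E.
by rewrite ET -Ex in sh2 st3.
Qed.

(** * Insertion tableaux are semistandard *)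

Definition dom (s s' : seq nat) : bool :=
  (size s' <= size s) && all (fun c => nth 0 s c < nth 0 s' c) (iota 0 (size s')).

Lemma domP s s' : reflect
  (size s' <= size s /\ forall c, c < size s' -> nth 0 s c < nth 0 s' c) (dom s s').
Proof.
apply: (iffP andP) => -[le H]; split=> //.
  by move=> c cs; apply: (allP H); rewrite mem_iota.
by apply/allP => c; rewrite mem_iota => /H.
Qed.

Lemma dom_trans : transitive dom.
Proof.
move=> y x z /domP[le1 H1] /domP[le2 H2]; apply/domP; split=> [|c cz].
  exact: leq_trans le2 le1.
by apply: ltn_trans (H2 _ cz); apply: H1; exact: leq_trans cz le2.
Qed.

Definition good (T : tableau) : bool :=
  [&& all (sorted leq) T, [::] \notin T & sorted dom T].

Lemma nth_shape (A : Type) (T : seq (seq A)) r :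
  nth 0 (shape T) r = size (nth [::] T r).
Proof.
have [rT|Tr] := ltnP r (size T); first by rewrite (nth_map [::]).
by rewrite !nth_default // size_map.
Qed.

Lemma find_lt_nth x s c : c < find (ltn x) s -> nth 0 s c <= x.
Proof. by move=> /(before_find 0) /negbT; rewrite -leqNgt. Qed.

(** Bumping routes move weakly left: a letter bumped from column k is smaller than the entry below
    it, if any, and so enters the next row at a column at most k. *)
Lemma row_insert_dom x y s s' : dom s s' -> (row_insert x s).2 = Some y ->
  dom (row_insert x s).1 (row_insert y s').1.
Proof.
move=> /domP[le H]; rewrite !row_insertE /=; case: ifP => // ks [Ey].
set k := find (ltn x) s in ks Ey *; set k' := find (ltn y) s'.
have xy : x < y by rewrite -Ey; have := nth_find 0 (a := ltn x) (s := s); apply; rewrite has_find.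
have kk : k' <= k.
  rewrite leqNgt; apply/negP => lt; have := find_lt_nth lt; rewrite leqNgt -{1}Ey.
  by rewrite H // (leq_trans lt) // find_size.
have k's : k' <= size s' by exact: find_size.
apply/domP; rewrite !size_set_nth; split=> [|c ck]; first by lia.
rewrite !nth_set_nth /=; case: (c =P k') => [->|ne].
  case: eqP => // ne; apply: leq_ltn_trans xy; apply: find_lt_nth.
  by rewrite -/k; lia.
have cs' : c < size s' by lia.
case: eqP => [Ek|_]; last exact: H.
by apply: ltn_trans xy _; rewrite -Ey -Ek; exact: H.
Qed.

Lemma row_insert_dom_none x s s' : dom s s' -> (row_insert x s).2 = None ->
  dom (row_insert x s).1 s'.
Proof.
move=> /domP[le H]; rewrite row_insertE /=; case: ifP => // /negbT ks _.
apply/domP; rewrite size_set_nth; split=> [|c cs]; first by lia.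
by rewrite nth_set_nth /=; case: eqP => [|_]; [lia|exact: H].
Qed.

Lemma insert_dom x s T : path dom s T -> path dom (row_insert x s).1
  (if (row_insert x s).2 is Some y then insert y T else T).
Proof.
elim: T x s => [|s' T IH] x s /=; last move=> /andP[ds dT].
  case Er: (row_insert x s).2 => [y|] //= _; rewrite andbT; apply/domP.
  have [xy ys] := row_insert_bump Er; rewrite row_insert_size.
  split=> [|[|//] _]; first by case: (s) ys.
  rewrite row_insertE nth_set_nth /=; case: eqP => // /eqP k0.
  by apply: leq_ltn_trans xy; apply: find_lt_nth; case: find k0.
case Er: (row_insert x s).2 => [y|].
  by rewrite -/(insert y (s' :: T)) insert_cons /= (row_insert_dom ds Er) IH.
by rewrite /= row_insert_dom_none.
Qed.

Lemma insert_good x T : good T -> good (insert x T).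
Proof.
move=> /and3P[sT nT dT]; apply/and3P; split; first exact: insert_rows.
  elim: T x nT {sT dT} => [//|s T IH] x; rewrite inE negb_or insert_cons => /andP[ns nT].
  rewrite inE negb_or; apply/andP; split; last first.
    by case: (row_insert x s).2 => [y|] //; exact: IH.
  by rewrite eq_sym -size_eq0 row_insert_size; case: (s) ns.
by case: T dT {sT nT} => // s T dT; rewrite insert_cons; exact: insert_dom.
Qed.

Lemma P_good w : good (P w).
Proof. by elim/last_ind: w => // w x IH; rewrite P_rcons insert_good. Qed.

Lemma mem_rrw T x : x \in rrw T <-> exists2 s, s \in T & x \in s.
Proof.
by split=> [/flattenP|] [s]; rewrite ?mem_rev => sT xs; [exists s|apply/flattenP; exists s; rewrite ?mem_rev].
Qed.

Lemma ent_mem T r c : c < size (nth [::] T r) -> ent T r c \in rrw T.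
Proof.
move=> lt; apply/mem_rrw; exists (nth [::] T r); last exact: mem_nth.
by apply: mem_nth; rewrite ltnNge; apply/negP => le; rewrite nth_default in lt.
Qed.

Lemma good_semistandard T : good T -> 0 \notin rrw T -> semistandard (shape T) T.
Proof.
move=> /and3P[sT nT dT] n0; split=> // [r c|r c c' cc'|r r' c rr']; rewrite nth_shape => lt.
- by rewrite lt0n; apply: contraNneq n0 => <-; exact: ent_mem.
- have rT : r < size T by rewrite ltnNge; apply/negP => le; rewrite nth_default in lt.
  have sr : sorted leq (nth [::] T r) by apply: (allP sT); exact: mem_nth.
  apply: (sorted_leq_nth leq_trans leqnn 0 sr) => //; rewrite inE //.
  exact: leq_ltn_trans lt.
- have rT : r' < size T by rewrite ltnNge; apply/negP => le; rewrite nth_default in lt.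
  have /domP[_] := sorted_ltn_nth dom_trans [::] dT r r' (ltn_trans rr' rT) rT rr'.
  by apply.
Qed.

Lemma good_part T : good T -> is_part (shape T).
Proof.
move=> /and3P[sT nT dT]; apply/andP; split; last first.
  by apply/negP => /mapP[s sT' /esym/eqP]; rewrite size_eq0 => /eqP E; rewrite -E sT' in nT.
by rewrite sorted_map; apply: sub_sorted dT => s s' /domP[].
Qed.

Lemma semistandard_good lam T : is_part lam -> semistandard lam T -> good T.
Proof.
move=> /andP[slam nlam] [sh pos row col].
have szr r : size (nth [::] T r) = nth 0 lam r by rewrite -sh nth_shape.
apply/and3P; split.
- apply/(all_nthP [::]) => r rT; apply/(sortedP 0) => c; rewrite szr => lt.
  by have := row r c c.+1 (leqnSn c) lt.
- apply: contra nlam => /(map_f size); rewrite -/(shape T) sh; exact.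
- apply/(sortedP [::]) => r rT; apply/domP; rewrite !szr; split.
    by move/(sortedP 0): slam; apply; rewrite -sh size_map.
  by move=> c; exact: col.
Qed.

Lemma semistandard_n0 lam T : semistandard lam T -> 0 \notin rrw T.
Proof.
move=> [sh pos _ _]; apply/negP => /mem_rrw[s /(nthP [::]) [r rT <-]] /(nthP 0)[c cs E].
by have := pos r c; rewrite /ent E -sh nth_shape cs => /(_ isT).
Qed.

(* Inserting the column reading word of a tableau builds the tableau column by
   column, so it gives the tableau back. *)

Definition colseq (T : tableau) c := [seq nth 0 s c | s <- T & c < size s].

Definition crw (T : tableau) : seq nat := letters T (rd_boxes T).

Lemma crwE T : crw T =
  flatten [seq rev (colseq T c) | c <- iota 0 (size (head [::] T))].
Proof.
rewrite /crw /letters /rd_boxes map_flatten -map_comp; congr flatten.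
apply: eq_map => c /=; rewrite -map_comp filter_rev map_rev; congr rev.
rewrite /colseq -[T in RHS](mkseq_nth [::] T) /mkseq filter_map.
by rewrite -map_comp.
Qed.

Fixpoint app_col (R : tableau) (a : seq nat) : tableau :=
  match R, a with
  | s :: R', x :: a' => rcons s x :: app_col R' a'
  | _, _ => R
  end.

Fixpoint le_col (R : tableau) (a : seq nat) : bool :=
  match R, a with
  | s :: R', x :: a' => all (leq^~ x) s && le_col R' a'
  | _, [::] => true
  | [::], _ :: _ => false
  end.

Lemma le_col_behead R x a : path ltn x a -> le_col R (x :: a) -> le_col R a.
Proof.
elim: R x a => [//|s R IH] x [//|y a] /= /andP[xy ya] /andP[sx Ra].
rewrite (IH y) // andbT; apply: sub_all sx => z /= zx; lia.
Qed.

(** A column is read from the bottom, so [x] arrives after the larger letters [a]. It bumps the head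
    of [a] from the end of the first row, which bumps the next one, and the column slides down by
    one box. *)
Lemma insert_app_col x R a : path ltn x a -> le_col R (x :: a) ->
  insert x (app_col R a) = app_col R (x :: a).
Proof.
elim: R x a => [//|s R IH] x [|y a].
  move=> _ /andP[sx _]; rewrite [app_col _ [::]]/= insert_cons.
  have -> : row_insert x s = (rcons s x, None).
    by rewrite -[in LHS](cats0 s) row_insert_cat //= cats1.
  by case: (R).
move=> /andP[xy ya] /andP[sx Ra]; rewrite [app_col _ _]/= insert_cons -cats1.
by rewrite row_insert_cat //= (xy : x < y) /= IH // cats1.
Qed.

Lemma foldl_app_col R a : sorted ltn a -> le_col R a ->
  foldl (fun T x => insert x T) R (rev a) = app_col R a.
Proof.
elim: a => [|x a IH] /= sa Ra; first by case: R Ra.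
rewrite rev_cons -cats1 foldl_cat IH /=; last 2 first.
- exact: path_sorted sa.
- exact: le_col_behead Ra.
exact: insert_app_col.
Qed.

Lemma foldl_col0 a : sorted ltn a ->
  foldl (fun T x => insert x T) [::] (rev a) = [seq [:: x] | x <- a].
Proof.
elim: a => [//|x a IH] /= xa; rewrite rev_cons -cats1 foldl_cat IH /=; last first.
  exact: path_sorted xa.
elim: a x xa {IH} => [//|y a IH] x /= /andP[xy ya].
by rewrite (xy : x < y) /= IH.
Qed.

Lemma colseq_short T s c : path dom s T -> size s <= c -> colseq T c = [::].
Proof.
move=> dT sc; rewrite /colseq -[RHS]/(map (nth 0^~ c) [::]); congr map.
apply/eqP; rewrite -size_eq0 size_filter -leqn0 leqNgt -has_count.
apply/hasP => -[t tT ct]; have /allP /(_ _ tT) /domP[le _] := order_path_min dom_trans dT.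
by lia.
Qed.

Lemma colseq_sorted T c : sorted dom T -> sorted ltn (colseq T c).
Proof.
elim: T => // s T IH dT; rewrite /colseq /=; case: ifP => [cs|/negbT]; last first.
  by rewrite -leqNgt => sc; rewrite -/(colseq T c) (colseq_short dT).
rewrite /= -/(colseq T c) (path_sortedE ltn_trans) IH ?(path_sorted dT) // andbT.
apply/allP => x /mapP[t]; rewrite mem_filter => /andP[ct tT] ->.
by have /allP /(_ _ tT) /domP[_ ->] := order_path_min dom_trans dT.
Qed.

Lemma le_colseq T c : all (sorted leq) T -> sorted dom T ->
  le_col [seq take c s | s <- T] (colseq T c).
Proof.
elim: T => // s T IH /= /andP[ss sT] dT; rewrite /colseq /=.
case: ifP => [cs|/negbT]; last first.
  by rewrite -leqNgt => sc; rewrite -/(colseq T c) (colseq_short dT).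
rewrite /= IH ?(path_sorted dT) // andbT; apply/(all_nthP 0) => d.
rewrite size_take cs => dc; rewrite nth_take //.
by apply: (sorted_leq_nth leq_trans leqnn 0 ss); rewrite ?inE //; lia.
Qed.

Lemma app_colseq T c : sorted dom T ->
  app_col [seq take c s | s <- T] (colseq T c) = [seq take c.+1 s | s <- T].
Proof.
elim: T => // s T IH dT; rewrite /colseq /=.
case: ifP => [cs|/negbT].
  by rewrite /= -/(colseq T c) IH ?(path_sorted dT) // -take_nth.
rewrite -leqNgt => sc; rewrite -/(colseq T c) (colseq_short dT) //=.
rewrite !take_oversize //; last exact: leqW.
congr cons; apply/eq_in_map => t tT.
have /allP /(_ _ tT) /domP[le _] := order_path_min dom_trans dT.
by rewrite !take_oversize //; lia.
Qed.

Lemma P_crw T : good T -> P (crw T) = T.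
Proof.
case: T => // s T /and3P[sT nT dT]; rewrite crwE [head _ _]/=.
have [m sm] : exists m, size s = m.+1.
  by case: (s) nT => [|x s'] //; exists (size s').
have nz t : t \in s :: T -> 0 < size t.
  by case: t => // tT; rewrite tT in nT.
rewrite sm [iota _ _]/= [map _ _]/= [flatten _]/= /P /insertion_tableau foldl_cat.
rewrite foldl_col0 ?colseq_sorted //.
have -> : [seq [:: x] | x <- colseq (s :: T) 0] = [seq take 1 t | t <- s :: T].
  rewrite /colseq -map_comp (_ : filter _ _ = s :: T); last first.
    by apply/all_filterP/allP => t /nz.
  by apply/eq_in_map => t /nz /=; case: t => //= x t _; rewrite take0.
(* Once [c] columns are built, each further column only lengthens rows. The first column is apart,
   as it creates them. *)
suff H k c : foldl (fun U x => insert x U) [seq take c t | t <- s :: T]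
    (flatten [seq rev (colseq (s :: T) d) | d <- iota c k]) =
    [seq take (c + k) t | t <- s :: T].
  rewrite H add1n -sm; apply: map_id_in => t; rewrite inE => /orP[/eqP->|tT].
    by rewrite take_size.
  have /allP /(_ _ tT) /domP[le _] := order_path_min dom_trans dT.
  by rewrite take_oversize.
move: (s :: T) sT dT {nT nz} => U sU dU.
elim: k c => [|k IH] c; first by rewrite addn0.
rewrite [iota _ _]/= [map _ (_ :: _)]/= [flatten _]/= foldl_cat.
rewrite foldl_app_col ?colseq_sorted ?le_colseq //.
by rewrite app_colseq // IH addSnnS.
Qed.

(** * Heights of buoy and anchor words *)

Section Heights.

Import Order.TTheory GRing.Theory Num.Theory.
Local Open Scope ring_scope.

(** Cancellation is read off this walk: the columns before c leave no - if the walk is at a running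
    maximum at c, and those after c leave no + if it never again exceeds its value at c+1. *)
Fixpoint height (p m : nat -> bool) (k : nat) : int :=
  if k is k'.+1 then height p m k' + (p k' : nat)%:Z - (m k' : nat)%:Z else 0.

Definition prev (O : nat -> bool) (c : nat) : bool :=
  if c is c'.+1 then O c' else false.

(* The column of the letter on which f_i or e_i acts: no uncanceled - before
   it, no uncanceled + after it. *)
Definition pivot (H : nat -> int) (c : nat) : Prop :=
  (forall k, (k <= c)%N -> H k <= H c) /\
  (forall k, (c < k)%N -> H k <= H c.+1).

(* [X c] and [Y c] say that i and i+1 occur in column c, [O c] and [Q c] that
   they occur there in a box that is not an anchor. *)
Variables X Y O Q : nat -> bool.
Hypothesis OX : forall c, O c -> X c /\ X c.+1.
Hypothesis QY : forall c, Q c -> Y c /\ Y c.+1.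
Hypothesis QX : forall c, Q c -> X c -> X c.+1.
Hypothesis OY : forall c, O c -> Y c.+1 -> Y c.

Definition bplus c := X c && ~~ prev O c.
Definition bminus c := Y c && ~~ prev Q c.
Definition aplus c := X c && ~~ O c.
Definition aminus c := Y c && ~~ Q c.

Notation HB := (height bplus bminus).
Notation HA := (height aplus aminus).

Lemma HBS k : HB k.+1 = HB k + (bplus k : nat)%:Z - (bminus k : nat)%:Z.
Proof. by []. Qed.

Lemma HAS k : HA k.+1 = HA k + (aplus k : nat)%:Z - (aminus k : nat)%:Z.
Proof. by []. Qed.

(** A group already counted by its buoy and not yet by its anchor is one whose box in column k is
    not an anchor; there is at most one such group for each letter. *)
Lemma heightAB k : HA k.+1 = HB k.+1 - (O k : nat)%:Z + (Q k : nat)%:Z.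
Proof.
elim: k => [|k IH]; rewrite HBS HAS ?IH /bplus /bminus /aplus /aminus /=.
  have := @OX 0%N; have := @QY 0%N.
  by case: (X 0%N); case: (Y 0%N); case: (O 0%N); case: (Q 0%N) => /= H1 H2;
    try (by have [] := H1 isT); try (by have [] := H2 isT); lia.
have := @OX k; have := @QY k; have := @OX k.+1; have := @QY k.+1.
by case: (X k.+1); case: (Y k.+1); case: (O k.+1); case: (Q k.+1);
  case: (O k); case: (Q k) => /= H1 H2 H3 H4;
  try (by have [] := H1 isT); try (by have [] := H2 isT);
  try (by have [] := H3 isT); try (by have [] := H4 isT); lia.
Qed.

Lemma minus_start c : Y c ->
  exists x, [/\ (x <= c)%N, bminus x & forall d, (x <= d < c)%N -> Q d].
Proof.
rewrite /bminus; elim: c => [|c IH] Yc; first by exists 0%N; rewrite Yc.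
have [Qc|nQ] := boolP (Q c); last by exists c.+1; rewrite Yc nQ; split=> // d; lia.
have [x [xc bx H]] := IH (QY Qc).1; exists x; split=> //; first exact: leqW.
move=> d /andP[xd]; rewrite ltnS leq_eqVlt => /orP[/eqP->//|dc].
by apply: H; rewrite xd dc.
Qed.

Lemma HB_flat j k : (j <= k)%N ->
  (forall d, (j <= d < k)%N -> ~~ X d) ->
  (forall d, (j <= d < k)%N -> ~~ bminus d) -> HB k = HB j.
Proof.
elim: k => [|k IH]; first by rewrite leqn0 => /eqP->.
rewrite leq_eqVlt => /orP[/eqP->//|]; rewrite ltnS => jk nX nb.
have := nX k; have := nb k; rewrite jk ltnSn => /(_ isT) nbk /(_ isT) nXk.
rewrite HBS (negbTE nbk) /bplus (negbTE nXk) /= IH ?addr0 ?subr0 //.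
  by move=> d dk; apply: nX; lia.
by move=> d dk; apply: nb; lia.
Qed.

Lemma QX_up x d c : (x <= d <= c)%N -> (forall d, (x <= d < c)%N -> Q d) ->
  X d -> X c.
Proof.
elim: c => [|c IH] dc HQ Xd; first by rewrite (_ : 0 = d)%N //; lia.
have [->//|ne] := eqVneq c.+1 d.
apply: QX; first by apply: HQ; lia.
by apply: IH => //; [lia|move=> e he; apply: HQ; lia].
Qed.

Lemma HB_start x c : (x <= c)%N -> bminus x -> ~~ X c ->
  (forall d, (x <= d < c)%N -> Q d) -> HB c.+1 = HB x - 1.
Proof.
move=> xc bx nX HQ.
have nXd d : (x <= d <= c)%N -> ~~ X d by move=> dc; apply: contra nX; exact: QX_up HQ.
rewrite (@HB_flat x.+1 c.+1) //; first last.
- move=> [|d] // dc; rewrite /bminus negb_and negbK /= HQ ?orbT //; lia.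
- by move=> d dc; apply: nXd; lia.
rewrite HBS bx /bplus (negbTE (nXd x _)) /= ?addr0 //; lia.
Qed.

(** Here the anchor walk exceeds the buoy walk by one, but the excess value is attained by the buoy
    walk nearby. If i occurs in column c, a new group of i starts in the next column while that of
    i+1 continues. Otherwise no i occurs since the group of i+1 started, and the height before its
    start is the required one. *)
Lemma HA_gt_HB c : Q c -> ~~ O c ->
  HB c.+2 = HB c.+1 + 1 \/
  exists x, [/\ (x <= c)%N, HB x = HB c.+1 + 1, forall d, (x <= d <= c)%N -> Q d
              & forall d, (x <= d <= c)%N -> ~~ X d].
Proof.
move=> Qc nO; have [Xc|nX] := boolP (X c); [left|right].
  by rewrite HBS /bplus /bminus /= nO Qc (QX Qc Xc) andbF /= subr0.
have [x [xc bx H]] := minus_start (QY Qc).1; exists x; split=> //.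
- by rewrite (HB_start xc) // subrK.
- move=> d /andP[xd]; rewrite leq_eqVlt => /orP[/eqP->//|dc].
  by apply: H; rewrite xd dc.
- by move=> d dc; apply: contra nX; exact: QX_up H.
Qed.

Lemma HA_le M : (forall k, HB k <= M) -> forall k, HA k <= M.
Proof.
move=> leM [|k]; first exact: leM 0%N.
rewrite heightAB; have [Qk|nQ] := boolP (Q k); last by have := leM k.+1; lia.
have [Ok|nO] := boolP (O k); first by have := leM k.+1; lia.
have [E|[x [_ E _ _]]] := HA_gt_HB Qk nO; last by have := leM x; lia.
by have := leM k.+2; lia.
Qed.

(** So f_i acts on the step that first reaches the maximum of the walk; by [pivot_minus], e_i acts
    on the step that leaves it for the last time. *)
Lemma pivot_plus c : pivot HB c -> bplus c -> ~~ bminus c ->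
  [/\ HB c.+1 = HB c + 1, forall k, HB k <= HB c.+1
    & forall k, (k <= c)%N -> HB k < HB c.+1].
Proof.
move=> [p1 p2] bp bm; have E : HB c.+1 = HB c + 1.
  by rewrite HBS bp (negbTE bm) subr0.
split=> // k; last by move=> /p1; lia.
by have [/p1|/p2] := leqP k c; lia.
Qed.

Lemma pivot_minus c : pivot HB c -> bminus c -> ~~ bplus c ->
  [/\ HB c.+1 = HB c - 1, forall k, HB k <= HB c
    & forall k, (c < k)%N -> HB k < HB c].
Proof.
move=> [p1 p2] bm bp; have E : HB c.+1 = HB c - 1.
  by rewrite HBS bm (negbTE bp) addr0.
split=> // k; last by move=> /p2; lia.
by have [/p1|/p2] := leqP k c; lia.
Qed.

(** * Lowering: from the pivot of the buoys to the pivot of the anchors *)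

Section Plus.
Variable c : nat.
Hypotheses (pv : pivot HB c) (bp : bplus c) (bm : ~~ bminus c).

(** Only the excess of [HA_gt_HB] lets the anchors reach the maximum early, and this requires a
    group of i+1 that crosses into column c. *)
Lemma HA_before k : (k <= c)%N -> HB c.+1 <= HA k -> k = c /\ prev Q c.
Proof.
have [E le lt] := pivot_plus pv bp bm.
case: k => [|k] kc; first by have := lt 0%N isT => /=; lia.
rewrite heightAB; have := lt _ kc.
have [Qk|nQ] := boolP (Q k); last by lia.
have [Ok|nO] := boolP (O k); first by lia.
have [E2|[x [xk E2 _ _]]] := HA_gt_HB Qk nO; last by have := lt x; lia.
move=> l1 l2; have kc2 : k.+1 = c.
  apply/eqP; rewrite eqn_leq kc leqNgt; apply/negP => kc'.
  by have := lt k.+2 kc'; lia.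
by split=> //; rewrite -kc2.
Qed.

(** Case of a moved divider. The i+1 in column c is not a buoy, so its group comes from the previous
    column. The anchor walk rises there already, because the group of i ends in that column while
    the group of i+1 is still open. *)
Lemma plus_above_minus : Y c ->
  exists c', [/\ c = c'.+1, Q c', X c', ~~ O c' & pivot HA c'].
Proof.
have [E le lt] := pivot_plus pv bp bm.
move=> Yc; have := bm; rewrite /bminus Yc negbK.
case: c pv bp bm E le lt Yc HA_before => // c' pv' bp' bm' E le lt Yc HAb Qc'.
exists c'; have {}Qc' : Q c' by [].
have nO : ~~ O c' by move: bp' => /andP[].
have Xc' : X c'.
  apply: contraT => nX; have [E2|] := HA_gt_HB Qc' nO.
    have [x [xc bx H]] := minus_start (QY Qc').1.
    have := lt x; rewrite (leqW xc) => /(_ isT).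
    by have := HB_start xc bx nX H; lia.
  by move=> [x [xc E2 _ _]]; have := lt x; rewrite (leqW xc) => /(_ isT); lia.
have EA : HA c'.+1 = HB c'.+2 by rewrite heightAB Qc' (negbTE nO) E subr0.
have EA' : HA c'.+1 = HA c' + 1.
  by rewrite HAS /aplus /aminus Xc' nO Qc' andbF /= subr0.
split=> //; split=> k kc; last by rewrite EA; exact: HA_le.
have [le2|] := leP (HB c'.+2) (HA k); last by lia.
by have [|Ek _] := HAb k _ le2; [exact: leqW|move: kc; rewrite Ek ltnn].
Qed.

Variable a : nat.
Hypotheses (ca : (c <= a)%N) (Oa : forall d, (c <= d < a)%N -> O d) (nOa : ~~ O a).
Hypothesis nY : ~~ Y c.

Lemma plus_free_notY d : (c <= d <= a)%N -> ~~ Y d.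
Proof.
elim: d => [|d IH] dc; first by rewrite (_ : 0 = c)%N //; lia.
have [E|ne] := eqVneq d.+1 c; first by rewrite E.
by apply: contra (IH _); [apply: OY; apply: Oa|]; lia.
Qed.

Lemma plus_free_HB d : (c <= d <= a)%N -> HB d.+1 = HB c.+1.
Proof.
elim: d => [|d IH] dc; first by rewrite (_ : 0 = c)%N //; lia.
have [E|ne] := eqVneq d.+1 c; first by rewrite E.
rewrite HBS IH /bplus /bminus; last lia.
rewrite (negbTE (plus_free_notY dc)) /= (Oa (d := d)); last lia.
by rewrite andbF subr0 addr0.
Qed.

(** Case of a changed group. No i+1 occurs between its buoy and its anchor, so the buoy walk is
    constant after c, and the step made by the buoy at c is made by the anchor at [a]. *)
Lemma plus_free : X a /\ pivot HA a.
Proof.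
have [E le lt] := pivot_plus pv bp bm.
have Xa : X a.
  have [<-|ne] := eqVneq c a; first by case/andP: bp.
  case: (a) ca Oa ne => [|a'] ca' Oa' ne; first by lia.
  by have [] := @OX a'; first by apply: Oa'; lia.
have nYQ d : ~~ Y d -> Q d = false by move=> nYd; apply: contraNF nYd => /QY[].
have EA : HA a.+1 = HB c.+1.
  rewrite heightAB (negbTE nOa) nYQ ?plus_free_notY ?ca ?leqnn //.
  by rewrite plus_free_HB ?ca ?leqnn // addr0 subr0.
have EA' : HA a.+1 = HA a + 1.
  by rewrite HAS /aplus /aminus Xa nOa (negbTE (plus_free_notY _)) ?ca ?leqnn //= subr0.
split=> //; split=> k kc; last by rewrite EA; exact: HA_le.
suff : HA k < HB c.+1 by lia.
have [kc'|ck] := leqP k c.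
  rewrite ltNge; apply/negP => H; have [_] := HA_before kc' H.
  by case: (c) nY => // c' nYc /QY[_]; rewrite (negbTE nYc).
case: k kc ck => // k kc ck; rewrite heightAB plus_free_HB; last lia.
by rewrite nYQ ?plus_free_notY ?Oa //; lia.
Qed.

(** An i right after the anchor column would be a buoy and push the walk above its maximum unless an
    i+1 compensates. This is what keeps the row of a changed group weakly increasing. *)
Lemma plus_free_next : X a.+1 -> Y a.+1.
Proof.
have [E le lt] := pivot_plus pv bp bm.
move=> Xa; apply: contraT => nYa; have := le a.+2.
rewrite HBS plus_free_HB ?ca ?leqnn // /bplus /bminus Xa (negbTE nYa) /= nOa /=; lia.
Qed.

End Plus.

(** * Raising: from the pivot of the buoys to the pivot of the anchors *)

Section Minus.
Variable c : nat.
Hypotheses (pv : pivot HB c) (bm : bminus c) (bp : ~~ bplus c).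
Variable a : nat.
Hypotheses (ca : (c <= a)%N) (Qa : forall d, (c <= d < a)%N -> Q d) (nQa : ~~ Q a).

Lemma HA_after d : (c <= d)%N -> HB c <= HA d.+1 ->
  (d < a)%N /\ ~~ X c.
Proof.
have [E le lt] := pivot_minus pv bm bp.
move=> cd; rewrite heightAB; have := lt d.+1; rewrite ltnS cd => /(_ isT) l1.
have [Qd|nQ] := boolP (Q d); last by lia.
have [Od|nO] := boolP (O d); first by lia.
have [E2|[x [xk E2 HQ HX]]] := HA_gt_HB Qd nO.
  by have := lt d.+2; rewrite !ltnS (leqW cd) => /(_ isT); lia.
move=> l2; have xc : (x <= c)%N.
  by rewrite leqNgt; apply/negP => /lt; lia.
split; last by apply: HX; rewrite xc cd.
rewrite ltnNge; apply/negP => ad; move/negP: nQa; apply; apply: HQ.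
by rewrite ad (leq_trans xc ca).
Qed.

(** An i first appearing later under the span of the group would be a buoy and bring the walk back
    to its maximum, which it left for the last time at c. *)
Lemma minus_flat d : ~~ X c -> (c <= d <= a)%N ->
  (~~ X d /\ HB d.+1 = HB c - 1).
Proof.
have [E le lt] := pivot_minus pv bm bp.
move=> nX; elim: d => [|d IH] dc; first by rewrite (_ : 0 = c)%N ?nX ?E //; lia.
have [Ed|ne] := eqVneq d.+1 c; first by rewrite Ed nX E.
have [nXd Ed] : ~~ X d /\ HB d.+1 = HB c - 1 by apply: IH; lia.
have Qd : Q d by apply: Qa; lia.
have nO : O d = false by apply: contraNF nXd => /OX[].
have bpE : bplus d.+1 = X d.+1 by rewrite /bplus /= nO andbT.
have bmE : bminus d.+1 = false by rewrite /bminus /= Qd andbF.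
have Ed2 : HB d.+2 = HB c - 1 + (X d.+1 : nat)%:Z by rewrite HBS Ed bpE bmE subr0.
have [Xd|nXd1] := boolP (X d.+1); last by rewrite Ed2 (negbTE nXd1) addr0.
have cd2 : (c < d.+2)%N by lia.
by have := lt _ cd2; rewrite Ed2 Xd; lia.
Qed.

(** An i in the anchor column forces one in column c, which cannot be a buoy. Its group comes from
    the previous column, and the anchor walk makes its step there. *)
Lemma minus_below_plus : X a ->
  exists c', [/\ c = c'.+1, O c', Y c', ~~ Q c' & X c /\ pivot HA c'].
Proof.
have [E le lt] := pivot_minus pv bm bp.
move=> Xa; have Xc : X c.
  apply: contraT => nX; have [] := minus_flat nX (d := a); first by rewrite ca leqnn.
  by rewrite Xa.
have := bp; rewrite /bplus Xc negbK.
have HAa := HA_after; case: c E le lt Xc bm HAa => // c' E le lt Xc bm' HAa Oc'.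
have {}Oc' : O c' by []; have /andP[Yc nQ] := bm'; have Yc' := OY Oc' Yc.
exists c'; split=> //; split=> //.
have EA : HA c'.+1 = HB c'.+1 - 1.
  by rewrite heightAB Oc' (negbTE (nQ : ~~ Q c')) addr0.
have EA' : HA c'.+1 = HA c' - 1.
  by rewrite HAS /aplus /aminus Oc' Yc' (nQ : ~~ Q c') andbF /= addr0.
split=> k kc; first by have := HA_le le k; lia.
rewrite EA; case: k kc => // k kc.
have [->|ne] := eqVneq k c'; first by rewrite EA.
have [H|] := leP (HB c'.+1) (HA k.+1); last by lia.
by have [|_] := HAa k _ H; [lia|rewrite Xc].
Qed.

Hypothesis nXa : ~~ X a.

Lemma minus_free_notX d : (c <= d <= a)%N -> ~~ X d.
Proof. by move=> dc; apply: contra nXa; exact: QX_up Qa. Qed.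

Lemma minus_free : Y a /\ pivot HA a.
Proof.
have [E le lt] := pivot_minus pv bm bp.
have nXc : ~~ X c by apply: minus_free_notX; rewrite leqnn.
have Ya : Y a.
  have [<-|ne] := eqVneq c a; first by case/andP: bm.
  case: (a) ca Qa ne => [|a'] ca' Qa' ne; first by lia.
  by have [] := @QY a'; first by apply: Qa'; lia.
have XO d : ~~ X d -> O d = false by move=> nX; apply: contraNF nX => /OX[].
have EA : HA a = HB c.
  have [<-|ne] := eqVneq c a.
    move: bm nXc; rewrite /bminus; case: (c) => // c' /andP[_ nQ] nX.
    rewrite heightAB (negbTE (nQ : ~~ Q c')) (_ : O c' = false) ?addr0 ?subr0 //.
    by apply: contraNF nX => /OX[].
  case Ea: a ne => [|a'] ne; first by lia.
  have [nX EB] := minus_flat nXc (d := a') ltac:(lia).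
  by rewrite heightAB EB (Qa (d := a')) ?XO ?subr0 ?subrK //; lia.
have EA' : HA a.+1 = HA a - 1.
  by rewrite HAS /aplus /aminus (negbTE nXa) Ya nQa /= addr0.
split=> //; split=> k kc; first by rewrite EA; exact: HA_le.
rewrite EA' EA; case: k kc => // k kc.
have [H|] := leP (HB c) (HA k.+1); last by lia.
by have [|] := HA_after _ H; lia.
Qed.

(** Otherwise the group of that i+1 would have started one above the height at c, which is the
    maximum. *)
Lemma minus_free_prev c' : c = c'.+1 -> Y c' -> X c'.
Proof.
have [E le lt] := pivot_minus pv bm bp.
move=> Ec Yc'; apply: contraT => nX; have [x [xc bx H]] := minus_start Yc'.
by have := HB_start xc bx nX H; rewrite -Ec; have := le x; lia.
Qed.

End Minus.

End Heights.

(** * Words read by columns *)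

(** In a decreasing word i+1 comes before i, so the two cancel. Hence heights taken column by column
    suffice. *)
Lemma phi_decreasing i w : sorted gtn w ->
  phi i w = (i \in w) - (i.+1 \in w) /\ eps i w = (i.+1 \in w) - (i \in w).
Proof.
elim: w => [//|x v IH] xv.
have [-> ->] : phi i (x :: v) = (if x == i then (phi i v).+1 else
    if x == i.+1 then (phi i v).-1 else phi i v) /\
  eps i (x :: v) = (if (x == i.+1) && (phi i v == 0) then (eps i v).+1 else eps i v) by [].
have [-> ->] := IH (path_sorted xv).
have gt_trans : transitive gtn by move=> y z t /= h1 h2; exact: ltn_trans h1.
have lt y : y \in v -> y < x by move=> yv; have /allP /(_ _ yv) := order_path_min gt_trans xv.
have nin y : x <= y -> (y \in v) = false.
  by move=> xy; apply/negP => /lt; rewrite ltnNge xy.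
rewrite !inE; have [xi|ni] := eqVneq x i.
  by subst x; rewrite !nin //= (gtn_eqF (ltnSn i)) (ltn_eqF (ltnSn i)).
have [xS|nS] := eqVneq x i.+1.
  subst x; rewrite !(@nin i.+1) //=.
  by case: (i \in v).
by [].
Qed.

Lemma count_decreasing (v : nat) w : sorted gtn w -> count_mem v w = (v \in w).
Proof.
move=> sw; apply: count_uniq_mem; apply: sorted_uniq sw.
  by move=> y z t /= h1 h2; exact: ltn_trans h1.
by move=> y /=; rewrite ltnn.
Qed.

Definition colwords (f : nat -> seq nat) (j m : nat) : seq nat :=
  flatten [seq f c | c <- iota j m].

Lemma colwordsS f j m : colwords f j m.+1 = f j ++ colwords f j.+1 m.
Proof. by []. Qed.

Lemma colwords_cat f j m k : colwords f j (m + k) = colwords f j m ++ colwords f (j + m) k.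
Proof. by rewrite /colwords iotaD map_cat flatten_cat. Qed.

Lemma eq_colwords f g j m :
  (forall c, j <= c < j + m -> f c = g c) -> colwords f j m = colwords g j m.
Proof.
move=> fg; rewrite /colwords; congr flatten; apply/eq_in_map => c.
by rewrite mem_iota => /fg.
Qed.

Lemma colwords_split f L c : c < L ->
  colwords f 0 L = colwords f 0 c ++ f c ++ colwords f c.+1 (L - c.+1).
Proof.
move=> cL; rewrite -{1}(subnKC (ltnW cL)) colwords_cat add0n.
by rewrite -(subnSK cL) colwordsS.
Qed.

Section ColumnHeights.

Variables (i : nat) (f : nat -> seq nat).
Hypothesis sf : forall c, sorted gtn (f c).

Definition hgt : nat -> int :=
  height (fun c => i \in f c) (fun c => i.+1 \in f c).

Local Open Scope ring_scope.

Lemma hgtS c : hgt c.+1 =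
  hgt c + (i \in f c : nat)%:Z - (i.+1 \in f c : nat)%:Z.
Proof. by []. Qed.

Lemma hgt_count j m : hgt (j + m)%N - hgt j =
  (count_mem i (colwords f j m))%:Z - (count_mem i.+1 (colwords f j m))%:Z.
Proof.
elim: m j => [|m IH] j; first by rewrite addn0 /=; lia.
rewrite addnS -addSn colwordsS !count_cat !(count_decreasing _ (sf j)).
by have := IH j.+1; rewrite (hgtS j); lia.
Qed.

Lemma colwords_eps0 j m :
  (forall k, (j <= k <= j + m)%N -> hgt k <= hgt (j + m)%N) ->
  eps i (colwords f j m) = 0%N.
Proof.
elim: m j => [//|m IH] j le; rewrite colwordsS eps_cat.
rewrite IH; last by move=> k kj; rewrite addSnnS; apply: le; lia.
have [_ ->] := phi_decreasing i (sf j).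
have := hgt_count j.+1 m; have := phi_eps_count i (colwords f j.+1 m).
rewrite IH; last by move=> k kj; rewrite addSnnS; apply: le; lia.
have := le j; rewrite addSnnS (hgtS j); lia.
Qed.

(** The slack [N] serves the induction: removing the first column shifts the reference height, and
    the bound with it. *)
Lemma colwords_phi_le j m N :
  (forall k, (j <= k <= j + m)%N -> hgt k <= hgt j + N%:Z) ->
  (phi i (colwords f j m) <= N)%N.
Proof.
elim: m j N => [//|m IH] j N le; rewrite colwordsS phi_cat.
have [-> ->] := phi_decreasing i (sf j).
have := le j.+1; rewrite (hgtS j) => le1.
have le1' := le1 ltac:(lia).
have := IH j.+1 (N + (i.+1 \in f j) - (i \in f j))%N.
suff H : forall k, (j.+1 <= k <= j.+1 + m)%N ->
    hgt k <= hgt j.+1 + (N + (i.+1 \in f j) - (i \in f j))%N%:Z.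
  by move=> /(_ H); lia.
move=> k kj; have := le k ltac:(lia); rewrite (hgtS j); lia.
Qed.

Lemma colwords_phi0 j m :
  (forall k, (j <= k <= j + m)%N -> hgt k <= hgt j) ->
  phi i (colwords f j m) = 0%N.
Proof.
by move=> le; apply/eqP; rewrite -leqn0; apply: colwords_phi_le => k /le; rewrite GRing.addr0.
Qed.

Lemma eps0_hgt j m : eps i (colwords f j m) = 0%N ->
  forall k, (j <= k <= j + m)%N -> hgt k <= hgt (j + m)%N.
Proof.
move=> e0 k /andP[jk km].
have : eps i (colwords f j (k - j + (m - (k - j)))) = 0%N by rewrite subnKC //; lia.
rewrite colwords_cat eps_cat subnKC // => e0'.
have := hgt_count k (m - (k - j))%N.
have := phi_eps_count i (colwords f k (m - (k - j))).
rewrite (_ : k + (m - (k - j)) = j + m)%N; lia.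
Qed.

Lemma phi0_hgt j m : phi i (colwords f j m) = 0%N ->
  forall k, (j <= k <= j + m)%N -> hgt k <= hgt j.
Proof.
move=> p0 k /andP[jk km].
have : phi i (colwords f j (k - j + (m - (k - j)))) = 0%N by rewrite subnKC //; lia.
rewrite colwords_cat phi_cat => p0'.
have := hgt_count j (k - j)%N; rewrite subnKC //.
have := phi_eps_count i (colwords f j (k - j)); lia.
Qed.

Lemma hgt_const L k : (forall c, (L <= c)%N -> f c = [::]) -> (L <= k)%N ->
  hgt k = hgt L.
Proof.
move=> f0; elim: k => [|k IH]; first by rewrite leqn0 => /eqP->.
rewrite leq_eqVlt => /orP[/eqP->//|]; rewrite ltnS => Lk.
by rewrite hgtS f0 //= GRing.addr0 GRing.subr0 IH.
Qed.

Lemma pivot_words L c : (c < L)%N -> pivot hgt c ->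
  eps i (colwords f 0 c) = 0%N /\ phi i (colwords f c.+1 (L - c.+1)) = 0%N.
Proof.
move=> cL [p1 p2]; split.
  by apply: colwords_eps0 => k /andP[_ kc]; exact: p1.
by apply: colwords_phi0 => k /andP[ck _]; exact: p2.
Qed.

Lemma words_pivot L c : (forall c, (L <= c)%N -> f c = [::]) -> (c < L)%N ->
  eps i (colwords f 0 c) = 0%N -> phi i (colwords f c.+1 (L - c.+1)) = 0%N ->
  pivot hgt c.
Proof.
move=> f0 cL e0 p0; split=> k kc; first by have := eps0_hgt e0; apply.
have H k' : (c < k' <= L)%N -> hgt k' <= hgt c.+1.
  by move=> ck; apply: (phi0_hgt p0); lia.
have [kL|Lk] := leqP k L; first by apply: H; rewrite kc.
by rewrite (hgt_const f0 (ltnW Lk)); apply: H; rewrite cL leqnn.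
Qed.

End ColumnHeights.

Definition colw (T : tableau) (D : nat -> nat -> bool) (c : nat) : seq nat :=
  [seq ent T r c | r <- rev (iota 0 (size T)) & D r c].

Lemma mem_colw T (D : nat -> nat -> bool) c v : reflect (exists r, [/\ r < size T, D r c & ent T r c = v])
  (v \in colw T D c).
Proof.
apply: (iffP mapP) => [[r]|[r [rT Dr <-]]].
  by rewrite mem_filter mem_rev mem_iota => /andP[Dr rT] ->; exists r.
by exists r => //; rewrite mem_filter mem_rev mem_iota Dr.
Qed.

Lemma colw_split T (D : nat -> nat -> bool) r c : r < size T ->
  colw T D c =
    rev [seq ent T s c | s <- iota r.+1 (size T - r.+1) & D s c] ++
    nseq (D r c) (ent T r c) ++
    rev [seq ent T s c | s <- iota 0 r & D s c].
Proof.
move=> rT; rewrite /colw filter_rev map_rev -{1}(subnKC (ltnW rT)) iotaD add0n.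
rewrite -(subnSK rT) filter_cat map_cat rev_cat /=.
by case: (D r c) => //=; rewrite rev_cons cat_rcons.
Qed.

(** * Valued-set tableaux *)

Lemma shape_mkfill (A : Type) lam (F : nat -> nat -> A) : shape (mkfill lam F) = lam.
Proof.
rewrite /shape /mkfill -map_comp -[RHS](mkseq_nth 0) /mkseq.
by apply: eq_map => r /=; rewrite size_map size_iota.
Qed.

Lemma nth_mkfill (A : Type) lam (F : nat -> nat -> A) d r c :
  nth d (nth [::] (mkfill lam F) r) c = if c < nth 0 lam r then F r c else d.
Proof.
rewrite /mkfill; have [rl|lr] := ltnP r (size lam); last first.
  by rewrite !(@nth_default _ _ _ r) ?size_map ?size_iota ?nth_nil.
rewrite (nth_map 0) ?size_iota // nth_iota // add0n.
have [cl|lc] := ltnP c (nth 0 lam r); last by rewrite nth_default ?size_map ?size_iota.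
by rewrite (nth_map 0) ?size_iota // nth_iota.
Qed.

Lemma ent_mkfill lam F r c :
  ent (mkfill lam F) r c = if c < nth 0 lam r then F r c else 0.
Proof. exact: nth_mkfill. Qed.

Lemma tableau_eq (A : Type) (d : A) (T T' : seq (seq A)) : shape T = shape T' ->
  (forall r c, c < nth 0 (shape T) r ->
     nth d (nth [::] T r) c = nth d (nth [::] T' r) c) -> T = T'.
Proof.
move=> sh H; apply: (@eq_from_nth _ [::]).
  by rewrite -(size_map size T) -/(shape T) sh size_map.
move=> r rT; apply: (@eq_from_nth _ d); first by rewrite -!nth_shape sh.
by move=> c; rewrite -nth_shape => /H.
Qed.

Lemma ent_out T r c : nth 0 (shape T) r <= c -> ent T r c = 0.
Proof. by rewrite nth_shape => le; rewrite /ent nth_default. Qed.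

Section VSTFacts.

Variables (lam : seq nat) (V : vst).
Hypotheses (hlam : is_part lam) (hV : VSToo lam V).

Lemma part_le r r' : r <= r' -> nth 0 lam r' <= nth 0 lam r.
Proof.
move=> rr; have [r's|] := ltnP r' (size lam); last by move=> le; rewrite nth_default.
have /andP[srt _] := hlam.
have geq_trans : transitive geq by move=> x y z /= h1 h2; exact: leq_trans h2 h1.
by apply: (sorted_leq_nth geq_trans leqnn 0 srt) => //; rewrite inE //; lia.
Qed.

Lemma part_size r c : c < nth 0 lam r -> r < size lam.
Proof. by move=> lt; rewrite ltnNge; apply/negP => le; rewrite nth_default in lt. Qed.

Lemma part_pos r : r < size lam -> 0 < nth 0 lam r.
Proof.
move=> rl; have /andP[_ n0] := hlam; rewrite lt0n; apply: contraNneq n0 => <-.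
exact: mem_nth.
Qed.

Lemma vst_shape1 : shape V.1 = lam. Proof. by have [[]] := hV. Qed.
Lemma vst_shape2 : shape V.2 = lam. Proof. by have [] := hV. Qed.

Lemma vst_size1 : size V.1 = size lam.
Proof. by rewrite -vst_shape1 size_map. Qed.

Lemma vst_row1 r : size (nth [::] V.1 r) = nth 0 lam r.
Proof. by rewrite -vst_shape1 nth_shape. Qed.

Lemma vst_row2 r : size (nth [::] V.2 r) = nth 0 lam r.
Proof. by rewrite -vst_shape2 nth_shape. Qed.

Lemma ncolsE : ncols V = nth 0 lam 0.
Proof. by rewrite /ncols -nth0 vst_row1. Qed.

Lemma vst_pos r c : c < nth 0 lam r -> 0 < ent V.1 r c.
Proof. by have [[_ + _ _] _ _ _] := hV; apply. Qed.

Lemma vst_row r c c' : c <= c' -> c' < nth 0 lam r -> ent V.1 r c <= ent V.1 r c'.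
Proof. by have [[_ _ + _] _ _ _] := hV; apply. Qed.

Lemma vst_col r r' c : r < r' -> c < nth 0 lam r' -> ent V.1 r c < ent V.1 r' c.
Proof. by have [[_ _ _ +] _ _ _] := hV; apply. Qed.

Lemma vst_col_inj r r' c : c < nth 0 lam r -> c < nth 0 lam r' ->
  ent V.1 r c = ent V.1 r' c -> r = r'.
Proof.
move=> cr cr' E; have [lt|gt|//] := ltngtP r r'.
  by have := vst_col lt cr'; rewrite E ltnn.
by have := vst_col gt cr; rewrite E ltnn.
Qed.

Lemma buoy_in r c : is_buoy V r c -> c < nth 0 lam r.
Proof.
rewrite /is_buoy ltnNge => bu; apply/negP => le; move: bu.
by rewrite nth_default // vst_row2.
Qed.

Lemma buoy0 r : 0 < nth 0 lam r -> is_buoy V r 0.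
Proof. by move=> /part_size; have [_ _ + _] := hV; apply. Qed.

Lemma nbuoy_eq r c : c.+1 < nth 0 lam r -> ~~ is_buoy V r c.+1 ->
  ent V.1 r c.+1 = ent V.1 r c.
Proof. by have [_ _ _] := hV; apply. Qed.

(** Unlike the negation of [is_anchor], this excludes boxes outside the diagram. *)
Definition nanchor r c := (c.+1 < nth 0 lam r) && ~~ is_buoy V r c.+1.

Lemma anchorE r c : is_anchor V r c = (c < nth 0 lam r) && ~~ nanchor r c.
Proof.
rewrite /is_anchor /nanchor vst_row2; case: (ltnP c) => //= cl.
case: ltnP => [cl'|le] /=; last by rewrite nth_default // vst_row2.
by rewrite negbK /is_buoy; apply: set_nth_default; rewrite vst_row2.
Qed.

Lemma anchor_in r c : is_anchor V r c -> c < nth 0 lam r.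
Proof. by rewrite anchorE => /andP[]. Qed.

Lemma nanchor_eq r c : nanchor r c -> ent V.1 r c.+1 = ent V.1 r c.
Proof. by move=> /andP[]; exact: nbuoy_eq. Qed.

Lemma colw_sorted (D : nat -> nat -> bool) c :
  (forall r, D r c -> c < nth 0 lam r) -> sorted gtn (colw V.1 D c).
Proof.
move=> Din; rewrite /colw filter_rev map_rev rev_sorted.
rewrite (sorted_pairwise ltn_trans) pairwise_map.
have : pairwise ltn [seq r <- iota 0 (size V.1) | D r c].
  by rewrite -(sorted_pairwise ltn_trans) sorted_filter ?iota_ltn_sorted //; exact: ltn_trans.
have : all (D^~ c) [seq r <- iota 0 (size V.1) | D r c] by exact: filter_all.
elim: [seq _ <- _ | _] => //= r s IH /andP[Dr Ds] /andP[rs ps].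
rewrite IH // andbT; apply/allP => r' r's; apply: vst_col; first exact: (allP rs).
by apply: Din; exact: (allP Ds).
Qed.

Lemma aw_sorted c : sorted gtn (anchor_word V c).
Proof. by apply: colw_sorted => r; exact: anchor_in. Qed.

Definition inlam r c := c < nth 0 lam r.
(** Column entries are distinct, so a letter has at most one box per column and its presence is a
    boolean. With [occurs_na], this instantiates X, Y, O and Q of the height analysis. *)
Definition occurs v c := v \in colw V.1 inlam c.
Definition occurs_na v c := v \in colw V.1 nanchor c.

Lemma occursP v c : reflect (exists2 r, c < nth 0 lam r & ent V.1 r c = v) (occurs v c).
Proof.
apply: (iffP (mem_colw _ _ _ _)) => [[r [_ ? ?]]|[r cr Er]]; first by exists r.
by exists r; rewrite vst_size1 (part_size cr).
Qed.

Lemma occurs_naP v c :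
  reflect (exists2 r, nanchor r c & ent V.1 r c = v) (occurs_na v c).
Proof.
apply: (iffP (mem_colw _ _ _ _)) => [[r [_ ? ?]]|[r cr Er]]; first by exists r.
by exists r; rewrite vst_size1; have /andP[/part_size] := cr.
Qed.

Lemma anchor_mem v c : (v \in anchor_word V c) = occurs v c && ~~ occurs_na v c.
Proof.
apply/mem_colw/andP => [[r [_ anc Er]]|[/occursP[r cr Er] nn]].
  have cr := anchor_in anc; split; first by apply/occursP; exists r.
  apply/negP => /occurs_naP[r' na Er']; have cr' : c < nth 0 lam r' by have /andP[/ltnW] := na.
  have E : r = r' by apply: (@vst_col_inj _ _ c) => //; rewrite Er Er'.
  by move: anc; rewrite anchorE E na andbF.
exists r; rewrite vst_size1 (part_size cr) anchorE cr; split=> //=.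
by apply: contra nn => na; apply/occurs_naP; exists r.
Qed.

(** A box is not a buoy exactly when its left neighbour is not an anchor, and both then hold the
    same letter. *)
Lemma buoy_mem v c :
  (v \in colw V.1 (is_buoy V) c) = occurs v c && ~~ prev (occurs_na v) c.
Proof.
apply/mem_colw/andP => [[r [_ bu Er]]|[/occursP[r cr Er] nn]].
  have cr := buoy_in bu; split; first by apply/occursP; exists r.
  case: c bu Er cr => // c bu Er cr.
  apply/negP => /occurs_naP[r' na Er']; have /andP[cr' nb] := na.
  have E : r = r' by apply: (@vst_col_inj _ _ c.+1) => //; rewrite Er (nanchor_eq na).
  by rewrite E (negbTE nb) in bu.
exists r; rewrite vst_size1 (part_size cr); split=> //.
case: c nn cr Er => [|c] nn cr Er; first exact: buoy0.
apply: contraT => nb; case/negP: nn; apply/occurs_naP; exists r.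
  by rewrite /nanchor cr nb.
by rewrite -Er nbuoy_eq.
Qed.

Lemma na_occurs v c : occurs_na v c -> occurs v c /\ occurs v c.+1.
Proof.
move=> /occurs_naP[r na Er]; have /andP[cr nb] := na.
split; apply/occursP; exists r => //; first exact: ltnW.
by rewrite (nanchor_eq na).
Qed.

(** The i lies above the i+1, whose row extends to the next column. There the box right of the i
    holds at least i and less than the i+1 further down. *)
Lemma na_minus_plus i c : occurs_na i.+1 c -> occurs i c -> occurs i c.+1.
Proof.
move=> /occurs_naP[r na Er] /occursP[r' cr' Er']; have /andP[cr nb] := na.
have rr : r' < r.
  rewrite ltnNge; apply/negP; rewrite leq_eqVlt => /orP[/eqP E|lt].
    by move: Er Er'; rewrite E; lia.
  by have := vst_col lt cr'; rewrite Er Er'; lia.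
apply/occursP; exists r'; first by apply: leq_trans cr (part_le (ltnW rr)).
have := vst_row (leqnSn c) (leq_trans cr (part_le (ltnW rr))).
by have := vst_col rr cr; rewrite (nanchor_eq na) Er Er'; lia.
Qed.

Lemma na_plus_minus i c : occurs_na i c -> occurs i.+1 c.+1 -> occurs i.+1 c.
Proof.
move=> /occurs_naP[r na Er] /occursP[r' cr' Er']; have /andP[cr nb] := na.
have rr : r < r'.
  rewrite ltnNge; apply/negP; rewrite leq_eqVlt => /orP[/eqP E|lt].
    by move: Er Er'; rewrite E (nanchor_eq na); lia.
  by have := vst_col lt cr; rewrite (nanchor_eq na) Er Er'; lia.
apply/occursP; exists r'; first exact: ltnW.
by have := vst_col rr (ltnW cr'); have := vst_row (leqnSn c) cr'; rewrite Er Er'; lia.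
Qed.

Lemma colw_out (D : nat -> nat -> bool) c : (forall r, D r c -> c < nth 0 lam r) ->
  ncols V <= c -> colw V.1 D c = [::].
Proof.
rewrite ncolsE => Din le; apply/eqP; case E: colw => [//|v s].
have /mem_colw[r [_ /Din cr _]] : v \in colw V.1 D c by rewrite E mem_head.
by have := part_le (leq0n r); lia.
Qed.

Lemma eq_height p m p' m' : p =1 p' -> m =1 m' -> height p m =1 height p' m'.
Proof. by move=> Ep Em; elim=> //= k ->; rewrite Ep Em. Qed.

Definition HA i := height (aplus (occurs i) (occurs_na i)) (aminus (occurs i.+1) (occurs_na i.+1)).
Definition HB i := height (bplus (occurs i) (occurs_na i)) (bminus (occurs i.+1) (occurs_na i.+1)).

Lemma hgt_anchor i : hgt i (anchor_word V) =1 HA i.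
Proof. by apply: eq_height => c; rewrite anchor_mem. Qed.

Lemma hgt_buoy i : hgt i (colw V.1 (is_buoy V)) =1 HB i.
Proof. by apply: eq_height => c; rewrite buoy_mem. Qed.

Lemma eq_pivot (H H' : nat -> int) c : H =1 H' -> pivot H c -> pivot H' c.
Proof. by move=> E [p1 p2]; split=> k; rewrite -!E; [exact: p1|exact: p2]. Qed.

Definition bcol c := [seq (r, c) | r <- rev (iota 0 (size V.1)) & is_buoy V r c].

Lemma buoysE : buoys V = flatten [seq bcol c | c <- iota 0 (ncols V)].
Proof.
rewrite /buoys /rd_boxes filter_flatten -map_comp; congr flatten; apply: eq_map => c /=.
rewrite filter_map; congr map; rewrite -filter_predI; apply: eq_filter => r /=.
by case E: (is_buoy V r c) => //=; rewrite vst_row1 buoy_in.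
Qed.

Lemma letters_bcol c : letters V.1 (bcol c) = colw V.1 (is_buoy V) c.
Proof. by rewrite /letters /bcol -map_comp. Qed.

Lemma letters_flatten_bcol j m :
  letters V.1 (flatten [seq bcol c | c <- iota j m]) =
  colwords (colw V.1 (is_buoy V)) j m.
Proof.
rewrite /letters map_flatten -map_comp /colwords; congr flatten.
by apply: eq_map => c; exact: letters_bcol.
Qed.

Lemma letters_buoys : letters V.1 (buoys V) = colwords (colw V.1 (is_buoy V)) 0 (ncols V).
Proof. by rewrite buoysE letters_flatten_bcol. Qed.

Lemma buoys_split a r c b : buoys V = a ++ (r, c) :: b ->
  let hi := [seq ent V.1 s c | s <- iota r.+1 (size V.1 - r.+1) & is_buoy V s c] in
  let lo := [seq ent V.1 s c | s <- iota 0 r & is_buoy V s c] in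
  [/\ is_buoy V r c, c < ncols V,
      letters V.1 a = colwords (colw V.1 (is_buoy V)) 0 c ++ rev hi &
      letters V.1 b = rev lo ++ colwords (colw V.1 (is_buoy V)) c.+1 (ncols V - c.+1)].
Proof.
move=> E hi lo.
have : (r, c) \in buoys V by rewrite E mem_cat mem_head orbT.
rewrite {1}buoysE => /flattenP[s /mapP[c' c'L ->] /mapP[r']].
rewrite mem_filter mem_rev => /andP[bu r'T] [Er Ec]; subst r' c'.
move: c'L r'T; rewrite !mem_iota /= !add0n => cL rT.
pose hib := [seq (s, c) | s <- iota r.+1 (size V.1 - r.+1) & is_buoy V s c].
pose lob := [seq (s, c) | s <- iota 0 r & is_buoy V s c].
have Eb : bcol c = rev hib ++ (r, c) :: rev lob.
  rewrite /bcol filter_rev map_rev -{1}(subnKC (ltnW rT)) iotaD add0n.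
  by rewrite -(subnSK rT) filter_cat map_cat rev_cat /= bu /= rev_cons cat_rcons.
have := E; rewrite buoysE.
have -> : iota 0 (ncols V) = iota 0 c ++ c :: iota c.+1 (ncols V - c.+1).
  by rewrite -{1}(subnKC (ltnW cL)) iotaD add0n -(subnSK cL).
rewrite map_cat flatten_cat /= Eb -!catA cat_cons catA => E2.
have notin j m : (c < j) || (j + m <= c) -> (r, c) \notin flatten [seq bcol d | d <- iota j m].
  move=> cj; apply/negP => /flattenP[q /mapP[d dj ->] /mapP[r' _ [_ Ed]]].
  by move: dj; rewrite -Ed mem_iota; lia.
have n1 : (r, c) \notin flatten [seq bcol d | d <- iota 0 c] ++ rev hib.
  rewrite mem_cat negb_or notin ?leqnn ?orbT //= mem_rev.
  by apply/negP => /mapP[q + [Eq]]; rewrite mem_filter mem_iota -Eq; lia.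
have n2 : (r, c) \notin rev lob ++ flatten [seq bcol d | d <- iota c.+1 (ncols V - c.+1)].
  rewrite mem_cat negb_or notin ?ltnSn // andbT mem_rev.
  by apply/negP => /mapP[q + [Eq]]; rewrite mem_filter mem_iota -Eq; lia.
(* The box occurs only once in the list, so both decompositions cut it at the same place. *)
have [[d [_ Eb1]]|[Ea _ Eb1]|[d [Ea _]]] := cat_cons_split E2.
- by move: n2; rewrite Eb1 mem_cat mem_head orbT.
- split=> //.
    by rewrite -Ea /letters map_cat -/(letters V.1 _) letters_flatten_bcol map_rev -map_comp.
  rewrite -Eb1 /letters map_cat map_rev -map_comp; congr (_ ++ _).
  exact: letters_flatten_bcol.
- by move: n1; rewrite Ea mem_cat mem_head orbT.
Qed.

End VSTFacts.

(** * Crystal operators on valued-set tableaux *)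

Definition aw (V : vst) : seq nat := colwords (anchor_word V) 0 (ncols V).

(** Inside column c the letters before the changed one exceed i+1 and those after it are below i, so
    they do not disturb the conditions on the other columns. *)
Lemma cols_fstep i f g L c hi lo : c < L ->
  sorted gtn (f c) -> sorted gtn (g c) ->
  f c = hi ++ i :: lo -> g c = hi ++ i.+1 :: lo ->
  (forall d, d != c -> f d = g d) ->
  eps i (colwords f 0 c) = 0 -> phi i (colwords f c.+1 (L - c.+1)) = 0 ->
  fstep i (colwords f 0 L) (colwords g 0 L).
Proof.
move=> cL sfc sgc Ef Eg fg e0 p0.
have gt_trans : transitive gtn by move=> y z t /= h1 h2; exact: ltn_trans h1.
have hi_gt x : x \in hi -> i.+1 < x.
  move=> xh; move: sgc; rewrite Eg (sorted_pairwise gt_trans) pairwise_cat.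
  by move=> /and3P[/allrelP H _ _]; apply: H => //; rewrite mem_head.
have lo_lt x : x \in lo -> x < i.
  move=> xl; move: sfc; rewrite Ef (sorted_pairwise gt_trans) pairwise_cat /=.
  by move=> /and3P[_ _ /andP[/allP H _]]; exact: H.
exists (colwords f 0 c ++ hi), (lo ++ colwords f c.+1 (L - c.+1)); split.
- by rewrite (colwords_split _ cL) Ef -!catA.
- rewrite (colwords_split _ cL) Eg -!catA; congr (_ ++ (_ ++ _ :: _ ++ _)).
    by apply: eq_colwords => d dc; rewrite fg //; lia.
  by apply: eq_colwords => d dc; rewrite fg //; lia.
- by rewrite eps_cat e0 eps_notin //; apply/negP => /hi_gt; lia.
- rewrite phi_cat p0 phi_notin //; apply/negP => /lo_lt; lia.
Qed.

Lemma colw_split2 T (D : nat -> nat -> bool) m c : m.+1 < size T ->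
  colw T D c =
    rev [seq ent T s c | s <- iota m.+2 (size T - m.+2) & D s c] ++
    nseq (D m.+1 c) (ent T m.+1 c) ++ nseq (D m c) (ent T m c) ++
    rev [seq ent T s c | s <- iota 0 m & D s c].
Proof.
move=> mT; rewrite (colw_split _ _ mT); congr (_ ++ (_ ++ _)).
rewrite -addn1 iotaD filter_cat map_cat rev_cat /=.
by case: (D m c).
Qed.

Section Operators.

Variables (lam : seq nat) (V : vst).
Hypotheses (hlam : is_part lam) (hV : VSToo lam V).

(** If the column had a buoy of the other letter as well, the two would cancel. So the column makes
    a pure step of the walk. *)
Lemma buoy_pivot i a b r c :
  buoys V = a ++ (r, c) :: b -> eps i (letters V.1 a) = 0 ->
  phi i (letters V.1 b) = 0 -> ent V.1 r c = i \/ ent V.1 r c = i.+1 ->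
  let bp := bplus (occurs lam V i) (occurs_na lam V i) c in
  let bm := bminus (occurs lam V i.+1) (occurs_na lam V i.+1) c in
  [/\ is_buoy V r c, c < ncols V, pivot (HB lam V i) c,
      (ent V.1 r c = i -> bp /\ ~~ bm)
    & (ent V.1 r c = i.+1 -> bm /\ ~~ bp)].
Proof.
move=> E ea pb v_i; have [bu cL Ea Eb] := buoys_split hlam hV E.
set f := colw V.1 (is_buoy V) in Ea Eb.
set hi := [seq _ | _ <- iota r.+1 _ & _] in Ea.
set lo := [seq _ | _ <- iota 0 r & _] in Eb.
have cr : c < nth 0 lam r := buoy_in hV bu.
have hi_gt x : x \in rev hi -> ent V.1 r c < x.
  rewrite mem_rev => /mapP[s]; rewrite mem_filter mem_iota => /andP[bs /andP[rs _]] ->.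
  exact: (vst_col hV rs (buoy_in hV bs)).
have lo_lt x : x \in rev lo -> x < ent V.1 r c.
  rewrite mem_rev => /mapP[s]; rewrite mem_filter mem_iota => /andP[bs /andP[_ rs]] ->.
  exact: (vst_col hV rs cr).
have ph : phi i (rev hi) = 0.
  by apply: phi_notin; apply/negP => /hi_gt; case: v_i => ->; lia.
have el : eps i (rev lo) = 0.
  by apply: eps_notin; apply/negP => /lo_lt; case: v_i => ->; lia.
move: ea pb; rewrite Ea Eb eps_cat phi_cat ph el => ea pb.
have sf d : sorted gtn (f d) by apply: (colw_sorted hV) => s; exact: (buoy_in hV).
have pv : pivot (HB lam V i) c.
  apply: (eq_pivot (hgt_buoy hV i)); apply: (@words_pivot _ _ sf (ncols V)) => //.
  - by move=> d dL; apply: (colw_out hlam hV) => // s; exact: (buoy_in hV).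
  - by lia.
  - by lia.
have cnt := phi_eps_count i (rev hi); have cnl := phi_eps_count i (rev lo).
have nmem v : v != ent V.1 r c -> v \in f c -> v \in rev hi \/ v \in rev lo.
  move=> ne; rewrite /f (colw_split _ _ (r := r)); last first.
    by rewrite (vst_size1 hV) (part_size cr).
  rewrite !mem_cat mem_nseq (negbTE ne) andbF /=.
  by move=> /orP.
have memc : ent V.1 r c \in f c.
  by apply/mem_colw; exists r; rewrite (vst_size1 hV) (part_size cr).
split=> //; rewrite /bplus /bminus -!(buoy_mem hV) -/f => Ev;
  rewrite Ev in memc nmem hi_gt lo_lt; split=> //; apply/negP => vf.
  have [|H|/lo_lt] := nmem _ _ vf; [by lia| |by lia].
  have : 0 < count_mem i.+1 (rev hi) by rewrite -has_count has_pred1.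
  have /count_memPn : i \notin rev hi by apply/negP => /hi_gt; lia.
  by lia.
have [|/hi_gt|H] := nmem _ _ vf; [by lia|by lia|].
have : 0 < count_mem i (rev lo) by rewrite -has_count has_pred1.
have /count_memPn : i.+1 \notin rev lo by apply/negP => /lo_lt; lia.
by lia.
Qed.

Lemma HA_bound i M : (forall k, HB lam V i k <= M)%R -> forall k, (HA lam V i k <= M)%R.
Proof.
by apply: HA_le => c; [exact: (na_occurs hV)|exact: (na_occurs hV)|exact: (na_minus_plus hlam hV)].
Qed.

Lemma buoy_sorted d : sorted gtn (colw V.1 (is_buoy V) d).
Proof. by apply: (colw_sorted hV) => s; exact: (buoy_in hV). Qed.

Lemma buoy_out d : ncols V <= d -> colw V.1 (is_buoy V) d = [::].
Proof. by move=> dL; apply: (colw_out hlam hV) => // s; exact: (buoy_in hV). Qed.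

Lemma phi_buoys0 i : phi i (letters V.1 (buoys V)) = 0 -> phi i (aw V) = 0.
Proof.
rewrite (letters_buoys hV) => p0.
have le k : (HB lam V i k <= 0)%R.
  rewrite -(hgt_buoy hV); have H := phi0_hgt buoy_sorted p0.
  have [kL|Lk] := leqP k (ncols V); first exact: H.
  by rewrite (hgt_const _ (@buoy_out) (ltnW Lk)); apply: H; rewrite leqnn.
apply: colwords_phi0 => [c|k _]; first exact: (aw_sorted hV).
by rewrite !(hgt_anchor hV); exact: HA_bound.
Qed.

Lemma eps_buoys0 i : eps i (letters V.1 (buoys V)) = 0 -> eps i (aw V) = 0.
Proof.
rewrite (letters_buoys hV) => e0.
have le k : (HB lam V i k <= HB lam V i (ncols V))%R.
  rewrite -!(hgt_buoy hV); have H := eps0_hgt buoy_sorted e0.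
  have [kL|Lk] := leqP k (ncols V); first exact: H.
  by rewrite (hgt_const _ (@buoy_out) (ltnW Lk)).
apply: colwords_eps0 => [c|k _]; first exact: (aw_sorted hV).
rewrite !(hgt_anchor hV) add0n.
(* No group is open at the end of the last column, so both walks end at the same height. *)
suff <- : HB lam V i (ncols V) = HA lam V i (ncols V) by exact: HA_bound.
case EL: (ncols V) => [//|L]; rewrite /HA heightAB; try by move=> ?; exact: (na_occurs hV).
have na v : occurs_na lam V v L = false.
  apply/negP => /(occurs_naP hV)[r /andP[lt _] _].
  by have := part_le hlam (leq0n r); rewrite -(ncolsE hV) EL; lia.
by rewrite !na GRing.addr0 GRing.subr0.
Qed.

(** A group has one buoy and one anchor, with the same letter; the partial counts differ by the
    group still open. *)
Lemma count_buoys v : count_mem v (letters V.1 (buoys V)) = count_mem v (aw V).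
Proof.
rewrite (letters_buoys hV) /aw.
have S f k : count_mem v (colwords f 0 k.+1) =
    count_mem v (colwords f 0 k) + count_mem v (f k).
  by rewrite -addn1 colwords_cat count_cat (colwordsS f _ 0) count_cat /= addn0.
have H k : count_mem v (colwords (colw V.1 (is_buoy V)) 0 k.+1) =
    count_mem v (colwords (anchor_word V) 0 k.+1) + occurs_na lam V v k.
  elim: k => [|k IH]; rewrite S [in RHS]S ?IH (count_decreasing v (buoy_sorted _))
    (count_decreasing v (aw_sorted hV _)) (buoy_mem hV) (anchor_mem hV) /=.
    by have := @na_occurs _ _ hV v 0; case: occurs; case: occurs_na => //= /(_ isT)[].
  have := @na_occurs _ _ hV v k; have := @na_occurs _ _ hV v k.+1.
  by case: (occurs _ _ _ k.+1); case: occurs_na => /= H1; case: occurs_na => /= H2;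
     try (by have [] := H1 isT); try (by have [] := H2 isT); lia.
case EL: (ncols V) => [//|L]; rewrite H (_ : occurs_na lam V v L = false) ?addn0 //.
apply/negP => /(occurs_naP hV)[r /andP[lt _] _].
by have := part_le hlam (leq0n r); rewrite -(ncolsE hV) EL; lia.
Qed.

Lemma anchor_colP r c : is_buoy V r c -> let a := anchor_col V r c in
  [/\ c <= a < nth 0 lam r, forall d, c <= d < a -> nanchor lam V r d,
      ~~ nanchor lam V r a & forall d, c <= d <= a -> ent V.1 r d = ent V.1 r c].
Proof.
move=> bu /=; have cr := buoy_in hV bu.
rewrite /anchor_col; set row := nth [::] V.2 r; set k := find _ _.
have szd : size (drop c.+1 row) = nth 0 lam r - c.+1 by rewrite size_drop (vst_row2 hV).
have kle : k <= nth 0 lam r - c.+1 by rewrite -szd find_size.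
have na d : c <= d < c + k -> nanchor lam V r d.
  move=> dk; rewrite /nanchor; apply/andP; split; first by lia.
  have /(before_find false) : d - c < k by lia.
  by rewrite nth_drop /is_buoy -/row (_ : c.+1 + (d - c) = d.+1) => [->|]; last lia.
split=> //; first by lia.
  rewrite /nanchor; case: ltnP => //= lt; rewrite negbK.
  have : has id (drop c.+1 row) by rewrite has_find szd -/k; lia.
  by move=> /(nth_find false); rewrite nth_drop -/k addSn.
elim=> [|d IH] dk; first by rewrite (_ : c = 0) //; lia.
have [->//|ne] := eqVneq d.+1 c.
by rewrite (nanchor_eq hV) ?IH ?na //; lia.
Qed.

Section ChangeGroup.

Variables (r c v : nat).
Hypotheses (bu : is_buoy V r c) (v0 : 0 < v).
Let a := anchor_col V r c.
Hypothesis left_le : forall d, d < c -> ent V.1 r d <= v.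
Hypothesis right_ge : forall d, a < d -> d < nth 0 lam r -> v <= ent V.1 r d.
Hypothesis above_lt : forall s d, s < r -> c <= d <= a -> ent V.1 s d < v.
Hypothesis below_gt : forall s d, r < s -> c <= d <= a -> d < nth 0 lam s -> v < ent V.1 s d.
Let V' := change_group V r c v.

Lemma change_group_ent s d : d < nth 0 lam s ->
  ent V'.1 s d = if (s == r) && (c <= d <= a) then v else ent V.1 s d.
Proof. by move=> ds; rewrite /V' /= /set_range ent_mkfill (vst_shape1 hV) ds. Qed.

Lemma change_group_VST : VSToo lam V'.
Proof.
have [/andP[ca ar] nad nna entE] := anchor_colP bu; rewrite -/a in ca ar nad nna entE.
split; last first.
- move=> s d ds; rewrite -[is_buoy V' s d.+1]/(is_buoy V s d.+1) => nb.
  rewrite !change_group_ent //; last exact: ltnW.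
  have -> : ent V.1 s d.+1 = ent V.1 s d by exact: (nbuoy_eq hV).
  have [Es|//] := eqVneq s r; rewrite Es /= in ds nb *.
  (* The two boxes belong to one group, so both are changed or neither is. *)
  have ne1 : d.+1 <> c by move=> E; rewrite E bu in nb.
  have ne2 : d <> a by move=> E; move: nna; rewrite /nanchor -E ds nb.
  by have -> : (c <= d.+1 <= a) = (c <= d <= a) by lia.
- by move=> s sl; have [_ _ H _] := hV; exact: H.
- exact: (vst_shape2 hV).
split; first by rewrite /V' /= /set_range shape_mkfill (vst_shape1 hV).
- move=> s d ds; rewrite change_group_ent //; case: ifP => // _; exact: (vst_pos hV).
- move=> s d d' dd ds; have ds' := leq_ltn_trans dd ds.
  rewrite !change_group_ent //; have [Es|_] := eqVneq s r => /=; last exact: (vst_row hV).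
  rewrite Es in ds ds' *; case: ifP => i1; case: ifP => i2 //.
  + by apply: right_ge => //; lia.
  + by apply: left_le; lia.
  + exact: (vst_row hV).
- move=> s s' d ss ds; have ds' := leq_trans ds (part_le hlam (ltnW ss)).
  rewrite !change_group_ent //; case: ifP => /= [/andP[/eqP Es dc]|_].
    rewrite Es in ss; rewrite (gtn_eqF ss) /=; exact: below_gt.
  case: ifP => [/andP[/eqP Es dc]|_]; last exact: (vst_col hV).
  by rewrite Es in ss; exact: above_lt.
Qed.

Lemma change_group_words :
  (forall d, d != a -> anchor_word V' d = anchor_word V d) /\
  exists hi lo, anchor_word V a = hi ++ ent V.1 r c :: lo /\
                anchor_word V' a = hi ++ v :: lo.
Proof.
have [/andP[ca ar] nad nna entE] := anchor_colP bu; rewrite -/a in ca ar nad nna entE.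
have sz : size V'.1 = size V.1 by rewrite /V' /= size_map size_iota size_map.
have rT : r < size V.1 by rewrite (vst_size1 hV) (part_size ar).
have anc s d : is_anchor V' s d = is_anchor V s d by [].
split=> [d da|].
  rewrite /anchor_word sz; apply/eq_in_map => s; rewrite mem_filter anc.
  move=> /andP[an _]; have ds := anchor_in hV an; rewrite change_group_ent //.
  case: ifP => // /andP[/eqP Es dc]; move: an; rewrite (anchorE hV) Es nad ?andbF //.
  by lia.
exists (rev [seq ent V.1 s a | s <- iota r.+1 (size V.1 - r.+1) & is_anchor V s a]).
exists (rev [seq ent V.1 s a | s <- iota 0 r & is_anchor V s a]).
have an : is_anchor V r a by rewrite (anchorE hV) ar nna.
split.
  rewrite -[anchor_word V a]/(colw V.1 (is_anchor V) a) (colw_split _ _ rT) an /=.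
  by rewrite entE ?ca ?leqnn.
rewrite -[anchor_word V' a]/(colw V'.1 (is_anchor V) a) (colw_split _ _ (r := r)) ?sz // an /=.
rewrite change_group_ent // eqxx ca leqnn /=; congr (_ ++ _ :: _); congr rev;
  apply/eq_in_map => s; rewrite mem_filter mem_iota => /andP[an' sr];
  rewrite change_group_ent ?(anchor_in hV) //; case: eqP => //; lia.
Qed.

End ChangeGroup.

Section MoveDivider.

Variables (r r' c : nat).
Hypotheses (rr : r' = r.+1 \/ r = r'.+1) (bu : is_buoy V r c.+1).
Hypotheses (ent_eq : ent V.1 r c.+1 = ent V.1 r c) (na : nanchor lam V r' c).
Let V' := move_divider V r r' c.+1.

Lemma move_divider_buoy s d : is_buoy V' s d =
  if (s == r) && (d == c.+1) then false
  else if (s == r') && (d == c.+1) then true else is_buoy V s d.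
Proof.
rewrite /V' /is_buoy /= nth_mkfill (vst_shape2 hV); have /andP[cr' _] := na.
case: ifP => ds; do 2 case: ifP => //.
  by move=> /andP[/eqP Es /eqP Ed]; rewrite Es Ed cr' in ds.
by move=> _ _; rewrite nth_default // (vst_row2 hV) leqNgt ds.
Qed.

Lemma move_divider_VST : VSToo lam V'.
Proof.
split; first by have [] := hV.
- by rewrite /V' /= shape_mkfill (vst_shape2 hV).
- by move=> s sl; rewrite move_divider_buoy !andbF; have [_ _ H _] := hV; exact: H.
- move=> s d ds; rewrite move_divider_buoy; case: ifP => [/andP[/eqP-> /eqP[->]] _ //|_].
  by case: ifP => // _; exact: (nbuoy_eq hV).
Qed.

Lemma move_divider_anchor s d : is_anchor V' s d =
  if (s == r) && (d == c) then false
  else if (s == r') && (d == c) then true else is_anchor V s d.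
Proof.
rewrite (anchorE move_divider_VST) (anchorE hV) /nanchor move_divider_buoy eqSS.
have cr := buoy_in hV bu; have /andP[cr' _] := na.
case: ifP => [/andP[/eqP-> /eqP->]|_]; first by rewrite cr andbF.
case: ifP => [/andP[/eqP-> /eqP->]|_ //]; by rewrite andbF (ltnW cr').
Qed.

(** The two rows are adjacent, so the anchor removed and the anchor added take the same place in the
    word of the column. *)
Lemma move_divider_words :
  (forall d, d != c -> anchor_word V' d = anchor_word V d) /\
  exists hi lo, anchor_word V c = hi ++ ent V.1 r c :: lo /\
                anchor_word V' c = hi ++ ent V.1 r' c :: lo.
Proof.
have cr := buoy_in hV bu; have /andP[cr' nb'] := na.
have rT : r < size V.1 by rewrite (vst_size1 hV) (part_size cr).
have r'T : r' < size V.1 by rewrite (vst_size1 hV) (part_size cr').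
split=> [d dc|].
  rewrite /anchor_word; congr map; apply: eq_filter => s.
  by rewrite move_divider_anchor (negbTE dc) !andbF.
have anr : is_anchor V r c by rewrite (anchorE hV) (ltnW cr) /nanchor bu andbF.
have anr' : is_anchor V r' c = false by rewrite (anchorE hV) na andbF.
have ar : is_anchor V' r c = false by rewrite move_divider_anchor !eqxx.
have ne : (r' == r) = false by case: rr => ->; lia.
have ar' : is_anchor V' r' c by rewrite move_divider_anchor !eqxx andbT ne.
have out s : s != r -> s != r' -> is_anchor V' s c = is_anchor V s c.
  by move=> /negbTE n1 /negbTE n2; rewrite move_divider_anchor n1 n2.
rewrite -[anchor_word V c]/(colw V.1 (is_anchor V) c).
rewrite -[anchor_word V' c]/(colw V.1 (is_anchor V') c).
pose m := minn r r'; have mT : m.+1 < size V.1 by rewrite /m; lia.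
rewrite !(colw_split2 _ _ mT).
exists (rev [seq ent V.1 s c | s <- iota m.+2 (size V.1 - m.+2) & is_anchor V s c]).
exists (rev [seq ent V.1 s c | s <- iota 0 m & is_anchor V s c]).
have -> : [seq s <- iota m.+2 (size V.1 - m.+2) | is_anchor V' s c] =
          [seq s <- iota m.+2 (size V.1 - m.+2) | is_anchor V s c].
  by apply: eq_in_filter => s; rewrite mem_iota => sm; apply: out; lia.
have -> : [seq s <- iota 0 m | is_anchor V' s c] = [seq s <- iota 0 m | is_anchor V s c].
  by apply: eq_in_filter => s; rewrite mem_iota => sm; apply: out; lia.
case: rr => E.
  by have -> : m = r by [rewrite /m; lia]; rewrite -E anr anr' ar ar'.
by have -> : m = r' by [rewrite /m; lia]; rewrite -E anr anr' ar ar'.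
Qed.

End MoveDivider.

End Operators.

Section OperatorSteps.

Variables (lam : seq nat) (V : vst).
Hypotheses (hlam : is_part lam) (hV : VSToo lam V).

Lemma ent_in r c : ent V.1 r c != 0 -> c < nth 0 lam r.
Proof.
by apply: contraR; rewrite -leqNgt -{1}(vst_shape1 hV) => /ent_out ->.
Qed.

Definition same_sizes (V' : vst) :=
  forall c, size (anchor_word V' c) = size (anchor_word V c).

Lemma pivot_fstep i V' c hi lo : VSToo lam V' -> c < ncols V ->
  pivot (HA lam V i) c -> (forall d, d != c -> anchor_word V' d = anchor_word V d) ->
  anchor_word V c = hi ++ i :: lo -> anchor_word V' c = hi ++ i.+1 :: lo ->
  fstep i (aw V) (aw V') /\ same_sizes V'.
Proof.
move=> hV' cL pv eqw Ew Ew'.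
have [|e0 p0] := @pivot_words i (anchor_word V) (aw_sorted hV) _ _ cL.
  by apply: eq_pivot pv => k; rewrite (hgt_anchor hV).
split; last first.
  by move=> d; have [->|/eqw->//] := eqVneq d c; rewrite Ew Ew' !size_cat.
rewrite /aw (ncolsE hV') -(ncolsE hV).
apply: (cols_fstep cL (aw_sorted hV _) (aw_sorted hV' _) Ew Ew') => //.
by move=> d /eqw.
Qed.

Lemma pivot_estep i V' c hi lo : VSToo lam V' -> c < ncols V ->
  pivot (HA lam V i) c -> (forall d, d != c -> anchor_word V' d = anchor_word V d) ->
  anchor_word V c = hi ++ i.+1 :: lo -> anchor_word V' c = hi ++ i :: lo ->
  fstep i (aw V') (aw V) /\ same_sizes V'.
Proof.
move=> hV' cL pv eqw Ew Ew'.
have [|e0 p0] := @pivot_words i (anchor_word V) (aw_sorted hV) _ _ cL.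
  by apply: eq_pivot pv => k; rewrite (hgt_anchor hV).
split; last first.
  by move=> d; have [->|/eqw->//] := eqVneq d c; rewrite Ew Ew' !size_cat.
rewrite /aw (ncolsE hV') -(ncolsE hV).
apply: (cols_fstep cL (aw_sorted hV' _) (aw_sorted hV _) Ew' Ew) => //.
  by rewrite (@eq_colwords _ (anchor_word V)) // => d dc; apply: eqw; lia.
by rewrite (@eq_colwords _ (anchor_word V)) // => d dc; apply: eqw; lia.
Qed.

Lemma anchor_col_na r c : is_buoy V r c -> let a := anchor_col V r c in
  [/\ c <= a < nth 0 lam r,
      forall d, c <= d < a -> occurs_na lam V (ent V.1 r c) d,
      ~~ occurs_na lam V (ent V.1 r c) a
    & forall d, c <= d <= a -> ent V.1 r d = ent V.1 r c].
Proof.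
move=> bu a; have [ca na nna entE] := anchor_colP hlam hV bu; split=> //.
  move=> d dc; apply/(occurs_naP hV); exists r; first exact: na.
  by apply: entE; lia.
apply/negP => /(occurs_naP hV)[s nas Es]; have /andP[sa _] := nas.
have E : s = r.
  apply: (vst_col_inj hV (c := a)); [exact: ltnW|by case/andP: ca|].
  by rewrite Es entE //; lia.
by move: nas; rewrite E; apply/negP.
Qed.

Lemma anchor_lt_ncols r c : c < nth 0 lam r -> c < ncols V.
Proof.
by move=> lt; rewrite (ncolsE hV); apply: leq_trans lt (part_le hlam (leq0n r)).
Qed.

(** The branches of [vst_f] are the two cases of the height analysis: a moved divider exchanges
    anchors in the column left of the buoy, a changed group acts at its own anchor, and in both
    cases this column is the pivot of the anchor walk. *)
Lemma vst_fP i V' : vst_f i V = Some V' ->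
  [/\ VSToo lam V', fstep i (aw V) (aw V') & same_sizes V'].
Proof.
rewrite /vst_f; case Ex: rightmost_plus => [[r c]|] //= [EV'].
have [a0 [b0 [Eb /= Eri ea pb]]] := rightmost_plusP Ex.
have [bu cL pv /(_ Eri)[bp bm] _] := buoy_pivot hlam hV Eb ea pb (or_introl Eri).
have cr := buoy_in hV bu.
have OX := @na_occurs _ _ hV i; have QY := @na_occurs _ _ hV i.+1.
have QX := @na_minus_plus _ _ hlam hV i; have OY := @na_plus_minus _ _ hlam hV i.
move: EV'; case: eqP => [Er1|Er1] <-.
  have cr1 : c < nth 0 lam r.+1 by apply: ent_in; rewrite Er1.
  have Yc : occurs lam V i.+1 c by apply/(occursP hV); exists r.+1.
  have [c' [Ec Qc' Xc' nO pA]] := plus_above_minus OX QY QX pv bp bm Yc.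
  have /(occurs_naP hV)[r2 na2 Er2] := Qc'; have /andP[c2 _] := na2.
  have E2 : r2 = r.+1.
    apply: (vst_col_inj hV c2); rewrite -?Ec //.
    by rewrite Er1 Ec (nanchor_eq hV na2).
  rewrite {r2 c2}E2 in na2 Er2.
  have /(occursP hV)[r1 c1 Er] := Xc'.
  have c'r : c' < nth 0 lam r by apply: ltnW; rewrite -Ec.
  (* Row r+1 holds i+1 in column c', and row r holds at most i there; so the i of this column is in
     row r. *)
  have E1 : r1 = r.
    have cr1' : c'.+1 < nth 0 lam r.+1 by rewrite -Ec.
    have lt1 := vst_col hV (ltnSn r) (ltnW cr1').
    have [lt|gt|//] := ltngtP r1 r; first by have := vst_col hV lt c'r; lia.
    have [|Eq] := ltnP r.+1 r1; first by move=> lt; have := vst_col hV lt c1; lia.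
    by move: Er Er2; have -> : r1 = r.+1 by [lia]; lia.
  rewrite E1 in Er; rewrite Ec in bu Eri *.
  have Eeq : ent V.1 r c'.+1 = ent V.1 r c' by rewrite Er Eri.
  have rr : r.+1 = r.+1 \/ r = r.+2 by left.
  have hV' := move_divider_VST hV Eeq na2.
  have [eqw [hi [lo [Ew Ew']]]] := move_divider_words hlam hV rr bu Eeq na2.
  rewrite Er in Ew; rewrite Er2 in Ew'.
  have [] := pivot_fstep hV' (anchor_lt_ncols c'r) pA eqw Ew Ew'.
  by split.
(* An i+1 in this column could only be directly below the buoy. *)
have nYc : ~~ occurs lam V i.+1 c.
  apply/negP => /(occursP hV)[s cs Es].
  have [lt|gt|Ers] := ltngtP s r.+1; last by apply: Er1; rewrite -Ers.
    have [lt'|Esr] := ltnP s r; first by have := vst_col hV lt' cr; lia.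
    by move: Es; have -> : s = r by [lia]; lia.
  have cs1 := leq_trans cs (part_le hlam (ltnW gt)).
  by have := vst_col hV (ltnSn r) cs1; have := vst_col hV gt cs; lia.
have [] := anchor_col_na bu; set a := anchor_col V r c => /andP[ca ar].
rewrite Eri => Oa nOa entE.
have [Xa pA] := plus_free OX QY QX OY pv bp bm ca Oa nOa nYc.
have nY d : c <= d <= a -> ~~ occurs lam V i.+1 d.
  exact: (plus_free_notY OY bp bm ca Oa nOa nYc).
have nxt := plus_free_next OY pv bp bm ca Oa nOa nYc.
have hV' : VSToo lam (change_group V r c i.+1).
  apply: (change_group_VST hlam hV bu) => //.
  - move=> d dc; have := vst_row hV (ltnW dc) cr; lia.
  - rewrite -/a => d ad dr; have dr' : a.+1 < nth 0 lam r by exact: leq_ltn_trans dr.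
    apply: leq_trans (vst_row hV ad dr).
    have := vst_row hV (leqnSn a) dr'; rewrite entE ?ca ?leqnn // leq_eqVlt.
    move=> /orP[/eqP Ea|//].
    (* If the box after the group held i, [nxt] would give an i+1 below it, and then an i+1 below
       the anchor, in a column free of i+1. *)
    have /nxt /(occursP hV)[s sa Es] : occurs lam V i a.+1 by apply/(occursP hV); exists r.
    have rs : r < s.
      rewrite ltnNge; apply/negP; rewrite leq_eqVlt => /orP[/eqP E|lt].
        by move: Es; rewrite E; lia.
      by have := vst_col hV lt dr'; lia.
    case/negP: (nY a ltac:(lia)); apply/(occursP hV); exists s; first exact: ltnW.
    have := vst_col hV rs (ltnW sa); have := vst_row hV (leqnSn a) sa.
    by rewrite (entE a) ?ca ?leqnn //; lia.
  - rewrite -/a => s d sr dc; have dr : d < nth 0 lam r by lia.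
    by have := vst_col hV sr dr; rewrite entE //; lia.
  - rewrite -/a => s d rs dc ds; have := vst_col hV rs ds; rewrite entE // leq_eqVlt.
    move=> /orP[/eqP E|//]; case/negP: (nY d dc); apply/(occursP hV); exists s => //.
have [eqw [hi [lo [Ew Ew']]]] := change_group_words hlam hV bu (ltn0Sn i).
rewrite -/a in eqw Ew Ew'; rewrite Eri in Ew.
have [] := pivot_fstep hV' (anchor_lt_ncols ar) pA eqw Ew Ew'.
by split.
Qed.

Lemma vst_f_none i : vst_f i V = None -> phi i (aw V) = 0.
Proof.
rewrite /vst_f; case Ex: rightmost_plus => [[r c]|] //= _.
by apply: (phi_buoys0 hlam hV); exact: rightmost_plus_none.
Qed.

Lemma vst_eP i V' : 0 < i -> vst_e i V = Some V' ->
  [/\ VSToo lam V', fstep i (aw V') (aw V) & same_sizes V'].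
Proof.
move=> i0; rewrite /vst_e; case Ex: leftmost_minus => [[r c]|] //= [EV'].
have [a0 [b0 [Eb /= Eri ea pb]]] := leftmost_minusP Ex.
have [bu cL pv _ /(_ Eri)[bm bp]] := buoy_pivot hlam hV Eb ea pb (or_intror Eri).
have cr := buoy_in hV bu.
have OX := @na_occurs _ _ hV i; have QY := @na_occurs _ _ hV i.+1.
have QX := @na_minus_plus _ _ hlam hV i; have OY := @na_plus_minus _ _ hlam hV i.
have [] := anchor_col_na bu; set a := anchor_col V r c in EV' * => /andP[ca ar].
rewrite Eri => Qa nQa entE.
move: EV'; case: ifP => [/andP[r0 /eqP Er1]|Er1] <-.
  have [q Eq] : exists q, r = q.+1 by exists r.-1; lia.
  subst r; rename q into r; rewrite /= in Er1.
  have ar1 := leq_trans ar (part_le hlam (leqnSn r)).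
  have Xa : occurs lam V i a by apply/(occursP hV); exists r.
  have [c' [Ec Oc' Yc' nQ [Xc pA]]] := minus_below_plus OX QY QX OY pv bm bp ca Qa nQa Xa.
  have /(occurs_naP hV)[r2 na2 Er2] := Oc'; have /andP[c2 _] := na2.
  have below s : c < nth 0 lam s -> ent V.1 s c = i -> s = r.
    move=> cs Es; have [lt|gt|//] := ltngtP s r.
      have := vst_col hV lt (leq_trans cr (part_le hlam (leqnSn r))).
      by have := vst_row hV ca ar1; lia.
    have [E|ne] := eqVneq s r.+1; first by move: Es; rewrite E; lia.
    by have := vst_col hV (_ : r.+1 < s) cs; rewrite Es Eri; lia.
  have E2 : r2 = r.
    by apply: below; rewrite Ec // (nanchor_eq hV na2).
  rewrite {r2 c2}E2 in na2 Er2.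
  have c'r : c' < nth 0 lam r.+1 by apply: ltnW; rewrite -Ec.
  have Er : ent V.1 r.+1 c' = i.+1.
    have := vst_col hV (ltnSn r) c'r; rewrite Er2.
    by have := vst_row hV (leqnSn c') (_ : c'.+1 < nth 0 lam r.+1); rewrite -Ec Eri cr => /(_ isT); lia.
  rewrite Ec in bu Eri *.
  have Eeq : ent V.1 r.+1 c'.+1 = ent V.1 r.+1 c' by rewrite Er Eri.
  have rr : r = r.+2 \/ r.+1 = r.+1 by right.
  have hV' := move_divider_VST hV Eeq na2.
  have [eqw [hi [lo [Ew Ew']]]] := move_divider_words hlam hV rr bu Eeq na2.
  rewrite Er in Ew; rewrite Er2 in Ew'.
  have [] := pivot_estep hV' (anchor_lt_ncols c'r) pA eqw Ew Ew'.
  by split.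
have nXa : ~~ occurs lam V i a.
  apply/negP => /(occursP hV)[s cs Es].
  have Era : ent V.1 r a = i.+1 by apply: entE; lia.
  have sr : s < r.
    rewrite ltnNge; apply/negP; rewrite leq_eqVlt => /orP[/eqP E|lt].
      by move: Es; rewrite -E; lia.
    by have := vst_col hV lt cs; lia.
  have [lt|Esr] := ltnP s r.-1.
    have := vst_col hV (_ : r.-1 < r) ar; have := vst_col hV lt (leq_trans ar (part_le hlam (leq_pred r))).
    by move=> h1 h2; have := h2 ltac:(lia); lia.
  move: Er1; have -> : r.-1 = s by lia.
  by rewrite Es eqxx andbT; lia.
have [Ya pA] := minus_free OX QY QX pv bm bp ca Qa nQa nXa.
have nX d : c <= d <= a -> ~~ occurs lam V i d by exact: (minus_free_notX QX Qa nXa).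
have prv := minus_free_prev QY QX pv bm bp ca nQa nXa.
have hV' : VSToo lam (change_group V r c i).
  apply: (change_group_VST hlam hV bu) => //.
  - move=> d dc; have Ec : c = c.-1.+1 by lia.
    have c'r : c.-1 < nth 0 lam r by lia.
    have le1 : ent V.1 r d <= ent V.1 r c.-1 by apply: (vst_row hV) => //; lia.
    apply: leq_trans le1 _; have := vst_row hV (leq_pred c) cr; rewrite Eri leq_eqVlt.
    move=> /orP[/eqP E|//].
    (* If the box before the group held i+1, [prv] would give an i above it, and then an i above the
       buoy. *)
    have /(prv _ Ec)/(occursP hV)[s cs Es] : occurs lam V i.+1 c.-1.
      by apply/(occursP hV); exists r.
    have sr : s < r.
      rewrite ltnNge; apply/negP; rewrite leq_eqVlt => /orP[/eqP E'|lt].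
        by move: Es; rewrite -E'; lia.
      by have := vst_col hV lt cs; lia.
    have crs := leq_trans cr (part_le hlam (ltnW sr)).
    case/negP: (nX c ltac:(lia)); apply/(occursP hV); exists s => //.
    by have := vst_row hV (leq_pred c) crs; have := vst_col hV sr cr; lia.
  - rewrite -/a => d ad dr; have := vst_row hV (ltnW ad) dr.
    by rewrite entE ?ca ?leqnn //; lia.
  - rewrite -/a => s d sr dc; have dr : d < nth 0 lam r by lia.
    have := vst_col hV sr dr; rewrite entE // ltnS leq_eqVlt => /orP[/eqP E|//].
    case/negP: (nX d dc); apply/(occursP hV); exists s => //.
    exact: leq_trans dr (part_le hlam (ltnW sr)).
  - rewrite -/a => s d rs dc ds; have := vst_col hV rs ds; rewrite entE //; lia.
have [eqw [hi [lo [Ew Ew']]]] := change_group_words hlam hV bu i0.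
rewrite -/a in eqw Ew Ew'; rewrite Eri in Ew.
have [] := pivot_estep hV' (anchor_lt_ncols ar) pA eqw Ew Ew'.
by split.
Qed.

Lemma vst_e_none i : vst_e i V = None -> eps i (aw V) = 0.
Proof.
rewrite /vst_e; case Ex: leftmost_minus => [[r c]|] //= _.
by apply: (eps_buoys0 hlam hV); exact: leftmost_minus_none.
Qed.

Lemma set_range_entries n T r a b v :
  entries_le n T -> v <= n -> entries_le n (set_range T r a b v).
Proof.
by move=> le vn s d; rewrite /set_range ent_mkfill; case: ifP => // _; case: ifP.
Qed.

Lemma vst_f_entries n i V' :
  vst_f i V = Some V' -> i < n -> entries_le n V.1 -> entries_le n V'.1.
Proof.
rewrite /vst_f; case: rightmost_plus => [[r c]|] //= [<-] lt le.
by case: ifP => // _; exact: set_range_entries.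
Qed.

Lemma vst_e_entries n i V' :
  vst_e i V = Some V' -> i < n -> entries_le n V.1 -> entries_le n V'.1.
Proof.
rewrite /vst_e; case: leftmost_minus => [[r c]|] //= [<-] lt le.
by case: ifP => // _; apply: set_range_entries => //; exact: ltnW.
Qed.

End OperatorSteps.

(** * Semistandard tableaux as valued-set tableaux *)

(** With every box its own group, the buoy and anchor words are both the column word of the
    tableau. *)
Definition allb (T : tableau) : vst := (T, [seq nseq k true | k <- shape T]).

Lemma nth_allb T r d c : nth d (nth [::] (allb T).2 r) c =
  if c < size (nth [::] T r) then true else d.
Proof.
rewrite /allb /=; have [rT|Tr] := ltnP r (size T); last first.
  by rewrite [nth [::] T r]nth_default // [nth [::] _ r]nth_default ?nth_nil // !size_map.
by rewrite (nth_map 0) ?size_map // nth_shape nth_nseq.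
Qed.

Lemma allb_buoy T r c : is_buoy (allb T) r c = (c < size (nth [::] T r)).
Proof. by rewrite /is_buoy nth_allb; case: ifP. Qed.

Lemma allb_VST lam T : is_part lam -> semistandard lam T -> VSToo lam (allb T).
Proof.
move=> hlam ssT; have [sh _ _ _] := ssT; split=> //.
- rewrite /allb /= sh /shape -map_comp -[RHS]map_id; apply: eq_map => k /=.
  by rewrite size_nseq.
- by move=> r rl; rewrite allb_buoy -nth_shape sh part_pos.
- by move=> r c lt; rewrite allb_buoy -nth_shape sh lt.
Qed.

Lemma rd_boxes_in T x : x \in rd_boxes T -> x.2 < size (nth [::] T x.1).
Proof.
move=> /flattenP[s /mapP[c _ ->]] /mapP[r].
by rewrite mem_filter => /andP[lt _] ->.
Qed.

Lemma allb_buoys T : buoys (allb T) = rd_boxes T.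
Proof. by apply/all_filterP/allP => x /rd_boxes_in; rewrite allb_buoy. Qed.

Lemma allb_anchor T r c : is_anchor (allb T) r c = (c < size (nth [::] T r)).
Proof.
rewrite /is_anchor nth_allb if_same andbT; have [rT|Tr] := ltnP r (size T).
  by rewrite /allb /= (nth_map 0) ?size_map // size_nseq nth_shape.
by rewrite !nth_default // !size_map.
Qed.

Lemma allb_aw T : aw (allb T) = crw T.
Proof.
rewrite /aw /colwords /crw /letters /rd_boxes map_flatten -map_comp.
congr flatten; apply: eq_map => c /=; rewrite -map_comp /anchor_word /=.
congr map; apply: eq_filter => r; exact: allb_anchor.
Qed.

Section SSYTOperators.

Variables (lam : seq nat) (T : tableau).
Hypotheses (hlam : is_part lam) (ssT : semistandard lam T).

Let hV : VSToo lam (allb T) := allb_VST hlam ssT.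

Lemma allb_nanchor r c : nanchor lam (allb T) r c = false.
Proof.
by rewrite /nanchor allb_buoy -nth_shape; have [-> _ _ _] := ssT; rewrite andbN.
Qed.

Lemma allb_occurs_na v c : occurs_na lam (allb T) v c = false.
Proof. by apply/negP => /(occurs_naP hV)[r]; rewrite allb_nanchor. Qed.

Lemma allb_anchor_col r c : is_buoy (allb T) r c -> anchor_col (allb T) r c = c.
Proof.
move=> bu; have [/andP[ca _] na _ _] := anchor_colP hlam hV bu.
apply/eqP; rewrite eqn_leq ca andbT leqNgt; apply/negP => lt.
by have := na c; rewrite leqnn lt allb_nanchor => /(_ isT).
Qed.

Lemma allb_set_range r c v : change_group (allb T) r c v =
  (set_range T r c (anchor_col (allb T) r c) v, (allb T).2).
Proof. by []. Qed.

(** A divider is never moved: an i+1 below the chosen i would be a buoy of the same column and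
    cancel it. *)
Lemma ssyt_f_allb i T' : ssyt_f i T = Some T' -> vst_f i (allb T) = Some (allb T').
Proof.
rewrite /ssyt_f /vst_f allb_buoys /=; case Ex: rightmost_plus => [[r c]|] //= [<-].
have [a [b [Eb /= Eri ea pb]]] := rightmost_plusP Ex.
have [|bu _ _ /(_ Eri)[_ bm] _] := buoy_pivot hlam hV _ ea pb (or_introl Eri).
  by rewrite allb_buoys.
case: eqP => [E1|_].
  case/negP: bm; rewrite /bminus; apply/andP; split.
    apply/(occursP hV); exists r.+1 => //.
    by apply: (ent_in hV); rewrite /= E1.
  by case: (c) => //= d; rewrite allb_occurs_na.
by rewrite allb_set_range allb_anchor_col // /allb /set_range shape_mkfill.
Qed.

Lemma ssyt_e_allb i T' : ssyt_e i T = Some T' -> vst_e i (allb T) = Some (allb T').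
Proof.
rewrite /ssyt_e /vst_e allb_buoys /=; case Ex: leftmost_minus => [[r c]|] //= [<-].
have [a [b [Eb /= Eri ea pb]]] := leftmost_minusP Ex.
have [|bu _ _ _ /(_ Eri)[_ bp]] := buoy_pivot hlam hV _ ea pb (or_intror Eri).
  by rewrite allb_buoys.
have cr := buoy_in hV bu.
rewrite allb_anchor_col //; case: ifP => [/andP[r0 /eqP E1]|_].
  case/negP: bp; rewrite /bplus; apply/andP; split.
    apply/(occursP hV); exists r.-1 => //.
    exact: leq_trans cr (part_le hlam (leq_pred r)).
  by case: (c) => //= d; rewrite allb_occurs_na.
by rewrite allb_set_range allb_anchor_col // /allb /set_range shape_mkfill.
Qed.

Lemma ssyt_fP i T' : ssyt_f i T = Some T' ->
  semistandard lam T' /\ fstep i (crw T) (crw T').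
Proof.
move=> /ssyt_f_allb /(vst_fP hlam hV)[[ss _ _ _] + _].
by rewrite !allb_aw.
Qed.

Lemma ssyt_eP i T' : 0 < i -> ssyt_e i T = Some T' ->
  semistandard lam T' /\ fstep i (crw T') (crw T).
Proof.
move=> i0 /ssyt_e_allb /(vst_eP hlam hV i0)[[ss _ _ _] + _].
by rewrite !allb_aw.
Qed.

Lemma ssyt_f_none i : ssyt_f i T = None -> phi i (crw T) = 0.
Proof.
by rewrite /ssyt_f; case Ex: rightmost_plus => // _; exact: rightmost_plus_none.
Qed.

Lemma ssyt_e_none i : ssyt_e i T = None -> eps i (crw T) = 0.
Proof.
by rewrite /ssyt_e; case Ex: leftmost_minus => // _; exact: leftmost_minus_none.
Qed.

End SSYTOperators.

Lemma ssyt_f_entries n i T T' :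
  ssyt_f i T = Some T' -> i < n -> entries_le n T -> entries_le n T'.
Proof.
rewrite /ssyt_f; case: rightmost_plus => [[r c]|] //= [<-] lt le.
exact: set_range_entries.
Qed.

Lemma ssyt_e_entries n i T T' :
  ssyt_e i T = Some T' -> i < n -> entries_le n T -> entries_le n T'.
Proof.
rewrite /ssyt_e; case: leftmost_minus => [[r c]|] //= [<-] lt le.
by apply: set_range_entries => //; exact: ltnW.
Qed.

(** * Insertion commutes with the crystal operators *)

(** The column word of [T] inserts to [T], and insertion preserves the string lengths when the
    result is read by rows. *)
Lemma crw_phi_eps i T : good T -> phi i (crw T) = phi i (rrw T) /\ eps i (crw T) = eps i (rrw T).
Proof. by move=> gT; have [<- <-] := P_phi_eps i (crw T); rewrite P_crw. Qed.

Lemma crw_count T a : good T -> count a (crw T) = count a (rrw T).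
Proof. by move=> gT; rewrite -P_count P_crw. Qed.

Lemma P_mem w x : (x \in rrw (P w)) = (x \in w).
Proof. by rewrite -!has_pred1 !has_count P_count. Qed.

Lemma P_semistandard w : 0 \notin w -> semistandard (shape (P w)) (P w).
Proof. by move=> w0; apply: good_semistandard (P_good w) _; rewrite P_mem. Qed.

Lemma P_entries n w : all (leq^~ n) w -> entries_le n (P w).
Proof.
move=> le r c; have [lt|ge] := ltnP c (size (nth [::] (P w) r)).
  by have := ent_mem lt; rewrite P_mem => /(allP le).
by rewrite ent_out // nth_shape.
Qed.

Lemma P_content w j : content (P w) j = count_mem j w.
Proof.
by rewrite -[RHS]P_count -crw_count ?P_good // /crw /letters count_map.
Qed.

Lemma P_size w : sumn (shape (P w)) = size w.
Proof.
by rewrite -[RHS]count_predT -P_count count_predT size_flatten /shape map_rev sumn_rev.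
Qed.

Lemma P_part w : is_part (shape (P w)).
Proof. exact: good_part (P_good w). Qed.

(** [ssyt_f] acts on the column word, bumping is controlled on the row word. Inserting the column
    words of a tableau and of its image gives both tableaux back and turns the step into one of row
    words, where steps are unique. *)
Lemma P_ssyt_f i w w' : 0 \notin w -> fstep i w w' -> ssyt_f i (P w) = Some (P w').
Proof.
move=> w0 st; have ssT := P_semistandard w0; have [cp _] := crw_phi_eps i (P_good w).
case E: (ssyt_f i (P w)) => [T'|]; last first.
  have := ssyt_f_none E; rewrite cp; have [-> _] := P_phi_eps i w.
  by have := fstep_phi st; case: phi.
have [ssT' st'] := ssyt_fP (P_part w) ssT E.
have gT' := semistandard_good (P_part w) ssT'.
have [_ st2] := P_fstep st'; rewrite !P_crw ?P_good // in st2.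
have [sh st3] := P_fstep st.
congr Some; apply: rrw_inj; first by rewrite sh; have [] := ssT'.
exact: fstep_det st2 st3.
Qed.

Lemma P_ssyt_f_none i w : 0 \notin w -> phi i w = 0 -> ssyt_f i (P w) = None.
Proof.
move=> w0 p0; case E: (ssyt_f i (P w)) => [T'|] //.
have [_ st] := ssyt_fP (P_part w) (P_semistandard w0) E.
have := fstep_phi st; have [-> _] := crw_phi_eps i (P_good w).
by have [-> _] := P_phi_eps i w; rewrite p0.
Qed.

Lemma P_ssyt_e i w w' : 0 < i -> 0 \notin w -> fstep i w' w ->
  ssyt_e i (P w) = Some (P w').
Proof.
move=> i0 w0 st; have ssT := P_semistandard w0; have [_ ce] := crw_phi_eps i (P_good w).
case E: (ssyt_e i (P w)) => [T'|]; last first.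
  have := ssyt_e_none E; rewrite ce; have [_ ->] := P_phi_eps i w.
  by have := fstep_eps st; case: eps.
have [ssT' st'] := ssyt_eP (P_part w) ssT i0 E.
have gT' := semistandard_good (P_part w) ssT'.
have [_ st2] := P_fstep st'; rewrite !P_crw ?P_good // in st2.
have [sh st3] := P_fstep st.
congr Some; apply: rrw_inj; first by rewrite -sh; have [] := ssT'.
exact: fstep_codet st2 st3.
Qed.

Lemma P_ssyt_e_none i w : 0 < i -> 0 \notin w -> eps i w = 0 -> ssyt_e i (P w) = None.
Proof.
move=> i0 w0 e0; case E: (ssyt_e i (P w)) => [T'|] //.
have [_ st] := ssyt_eP (P_part w) (P_semistandard w0) i0 E.
have := fstep_eps st; have [_ ->] := crw_phi_eps i (P_good w).
by have [_ ->] := P_phi_eps i w; rewrite e0.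
Qed.

(** * Highest weight elements *)

Definition hw (n : nat) (w : seq nat) : Prop := forall i, 0 < i < n -> eps i w = 0.

Lemma hw_suffix n u v : hw n (u ++ v) -> hw n v.
Proof. by move=> h i /h; rewrite eps_cat; lia. Qed.

Lemma vst_ge lam V r c : is_part lam -> VSToo lam V -> c < nth 0 lam r -> r < ent V.1 r c.
Proof.
move=> hlam hV; elim: r => [|r IH] cr; first exact: (vst_pos hV).
apply: leq_ltn_trans (vst_col hV (ltnSn r) cr).
exact: IH (leq_trans cr (part_le hlam (leqnSn r))).
Qed.

(** The last box of row r is an anchor, and all letters read after it lie in earlier rows, hence are
    at most r by induction. A letter x larger than r+1 in that box could not be cancelled by any
    x-1. The other boxes of the row are squeezed between r+1 and the last one. *)
Lemma hw_ent n lam V : is_part lam -> VSToo lam V -> entries_le n V.1 -> hw n (aw V) ->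
  forall r c, c < nth 0 lam r -> ent V.1 r c = r.+1.
Proof.
move=> hlam hV len hwV; elim/ltn_ind => r IH c cr.
set m := nth 0 lam r in cr.
have mr : m.-1 < nth 0 lam r by rewrite -/m; lia.
have an : is_anchor V r m.-1 by rewrite (anchorE hV) mr /nanchor -/m (ltn_predK cr) ltnn.
suff E : ent V.1 r m.-1 = r.+1.
  have := vst_row hV (_ : c <= m.-1) mr; rewrite E => /(_ ltac:(lia)).
  by have := vst_ge hlam hV cr; lia.
have ge := vst_ge hlam hV mr; apply/eqP; rewrite eqn_leq ge andbT leqNgt; apply/negP => gt.
have rT : r < size V.1 by rewrite (vst_size1 hV) (part_size mr).
have := hwV (ent V.1 r m.-1).-1; have := len r m.-1 => le1 H.
have {H} := H ltac:(lia); rewrite /aw (colwords_split _ (anchor_lt_ncols hlam hV mr)).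
rewrite -[anchor_word V m.-1]/(colw V.1 (is_anchor V) m.-1) (colw_split _ _ rT) an /=.
rewrite -!catA cat_cons catA eps_cat; set u := _ ++ colwords _ _ _; set x := ent _ _ _ in gt le1 *.
have nu : x.-1 \notin u.
  rewrite mem_cat mem_rev negb_or; apply/andP; split.
    apply/negP => /mapP[s]; rewrite mem_filter mem_iota => /andP[_ sr].
    have sr' : s < r by lia.
    by rewrite IH //; [lia|apply: leq_trans mr (part_le hlam (ltnW sr'))].
  apply/negP => /flattenP[w /mapP[d + ->]]; rewrite mem_iota => dm /mem_colw[s [_ ans Es]].
  have ds := anchor_in hV ans.
  have sr : s < r.
    by rewrite ltnNge; apply/negP => /(part_le hlam); rewrite -/m; lia.
  by move: Es; rewrite IH //; lia.
have Ex : x = x.-1.+1 by lia.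
have Eu : x :: u = x.-1.+1 :: u by rewrite -Ex.
by rewrite Eu eps_minus (phi_notin nu) /=; lia.
Qed.

Lemma count_const_rows k T :
  (forall r c, c < size (nth [::] T r) -> ent T r c = r + k) ->
  forall r, count_mem (r + k) (rrw T) = size (nth [::] T r).
Proof.
elim: T k => [|s T IH] k H r; first by rewrite nth_nil.
have HT r' c : c < size (nth [::] T r') -> ent T r' c = r' + k.+1.
  by move=> lt; rewrite addnS; exact: (H r'.+1 c lt).
have Hs : all (pred1 k) s by apply/(all_nthP 0) => c cs; apply/eqP; exact: (H 0 c cs).
rewrite rrw_cons count_cat; case: r => [|r] /=; last first.
  rewrite addSnnS (IH k.+1 HT) -[RHS]addn0; congr addn; apply/count_memPn/negP.
  by move=> /(allP Hs) /=; lia.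
rewrite (eqP (_ : count_mem (0 + k) s == size s)); last by rewrite -all_count.
rewrite (count_memPn _) //; apply/negP => /mem_rrw[s' /(nthP [::])[r rT <-]].
by move=> /(nthP 0)[c cs E]; have := HT r c cs; rewrite /ent E; lia.
Qed.

(** [P w] inherits the vanishing of [eps], and [hw_ent] applies to it with single-box groups. *)
Lemma hw_P n w : 0 \notin w -> all (leq^~ n) w -> hw n w ->
  (forall r c, c < nth 0 (shape (P w)) r -> ent (P w) r c = r.+1) /\
  forall r, nth 0 (shape (P w)) r = count_mem r.+1 w.
Proof.
move=> w0 le hww.
have H r c : c < nth 0 (shape (P w)) r -> ent (P w) r c = r.+1.
  apply: (@hw_ent n _ (allb (P w)) (P_part w)).
  - exact: allb_VST (P_part w) (P_semistandard w0).
  - exact: P_entries.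
  - move=> i i0; rewrite allb_aw; have [_ ->] := crw_phi_eps i (P_good w).
    by have [_ ->] := P_phi_eps i w; exact: hww.
split=> // r; rewrite nth_shape -[RHS]P_count -addn1 (@count_const_rows 1) //.
by move=> r' c; rewrite -nth_shape => /H; rewrite addn1.
Qed.

(** * Inflation *)

Definition sw (V : vst) (j : nat) : seq nat := colwords (anchor_word V) j (ncols V - j).

Lemma infl_tabE V j : infl_tab V j = P (sw V j).
Proof. by []. Qed.

Lemma sw0 V : sw V 0 = aw V.
Proof. by rewrite /sw subn0. Qed.

Lemma inflationE V :
  inflation V = (shape (P (aw V)), (P (aw V), mkfill (shape V.1) (infl_fill V))).
Proof. by rewrite /inflation infl_tabE sw0. Qed.

Definition fill_step (lam : seq nat) (mu : nat -> nat -> nat) :=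
  fun j (F : nat -> nat -> nat) r c =>
    if j + mu j r <= c < nth 0 lam r then (F r c).+1 else 0.

Lemma eq_fill lam (mu mu' : nat -> nat -> nat) s r c : (forall j, mu j r = mu' j r) ->
  foldr (fill_step lam mu) (fun _ _ => 0) s r c =
  foldr (fill_step lam mu') (fun _ _ => 0) s r c.
Proof. by move=> E; elim: s => //= j s IH; rewrite /fill_step E IH. Qed.

(** An entry counts the steps j at which its box lies outside mu_j. Row r of mu_j ends before plane
    column [j + mu j r], which is nondecreasing in j, so these steps form an initial segment and the
    resets to 0 lose nothing. *)
Lemma fill_gt lam (mu : nat -> nat -> nat) r c k m :
  c < nth 0 lam r -> (forall j, j + mu j r <= j.+1 + mu j.+1 r) ->
  forall j, k <= j ->
  (j < k + foldr (fill_step lam mu) (fun _ _ => 0) (iota k m) r c) =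
  (j < k + m) && (j + mu j r <= c).
Proof.
move=> cr mono; have mono' j j' : j <= j' -> j + mu j r <= j' + mu j' r.
  elim: j' => [|j' IH]; first by rewrite leqn0 => /eqP->.
  rewrite leq_eqVlt => /orP[/eqP->//|]; rewrite ltnS => /IH h; exact: leq_trans h (mono j').
elim: m k => [|m IH] k j kj /=; first by rewrite !addn0; lia.
rewrite {1}/fill_step cr andbT.
case: (leqP (k + mu k r) c) => [le|gt]; last first.
  rewrite addn0 ltnNge kj /=; apply/esym/negbTE; rewrite negb_and -!leqNgt -ltnNge.
  by apply/orP; right; apply: leq_trans gt (mono' _ _ kj).
move: kj; rewrite leq_eqVlt => /orP[/eqP<-|kj]; first by rewrite le; lia.
by rewrite !addnS -!addSn IH.
Qed.

Lemma sw_drop V j : j <= ncols V ->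
  sw V j = drop (size (colwords (anchor_word V) 0 j)) (aw V).
Proof.
by move=> jL; rewrite /aw -{1}(subnKC jL) colwords_cat drop_size_cat.
Qed.

Lemma size_colwords f g j m : (forall c, size (f c) = size (g c)) ->
  size (colwords f j m) = size (colwords g j m).
Proof. by move=> E; elim: m j => // m IH j; rewrite !colwordsS !size_cat E IH. Qed.

Section InflationStep.

Variables (lam : seq nat) (V V' : vst) (i : nat).
Hypotheses (hV : VSToo lam V) (hV' : VSToo lam V').
Hypotheses (st : fstep i (aw V) (aw V')).
Hypothesis (sz : forall c, size (anchor_word V' c) = size (anchor_word V c)).

(** As the columns keep their sizes, the suffixes from column j start at the same position of both
    words. *)
Lemma infl_tab_step j : shape (infl_tab V' j) = shape (infl_tab V j).
Proof.
rewrite !infl_tabE; have [jL|Lj] := leqP j (ncols V); last first.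
  by rewrite /sw (ncolsE hV') -(ncolsE hV) (eqP (ltnW Lj)).
rewrite !sw_drop //; last by rewrite (ncolsE hV') -(ncolsE hV).
rewrite (size_colwords _ _ sz).
by have [->//|st'] := fstep_drop (size (colwords (anchor_word V) 0 j)) st; case: (P_fstep st').
Qed.

Lemma inflation_step :
  inflation V' = ((inflation V).1, (P (aw V'), (inflation V).2.2)).
Proof.
rewrite !inflationE /= (vst_shape1 hV) (vst_shape1 hV').
have [-> _] := P_fstep st; congr (_, (_, _)); rewrite /mkfill; apply: eq_map => r.
apply: eq_map => c; rewrite /infl_fill (vst_shape1 hV) (vst_shape1 hV').
rewrite (ncolsE hV') -(ncolsE hV).
by apply: (@eq_fill lam (fun j r => nth 0 (shape (infl_tab V' j)) r)
  (fun j r => nth 0 (shape (infl_tab V j)) r)) => j; rewrite infl_tab_step.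
Qed.

End InflationStep.

Lemma mem_aw lam V x : VSToo lam V -> x \in aw V ->
  exists r c, c < nth 0 lam r /\ ent V.1 r c = x.
Proof.
move=> hV /flattenP[w /mapP[c _ ->]] /mem_colw[r [_ an E]].
by exists r, c; split=> //; exact: (anchor_in hV an).
Qed.

Lemma aw_pos lam V : VSToo lam V -> 0 \notin aw V.
Proof.
by move=> hV; apply/negP => /(mem_aw hV)[r [c [/(vst_pos hV) + E]]]; rewrite E.
Qed.

Lemma aw_le n lam V : VSToo lam V -> entries_le n V.1 -> all (leq^~ n) (aw V).
Proof. by move=> hV le; apply/allP => x /(mem_aw hV)[r [c [_ <-]]]; exact: le. Qed.

Lemma sw_sub V j x : x \in sw V j -> x \in aw V.
Proof.
have [jL|Lj] := leqP j (ncols V); first by rewrite sw_drop // => /mem_drop.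
by rewrite /sw (eqP (ltnW Lj)).
Qed.

Lemma aw_suffix V j : exists u, aw V = u ++ sw V j.
Proof.
have [jL|Lj] := leqP j (ncols V); last first.
  by exists (aw V); rewrite /sw (eqP (ltnW Lj)) cats0.
exists (take (size (colwords (anchor_word V) 0 j)) (aw V)).
by rewrite sw_drop // cat_take_drop.
Qed.

(* A valued-set tableau whose row r (counted from 0) has constant entry r+1 is
   given by its anchors; [cnt j r] is the row length mu_j(r) of inflation. *)
Section ConstantRows.

Variables (lam : seq nat) (V : vst).
Hypotheses (hlam : is_part lam) (hV : VSToo lam V).
Hypothesis (cst : forall r c, c < nth 0 lam r -> ent V.1 r c = r.+1).

Definition cnt j r := count_mem r.+1 (sw V j).

Lemma cnt_rec j r : cnt j r = is_anchor V r j + cnt j.+1 r.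
Proof.
rewrite /cnt /sw; have [jL|Lj] := ltnP j (ncols V); last first.
  rewrite (eqP Lj) (eqP (leqW Lj)) /= (_ : is_anchor V r j = false) //.
  apply/negP => /(anchor_in hV) /(anchor_lt_ncols hlam hV); lia.
rewrite -(subnSK jL) colwordsS count_cat; congr (_ + _).
rewrite (count_decreasing _ (aw_sorted hV _)); congr nat_of_bool.
apply/mem_colw/idP => [[s [_ an]]|an].
  by rewrite cst ?(anchor_in hV) // => -[<-].
by exists r; rewrite cst ?(anchor_in hV) // (vst_size1 hV) (part_size (anchor_in hV an)).
Qed.

Lemma cnt_out j r : nth 0 lam r <= j -> cnt j r = 0.
Proof.
move=> le; apply/count_memPn/negP => /flattenP[w /mapP[c + ->]].
rewrite mem_iota => jc /mem_colw[s [_ an]]; have cs := anchor_in hV an.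
by rewrite cst // => -[E]; move: cs; rewrite E; lia.
Qed.

Lemma last_anchor r c : c.+1 = nth 0 lam r -> is_anchor V r c.
Proof. by move=> E; rewrite (anchorE hV) -E ltnSn /nanchor -E ltnn. Qed.

(** The last box of a row is an anchor; this becomes the flag condition. *)
Lemma cnt_pos j r : j < nth 0 lam r -> 0 < cnt j r.
Proof.
move=> jr; have [k Ek] : exists k, j + k.+1 = nth 0 lam r by exists (nth 0 lam r - j.+1); lia.
elim: k j Ek {jr} => [|k IH] j Ek; rewrite cnt_rec.
  by rewrite last_anchor //; lia.
by have := IH j.+1; rewrite addSnnS => /(_ Ek); lia.
Qed.

(** The cut stays at a column where row r has an anchor and moves by one box otherwise, so its jumps
    record the non-anchors. *)
Lemma cut_mono j r : j + cnt j r <= j.+1 + cnt j.+1 r.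
Proof. by rewrite (cnt_rec j); case: is_anchor; lia. Qed.

Lemma cut_le j r : j <= nth 0 lam r -> j + cnt j r <= nth 0 lam r.
Proof.
move=> jr; have [k Ek] : exists k, j + k = nth 0 lam r by exists (nth 0 lam r - j); lia.
elim: k j Ek {jr} => [|k IH] j Ek; first by rewrite cnt_out; lia.
by have := cut_mono j r; have := IH j.+1; rewrite addSnnS => /(_ Ek); lia.
Qed.

Variable n : nat.
Hypotheses (len : entries_le n V.1) (hwV : hw n (aw V)).

Lemma shape_infl j r : nth 0 (shape (infl_tab V j)) r = cnt j r.
Proof.
rewrite infl_tabE; have [u E] := aw_suffix V j.
apply: (proj2 (@hw_P n _ _ _ _)).
- by apply: contra (aw_pos hV); exact: sw_sub.
- by apply/allP => x /sw_sub; exact: (allP (aw_le hV len)).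
- by apply: (@hw_suffix n u); rewrite -E.
Qed.

Lemma infl_fill_gt r c j : c < nth 0 lam r -> (j < infl_fill V r c) = (j + cnt j r <= c).
Proof.
move=> cr; have -> : infl_fill V r c =
    foldr (fill_step lam cnt) (fun _ _ => 0) (iota 0 (ncols V)) r c.
  rewrite /infl_fill (vst_shape1 hV).
  apply: (@eq_fill lam (fun j r => nth 0 (shape (infl_tab V j)) r) cnt) => k.
  exact: shape_infl.
have := fill_gt (k := 0) (ncols V) cr (fun j => cut_mono j r) (leq0n j).
rewrite !add0n => ->; case: (leqP (j + cnt j r) c) => [le|_]; last by rewrite andbF.
by rewrite andbT; have := anchor_lt_ncols hlam hV cr; lia.
Qed.

Lemma cnt_antitone j r r' : r <= r' -> cnt j r' <= cnt j r.
Proof.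
by move=> rr; rewrite -!shape_infl; apply: part_le => //; rewrite infl_tabE P_part.
Qed.

Lemma infl_fill_Fcs : Fcs lam (shape (infl_tab V 0)) (mkfill lam (infl_fill V)).
Proof.
have gt := infl_fill_gt.
split; first exact: shape_mkfill.
- move=> r c; rewrite shape_infl ent_mkfill => lt; case: ifP => // cr.
  by apply/eqP; rewrite -leqn0 leqNgt gt // add0n -ltnNge.
(* An entry above c would mean that row r has no anchor from column c on. *)
- move=> r c; rewrite shape_infl ent_mkfill => /andP[le cr]; rewrite cr gt // le /=.
  by rewrite leqNgt gt // -ltnNge; have := cnt_pos cr; lia.
- move=> r c c'; rewrite shape_infl !ent_mkfill => le lt cr'.
  have cr := ltn_trans lt cr'; rewrite cr cr' gt //.
  have g0 : 0 < infl_fill V r c by rewrite gt.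
  have : (infl_fill V r c).-1 < infl_fill V r c by lia.
  rewrite gt // => H; have := cnt_rec (infl_fill V r c).-1 r.
  by rewrite (prednK g0); case: is_anchor; lia.
(* The cut of a lower row is weakly to the left, as each mu_j is a partition. *)
- move=> r r' c rr; rewrite shape_infl !ent_mkfill => le cr'.
  have cr := leq_trans cr' (part_le hlam (ltnW rr)); rewrite cr cr' leqNgt; apply/negP.
  rewrite gt // => H.
  have : infl_fill V r' c < infl_fill V r' c; last by rewrite ltnn.
  by rewrite gt //; have := cnt_antitone (infl_fill V r' c) (ltnW rr); lia.
Qed.

Lemma infl_subparts : subparts lam (shape (infl_tab V 0)).
Proof.
split; first by rewrite infl_tabE P_part.
by move=> r; rewrite shape_infl; have := cut_le (leq0n (nth 0 lam r)).
Qed.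

End ConstantRows.

Lemma vst_eq lam V V' : is_part lam -> VSToo lam V -> VSToo lam V' ->
  (forall r c, c < nth 0 lam r -> ent V.1 r c = ent V'.1 r c) ->
  (forall r c, c < nth 0 lam r -> is_anchor V r c = is_anchor V' r c) -> V = V'.
Proof.
move=> hlam hV hV' E1 E2.
suff : V.1 = V'.1 /\ V.2 = V'.2 by case: (V) (V') => [? ?] [? ?] /= [-> ->].
split.
  apply: (@tableau_eq _ 0); rewrite (vst_shape1 hV) ?(vst_shape1 hV') //.
apply: (@tableau_eq _ false); rewrite (vst_shape2 hV) ?(vst_shape2 hV') // => r [|c] cr.
  by rewrite -[LHS]/(is_buoy V r 0) -[RHS]/(is_buoy V' r 0) (buoy0 hV cr) (buoy0 hV' cr).
have := E2 r c (ltnW cr); rewrite (anchorE hV) (anchorE hV') (ltnW cr) /nanchor cr /=.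
by rewrite !negbK.
Qed.

(* Columns are recovered from right to left and each column from top to bottom:
   at the first box where V and V' differ, the value of an anchor of one of them
   would have no place in the other. *)
Lemma aw_inj lam V V' : is_part lam -> VSToo lam V -> VSToo lam V' ->
  (forall c, anchor_word V c = anchor_word V' c) -> V = V'.
Proof.
move=> hlam hV hV' Ew.
suff H : forall k c r, ncols V <= c + k -> c < nth 0 lam r ->
    ent V.1 r c = ent V'.1 r c /\ is_anchor V r c = is_anchor V' r c.
  by apply: (vst_eq hlam hV hV') => r c cr; have [] := H (ncols V) c r (leq_addl _ _) cr.
elim=> [|k IH] c r; first by move=> le /(anchor_lt_ncols hlam hV); lia.
move=> Lk; elim/ltn_ind: r => r IHr cr.
have sym U U' : VSToo lam U -> VSToo lam U' -> (forall d, anchor_word U d = anchor_word U' d) ->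
    (forall s, s < r -> ent U.1 s c = ent U'.1 s c) ->
    (c.+1 < nth 0 lam r -> ent U.1 r c.+1 = ent U'.1 r c.+1) ->
    is_anchor U r c -> ent U'.1 r c <= ent U.1 r c /\ is_anchor U' r c.
  move=> hU hU' EU EUs EUr an.
  have : ent U.1 r c \in anchor_word U' c.
    by rewrite -EU; apply/mem_colw; exists r; rewrite (vst_size1 hU) (part_size cr).
  move=> /mem_colw[s [_ an' Es]]; have cs := anchor_in hU' an'.
  have [lt|gt|Esr] := ltngtP s r.
  - by have := vst_col hU lt cr; rewrite EUs // Es ltnn.
  - split; first by rewrite -Es; apply: ltnW; exact: (vst_col hU').
    apply: contraT => nan; move: (nan); rewrite (anchorE hU') cr negbK => na.
    have /andP[cr1 _] := na; have := vst_col hU' gt cs.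
    rewrite -(nanchor_eq hU' na) -EUr // Es.
    by have := vst_row hU (leqnSn c) cr1; lia.
  - by rewrite -Es Esr -Esr.
have E1 s : s < r -> ent V.1 s c = ent V'.1 s c.
  by move=> sr; have [] := IHr s sr (leq_trans cr (part_le hlam (ltnW sr))).
have E2 : c.+1 < nth 0 lam r -> ent V.1 r c.+1 = ent V'.1 r c.+1.
  by move=> lt; have [] := IH c.+1 r _ lt; lia.
have anE : is_anchor V r c = is_anchor V' r c.
  apply/idP/idP => an.
    by have [] := sym V V' hV hV' Ew E1 E2 an.
  have [] // := sym V' V hV' hV (fun d => esym (Ew d)) _ _ an.
    by move=> s sr; rewrite E1.
  by move=> lt; rewrite E2.
split=> //; case an: (is_anchor V r c).
  have [le1 _] := sym V V' hV hV' Ew E1 E2 an.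
  have [|||le2 _] := sym V' V hV' hV (fun d => esym (Ew d)).
  + by move=> s sr; rewrite E1.
  + by move=> lt; rewrite E2.
  + by rewrite -anE.
  by apply/eqP; rewrite eqn_leq le1 le2.
have na : nanchor lam V r c by move: an; rewrite (anchorE hV) cr /= => /negbFE.
have na' : nanchor lam V' r c by move: an; rewrite anE (anchorE hV') cr /= => /negbFE.
rewrite -(nanchor_eq hV na) -(nanchor_eq hV' na') E2 //.
by case/andP: na.
Qed.

Lemma part_eq mu nu : is_part mu -> is_part nu -> (forall r, nth 0 mu r = nth 0 nu r) ->
  mu = nu.
Proof.
move=> hmu hnu E.
have szle m m' : is_part m -> (forall r, nth 0 m r = nth 0 m' r) -> size m <= size m'.
  move=> hm Em; rewrite leqNgt; apply/negP => lt.
  by have := part_pos hm lt; rewrite Em nth_default.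
apply: (@eq_from_nth _ 0) => //; apply/eqP; rewrite eqn_leq !szle //.
Qed.

Section FlaggedToVST.

Variables (n : nat) (lam mu : seq nat) (F : tableau).
Hypotheses (hlam : is_part lam) (hmu : subparts lam mu) (hF : Fcs lam mu F).
Hypothesis szn : size lam <= n.

(* The entries of row r of F are the columns (numbered from 1) of the boxes of
   row r that are not anchors. *)
Definition vst_of_fill : vst :=
  (mkfill lam (fun r _ => r.+1),
   mkfill lam (fun r c => (c == 0) || (c \notin nth [::] F r))).

Let V0 := vst_of_fill.

Lemma vst_of_fill_ent r c : c < nth 0 lam r -> ent V0.1 r c = r.+1.
Proof. by move=> cr; rewrite ent_mkfill cr. Qed.

Lemma vst_of_fill_buoy r c : is_buoy V0 r c =
  (c < nth 0 lam r) && ((c == 0) || (c \notin nth [::] F r)).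
Proof. by rewrite /is_buoy nth_mkfill; case: ifP. Qed.

Lemma vst_of_fill_VST : VSToo lam V0.
Proof.
split.
- split; first exact: shape_mkfill.
  + by move=> r c cr; rewrite vst_of_fill_ent.
  + by move=> r c c' cc' cr; rewrite !vst_of_fill_ent //; exact: leq_ltn_trans cr.
  + move=> r r' c rr cr; rewrite !vst_of_fill_ent //.
    exact: leq_trans cr (part_le hlam (ltnW rr)).
- exact: shape_mkfill.
- by move=> r rl; rewrite vst_of_fill_buoy part_pos.
- by move=> r c cr _; rewrite !vst_of_fill_ent //; exact: ltnW.
Qed.

Lemma vst_of_fill_entries : entries_le n V0.1.
Proof.
move=> r c; rewrite ent_mkfill; case: ifP => // /part_size lt; exact: leq_trans lt szn.
Qed.

Lemma Fcs_zero r c : c < nth 0 mu r -> ent F r c = 0.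
Proof. by have [_ + _ _ _] := hF; apply. Qed.

Lemma Fcs_flag r c : c < nth 0 lam r -> ent F r c <= c.
Proof.
move=> cr; have [/Fcs_zero->//|le] := ltnP c (nth 0 mu r).
by have [_ _ H _ _] := hF; have /andP[] := H r c (introT andP (conj le cr)).
Qed.

Lemma Fcs_pos r c : c < nth 0 lam r -> (0 < ent F r c) = (nth 0 mu r <= c).
Proof.
move=> cr; case: (leqP (nth 0 mu r) c) => [le|/Fcs_zero->//].
by have [_ _ H _ _] := hF; have /andP[] := H r c (introT andP (conj le cr)).
Qed.

Lemma Fcs_row r c c' : c < c' -> c' < nth 0 lam r -> 0 < ent F r c ->
  ent F r c < ent F r c'.
Proof.
move=> cc' cr'; rewrite Fcs_pos; last exact: ltn_trans cr'.
by have [_ _ _ H _] := hF => le; exact: H.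
Qed.

Lemma Fcs_row_le r c c' : c <= c' -> c' < nth 0 lam r -> ent F r c <= ent F r c'.
Proof.
rewrite leq_eqVlt => /orP[/eqP->//|lt] cr'.
have [->//|p] := posnP (ent F r c); apply: ltnW; exact: Fcs_row.
Qed.

Lemma Fcs_mem r v : reflect (exists2 c, c < nth 0 lam r & ent F r c = v)
  (v \in nth [::] F r).
Proof.
have szF : size (nth [::] F r) = nth 0 lam r by rewrite -nth_shape; have [-> _ _ _ _] := hF.
by apply: (iffP (nthP 0)); rewrite szF => -[c ? ?]; exists c.
Qed.

(** By the flag no entry of row r reaches the length of the row, so the last box is an anchor
    without a special clause. *)
Lemma vst_of_fill_anchor r c : c < nth 0 lam r ->
  is_anchor V0 r c = (c.+1 \notin nth [::] F r).
Proof.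
move=> cr; rewrite (anchorE vst_of_fill_VST) cr /nanchor vst_of_fill_buoy /=.
case: (ltnP c.+1 (nth 0 lam r)) => [lt|ge] /=; first by rewrite negbK.
apply/esym/negP => /Fcs_mem[d dr Ed]; have := Fcs_flag dr; rewrite Ed; lia.
Qed.

(** Descending induction on j. If j+1 occurs in row r, column j has no anchor, and by strictness the
    entries above j start one box before those above j+1, just as the cut does. Otherwise both stay
    in place. *)
Lemma vst_of_fill_cut r c j : c < nth 0 lam r -> (j + cnt V0 j r <= c) = (j < ent F r c).
Proof.
have rec := cnt_rec hlam vst_of_fill_VST vst_of_fill_ent.
have cle := cut_le hlam vst_of_fill_VST vst_of_fill_ent.
have [lj|] := leqP (nth 0 lam r) j.
  by move=> cr; have := Fcs_flag cr; lia.
move=> jr; have [k Ek] : exists k, j + k.+1 = nth 0 lam r by exists (nth 0 lam r - j.+1); lia.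
have base m c' : nth 0 lam r <= m -> c' < nth 0 lam r ->
    (m + cnt V0 m r <= c') = (m < ent F r c').
  by move=> lm cr; have := Fcs_flag cr; lia.
have {Ek} [k' Ek] : exists k, nth 0 lam r <= j + k by exists k.+1; lia.
clear k; elim: k' j jr Ek c => [|k IH] j jr Ek c cr; first by lia.
have IHj d : d < nth 0 lam r -> (j.+1 + cnt V0 j.+1 r <= d) = (j.+1 < ent F r d).
  move=> dr; have [lt|ge] := ltnP j.+1 (nth 0 lam r); last exact: base.
  by apply: IH => //; lia.
rewrite rec vst_of_fill_anchor //; case: (Fcs_mem r j.+1) => [[c0 c0r E0]|nin] /=.
  rewrite add0n; have [lt|ge] := ltnP c.+1 (nth 0 lam r).
    have -> : (j + cnt V0 j.+1 r <= c) = (j.+1 + cnt V0 j.+1 r <= c.+1) by lia.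
    rewrite IHj //; apply/idP/idP => H.
      have [le|gt] := leqP c0 c; last by have := Fcs_row_le gt c0r; lia.
      by have := Fcs_row_le le cr; lia.
    by have := @Fcs_row r c c.+1 (ltnSn c) lt; lia.
  have c0c : c0 <= c by lia.
  have := Fcs_row_le c0c cr; have := cle j.+1 r jr; lia.
rewrite addnA addn1 IHj //; have : ent F r c <> j.+1 by move=> E; apply: nin; exists c.
by lia.
Qed.

(** If row i+1 had more anchors than row i from column k on, the weak increase of F down column
    [k + cnt V0 k i] would contradict the positions of the two cuts. *)
Lemma vst_of_fill_hw : hw n (aw V0).
Proof.
have hV := vst_of_fill_VST.
move=> [//|i] /andP[_ iltn]; apply: colwords_eps0 => [c|k]; first exact: (aw_sorted hV).
rewrite add0n => /andP[_ kL].
have := hgt_count i.+1 (aw_sorted hV) k (ncols V0 - k); rewrite subnKC //.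
rewrite -/(sw V0 k) -/(cnt V0 k i) -/(cnt V0 k i.+1).
suff : cnt V0 k i.+1 <= cnt V0 k i by lia.
rewrite leqNgt; apply/negP => lt.
have kr : k <= nth 0 lam i.+1.
  rewrite leqNgt; apply/negP => gt; move: lt.
  by rewrite (cnt_out hlam hV vst_of_fill_ent (ltnW gt)) ltn0.
have c1 := cut_le hlam hV vst_of_fill_ent kr.
have cr1 : k + cnt V0 k i < nth 0 lam i.+1 by lia.
have cr := leq_trans cr1 (part_le hlam (leqnSn i)).
have := vst_of_fill_cut k cr; rewrite leqnn => /esym H.
have [_ _ _ _ colF] := hF.
have := colF i i.+1 _ (ltnSn i) _ cr1; rewrite -Fcs_pos // => /(_ ltac:(lia)) le.
by have := vst_of_fill_cut k cr1; lia.
Qed.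

Lemma vst_of_fill_infl : shape (infl_tab V0 0) = mu /\ mkfill lam (infl_fill V0) = F.
Proof.
have hV := vst_of_fill_VST; have len := vst_of_fill_entries; have hwV := vst_of_fill_hw.
have [pmu smu] := hmu; split.
  apply: part_eq => //; first by rewrite infl_tabE P_part.
  move=> r; rewrite (shape_infl hV len hwV).
  have := cut_le hlam hV vst_of_fill_ent (leq0n (nth 0 lam r)); have := smu r.
  rewrite add0n => le1 le2; apply/eqP; rewrite eqn_leq; apply/andP; split.
    rewrite leqNgt; apply/negP => lt; have cr := leq_trans lt le2.
    by have := vst_of_fill_cut 0 cr; rewrite Fcs_pos // leqnn add0n leqNgt lt.
  rewrite leqNgt; apply/negP => lt; have cr := leq_trans lt le1.
  by have := vst_of_fill_cut 0 cr; rewrite Fcs_pos // add0n leqnn leqNgt lt.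
have [shF _ _ _ _] := hF.
apply: (@tableau_eq _ 0); rewrite shape_mkfill // => r c cr.
rewrite nth_mkfill cr -/(ent F r c).
have gt j : (j < infl_fill V0 r c) = (j < ent F r c).
  by rewrite (infl_fill_gt hlam hV vst_of_fill_ent len hwV) // vst_of_fill_cut.
apply/eqP; rewrite eqn_leq; apply/andP; split; rewrite leqNgt.
  by rewrite gt ltnn.
by rewrite -gt ltnn.
Qed.

End FlaggedToVST.

(** If two cuts differed for some j, the entry at the smaller one would exceed j in one filling
    only. Consecutive values of [cnt] then give the anchors. *)
Lemma hw_vst_inj n lam V V' : is_part lam -> VSToo lam V -> VSToo lam V' ->
  entries_le n V.1 -> entries_le n V'.1 -> hw n (aw V) -> hw n (aw V') ->
  (forall r c, c < nth 0 lam r -> infl_fill V r c = infl_fill V' r c) -> V = V'.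
Proof.
move=> hlam hV hV' len len' hwV hwV' E.
have cst := hw_ent hlam hV len hwV; have cst' := hw_ent hlam hV' len' hwV'.
have gt r c j cr := @infl_fill_gt _ _ hlam hV cst _ len hwV r c j cr.
have gt' r c j cr := @infl_fill_gt _ _ hlam hV' cst' _ len' hwV' r c j cr.
have cE r j : j <= nth 0 lam r -> cnt V j r = cnt V' j r.
  move=> jr; have := cut_le hlam hV cst jr; have := cut_le hlam hV' cst' jr => le' le.
  have [lt|lt|//] := ltngtP (cnt V j r) (cnt V' j r).
    have cr : j + cnt V j r < nth 0 lam r by lia.
    by have := gt r _ j cr; rewrite E // gt' //; lia.
  have cr : j + cnt V' j r < nth 0 lam r by lia.
  by have := gt r _ j cr; rewrite E // gt' //; lia.
apply: (vst_eq hlam hV hV') => r c cr; first by rewrite cst ?cst'.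
have := cE r c (ltnW cr); rewrite (cnt_rec hlam hV cst) (cnt_rec hlam hV' cst') cE //.
by case: is_anchor; case: is_anchor; lia.
Qed.

(** * Induction along the raising operators *)

Lemma vst_hw_ind n lam (Q : vst -> Prop) : is_part lam ->
  (forall V, VST n lam V -> hw n (aw V) -> Q V) ->
  (forall i V V', 0 < i < n -> VST n lam V -> VST n lam V' ->
     vst_e i V = Some V' -> Q V' -> Q V) ->
  forall V, VST n lam V -> Q V.
Proof.
(* Each e_i lowers the sum of the anchor word by one. *)
move=> hlam Qhw Qe V; have [m] := ubnP (sumn (aw V)); elim: m V => // m IH V ltm hV.
have [[i [V' [i0 e]]]|none] :=
    EM (exists i V', 0 < i < n /\ vst_e i V = Some V').
  have i_gt : 0 < i by case/andP: i0.
  have [hV' st _] := vst_eP hlam hV.1 i_gt e.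
  have hV'' : VST n lam V'.
    by split=> //; apply: (vst_e_entries e); [case/andP: i0|exact: hV.2].
  apply: (Qe i V V') => //; apply: IH => //; have := fstep_sumn st; lia.
apply: Qhw => // i i0; apply: (vst_e_none hlam hV.1).
by case e: (vst_e i V) => [V'|] //; case: none; exists i, V'.
Qed.

Lemma ssyt_hw_ind n mu (Q : tableau -> Prop) : is_part mu ->
  (forall T, SSYT n mu T -> hw n (crw T) -> Q T) ->
  (forall i T T', 0 < i < n -> SSYT n mu T -> SSYT n mu T' ->
     ssyt_e i T = Some T' -> Q T' -> Q T) ->
  forall T, SSYT n mu T -> Q T.
Proof.
move=> hmu Qhw Qe T; have [m] := ubnP (sumn (crw T)); elim: m T => // m IH T ltm hT.
have [[i [T' [i0 e]]]|none] :=
    EM (exists i T', 0 < i < n /\ ssyt_e i T = Some T').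
  have i_gt : 0 < i by case/andP: i0.
  have [hT' st] := ssyt_eP hmu hT.1 i_gt e.
  have hT'' : SSYT n mu T'.
    by split=> //; apply: (ssyt_e_entries e); [case/andP: i0|exact: hT.2].
  apply: (Qe i T T') => //; apply: IH => //; have := fstep_sumn st; lia.
apply: Qhw => // i i0; apply: ssyt_e_none.
by case e: (ssyt_e i T) => [T'|] //; case: none; exists i, T'.
Qed.

Section Inflation.

Variables (n : nat) (lam : seq nat).
Hypothesis hlam : is_part lam.

Lemma inflation_vst_e i V V' : 0 < i < n -> VST n lam V -> vst_e i V = Some V' ->
  [/\ VST n lam V', ssyt_e i (P (aw V)) = Some (P (aw V')) &
      inflation V' = ((inflation V).1, (P (aw V'), (inflation V).2.2))].
Proof.
move=> /andP[i0 iltn] [hV len] e; have [hV' st sz] := vst_eP hlam hV i0 e.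
split; first by split=> //; exact: (vst_e_entries e).
  by apply: P_ssyt_e => //; exact: aw_pos hV.
have szs c : size (anchor_word V c) = size (anchor_word V' c) by rewrite sz.
by have := inflation_step hV' hV st szs; rewrite !inflationE /= => -[-> ->].
Qed.

Lemma inflation_vst_f i V V' : 0 < i < n -> VST n lam V -> vst_f i V = Some V' ->
  [/\ VST n lam V', ssyt_f i (P (aw V)) = Some (P (aw V')) &
      inflation V' = ((inflation V).1, (P (aw V'), (inflation V).2.2))].
Proof.
move=> /andP[i0 iltn] [hV len] e; have [hV' st sz] := vst_fP hlam hV e.
split; first by split=> //; exact: (vst_f_entries e).
  by apply: P_ssyt_f => //; exact: aw_pos hV.
exact: inflation_step hV hV' st sz.
Qed.

Lemma inflation_carrier V : VST n lam V ->
  [/\ subparts lam (shape (P (aw V))), SSYT n (shape (P (aw V))) (P (aw V)) &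
      Fcs lam (shape (P (aw V))) (mkfill (shape V.1) (infl_fill V))].
Proof.
move=> hV0; have [hV len] := hV0; rewrite (vst_shape1 hV).
suff [h1 h2] : subparts lam (inflation V).1 /\ Fcs lam (inflation V).1 (inflation V).2.2.
  move: h1 h2; rewrite inflationE /= (vst_shape1 hV) => h1 h2; split=> //.
  by split; [exact: P_semistandard (aw_pos hV)|exact: P_entries (aw_le hV len)].
move: V hV0 {hV len}; apply: (vst_hw_ind hlam) => [V [hV len] hwV|i V V' i0 hV hV' e].
  have cst := hw_ent hlam hV len hwV.
  have h1 := infl_subparts hlam hV cst len hwV.
  have h2 := infl_fill_Fcs hlam hV cst len hwV.
  by move: h1 h2; rewrite infl_tabE sw0 inflationE /= (vst_shape1 hV).
by have [_ _ ->] := inflation_vst_e i0 hV e.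
Qed.

(** In the induction step both elements are raised by the same e_i and become equal. Uniqueness of
    f_i then gives equal anchor words, which split into columns alike because the operators keep the
    column sizes. *)
Lemma inflation_inj V V' : VST n lam V -> VST n lam V' -> inflation V = inflation V' -> V = V'.
Proof.
move=> hV; move: V hV V'.
apply: (vst_hw_ind hlam) => [V [hV len] hwV|i V V1 i0 hV hV1 e IH] V' hV' E.
  have [hV'' len'] := hV'; move: E; rewrite !inflationE => -[_ EP EF].
  have hwV' : hw n (aw V').
    move=> i i0; have [_ <-] := P_phi_eps i (aw V'); rewrite -EP.
    by have [_ ->] := P_phi_eps i (aw V); exact: hwV.
  apply: (hw_vst_inj hlam hV hV'' len len' hwV hwV') => r c cr.
  have := congr1 (fun T => ent T r c) EF.
  by rewrite !ent_mkfill (vst_shape1 hV) (vst_shape1 hV'') cr.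
have [i_gt iltn] := andP i0.
have EP : P (aw V) = P (aw V') by move: E; rewrite !inflationE => -[].
have [_ sE iE] := inflation_vst_e i0 hV e.
case e': (vst_e i V') => [V1'|]; last first.
  have := P_ssyt_e_none i_gt (aw_pos hV'.1) (vst_e_none hlam hV'.1 e').
  by rewrite -EP sE.
have [hV1' sE' iE'] := inflation_vst_e i0 hV' e'.
have EP1 : P (aw V1) = P (aw V1') by move: sE'; rewrite -EP sE => -[].
have E1 : V1 = V1' by apply: IH => //; rewrite iE iE' E EP1.
have [_ st sz] := vst_eP hlam hV.1 i_gt e; have [_ st' sz'] := vst_eP hlam hV'.1 i_gt e'.
rewrite -E1 in st' sz'; have Ea := fstep_det st st'.
have EL : ncols V = ncols V' by rewrite (ncolsE hV.1) (ncolsE hV'.1).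
have Ew : [seq anchor_word V c | c <- iota 0 (ncols V)] =
          [seq anchor_word V' c | c <- iota 0 (ncols V')].
  apply: eq_from_flatten_shape => //; rewrite EL /shape -!map_comp.
  by apply: eq_map => c /=; rewrite -sz -sz'.
apply: (aw_inj hlam hV.1 hV'.1) => c; have [cL|Lc] := ltnP c (ncols V).
  have := congr1 (fun s => nth [::] s c) Ew.
  by rewrite -EL !(nth_map 0) ?size_iota // nth_iota.
have out U : VST n lam U -> ncols U <= c -> anchor_word U c = [::].
  by move=> hU; apply: (colw_out hlam hU.1) => r; exact: (anchor_in hU.1).
by rewrite !out // -EL.
Qed.

(** With F fixed, T is raised to highest weight, where a preimage is built from F; going back down
    by f_i changes only the tableau factor. *)
Lemma inflation_surj mu T F : subparts lam mu -> SSYT n mu T -> Fcs lam mu F ->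
  exists2 V, VST n lam V & inflation V = (mu, (T, F)).
Proof.
move=> hmu hT hF; move: T hT; have [pmu smu] := hmu.
apply: (ssyt_hw_ind pmu) => [T [ssT leT] hwT|i T T1 i0 hT hT1 e [V1 hV1 E1]].
  have entT : forall r c, c < nth 0 mu r -> ent T r c = r.+1.
    by apply: (hw_ent pmu (allb_VST pmu ssT) leT); rewrite allb_aw.
  (* The flag keeps the first column out of lam/mu, so the last row of lam meets mu, and the entry
     of [T] there is the number of rows of lam. *)
  have szn : size lam <= n.
    case Es: (size lam) => [//|m]; have ml : m < size lam by rewrite Es.
    have p := part_pos hlam ml; have pm : 0 < nth 0 mu m.
      have := Fcs_flag hF p; rewrite leqNgt (Fcs_pos hF p).
      by rewrite -ltnNge.
    by rewrite -(entT m 0 pm); exact: leT.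
  have hV := vst_of_fill_VST F hlam.
  have hwV := vst_of_fill_hw hlam hF szn.
  have len := vst_of_fill_entries F szn.
  have [Emu EF] := vst_of_fill_infl hlam hmu hF szn.
  exists (vst_of_fill lam F) => //; rewrite inflationE (vst_shape1 hV) EF.
  rewrite infl_tabE sw0 in Emu; rewrite Emu; congr (_, (_, _)).
  have [H _] := hw_P (aw_pos hV) (aw_le hV len) hwV; have [shT _ _ _] := ssT.
  apply: (@tableau_eq _ 0); rewrite Emu // => r c cr.
  by rewrite -[LHS]/(ent _ r c) H ?Emu // -[RHS]/(ent T r c) entT.
have [i_gt iltn] := andP i0.
have [ssT1 st] := ssyt_eP pmu hT.1 i_gt e.
have gT := semistandard_good pmu hT.1; have gT1 := semistandard_good pmu hT1.1.
have n0 : 0 \notin crw T1.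
  have := semistandard_n0 hT1.1; rewrite -!has_pred1 !has_count.
  by rewrite (crw_count _ gT1).
have := P_ssyt_f n0 st; rewrite !P_crw // => fT1.
have EP : P (aw V1) = T1 by move: E1; rewrite inflationE => -[].
case f: (vst_f i V1) => [V|]; last first.
  have := P_ssyt_f_none (aw_pos hV1.1) (vst_f_none hlam hV1.1 f).
  by rewrite EP fT1.
have [hV sE iE] := inflation_vst_f i0 hV1 f.
exists V => //; rewrite iE E1 /=; move: sE; rewrite EP fT1 => -[->].
by [].
Qed.

End Inflation.

(** * Decomposition of the crystal of valued-set tableaux *)

Lemma SSYT_closed n mu i T T' : is_part mu -> 0 < i < n -> SSYT n mu T ->
  ssyt_e i T = Some T' \/ ssyt_f i T = Some T' -> SSYT n mu T'.
Proof.
move=> hmu /andP[i0 iltn] [ssT le] [e|f]; split.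
- by have [] := ssyt_eP hmu ssT i0 e.
- exact: (ssyt_e_entries e).
- by have [] := ssyt_fP hmu ssT f.
- exact: (ssyt_f_entries f).
Qed.

Lemma VST_closed n lam : is_part lam -> crystal_closed n (VST_crystal n lam).
Proof.
move=> hlam i V V' i0 hV [e|f].
  by have [] := inflation_vst_e hlam i0 hV e.
by have [] := inflation_vst_f hlam i0 hV f.
Qed.

Lemma vst_wtE lam V j : is_part lam -> VSToo lam V -> vst_wt V j = count_mem j (aw V).
Proof. by move=> hlam hV; rewrite -(count_buoys hlam hV) /letters count_map. Qed.

Lemma vst_sizeE lam V : is_part lam -> VSToo lam V -> vst_size V = size (aw V).
Proof.
move=> hlam hV; rewrite /vst_size -(size_map (fun x => ent V.1 x.1 x.2)).
apply: perm_size; apply/allP => v _ /=; apply/eqP.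
exact: (count_buoys hlam hV).
Qed.

Lemma inflation_ce n lam i V : is_part lam -> 0 < i < n -> VST n lam V ->
  ssyt_e i (P (aw V)) = omap (fun V' => P (aw V')) (vst_e i V).
Proof.
move=> hlam i0 hV; case e: (vst_e i V) => [V'|] /=.
  by have [] := inflation_vst_e hlam i0 hV e.
have /andP[i_gt _] := i0.
by apply: (P_ssyt_e_none i_gt (aw_pos hV.1)); exact: (vst_e_none hlam hV.1 e).
Qed.

Lemma inflation_cf n lam i V : is_part lam -> 0 < i < n -> VST n lam V ->
  ssyt_f i (P (aw V)) = omap (fun V' => P (aw V')) (vst_f i V).
Proof.
move=> hlam i0 hV; case f: (vst_f i V) => [V'|] /=.
  by have [] := inflation_vst_f hlam i0 hV f.
by apply: (P_ssyt_f_none (aw_pos hV.1)); exact: (vst_f_none hlam hV.1 f).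
Qed.

(* Both decompositions come from relabelling the multiplicity factor F. *)
Lemma inflation_iso n lam (S : Type) (K : seq nat -> set S)
    (kap : seq nat -> tableau -> S) : is_part lam ->
  (forall mu, subparts lam mu -> set_bij (Fcs lam mu) (K mu) (kap mu)) ->
  let lab V := ((inflation V).1, ((inflation V).2.1,
                kap (inflation V).1 (inflation V).2.2)) in
  crystal_iso n (VST_crystal n lam)
    (crystal_sum (subparts lam) (fun mu => crystal_times (B n mu) (K mu))) lab.
Proof.
move=> hlam hK lab.
have labE V : lab V = (shape (P (aw V)), (P (aw V),
    kap (shape (P (aw V))) (mkfill (shape V.1) (infl_fill V)))).
  by rewrite /lab inflationE.
split.
- split; first exact: VST_closed.
  move=> i [mu [T k]] y i0 [/= hmu [hT hk]] h.
  have : (exists2 T', ssyt_e i T = Some T' & y = (mu, (T', k))) \/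
         (exists2 T', ssyt_f i T = Some T' & y = (mu, (T', k))).
    case: h; [case E: (ssyt_e i T) => [T'|] //= [<-]; left|
              case E: (ssyt_f i T) => [T'|] //= [<-]; right]; by exists T'.
  case=> -[T' E ->]; split=> //; split=> //=; apply: (SSYT_closed hmu.1 i0 hT);
  by [left|right].
- split.
  + move=> V hV; have [h1 h2 h3] := inflation_carrier hlam hV.
    rewrite /lab inflationE /=; split=> //; split=> //=.
    by apply: (set_bij_homo (hK _ h1)).
  + move=> V V'; rewrite !inE => hV hV'; rewrite /lab !inflationE /= => -[_ E2 E3].
    have [h1 _ h3] := inflation_carrier hlam hV; have [_ _ h3'] := inflation_carrier hlam hV'.
    have [_ inj _] := hK _ h1; rewrite -E2 in E3 h3'.
    have EF := inj _ _ (mem_set h3) (mem_set h3') E3.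
    by apply: (inflation_inj hlam hV hV'); rewrite !inflationE -E2 EF.
  + move=> [mu [T k]] [/= hmu [hT hk]].
    have [_ _ surj] := hK _ hmu; have [F hF Ek] := surj _ hk.
    have [V hV E] := inflation_surj hlam hmu hT hF.
    by exists V => //; rewrite /lab E -Ek.
- move=> V hV j; rewrite /lab inflationE /= P_content.
  by rewrite (vst_wtE j hlam hV.1).
- move=> i V i0 hV; rewrite labE /= (inflation_ce hlam i0 hV).
  case e: (vst_e i V) => [V'|] //; rewrite /omap /obind /oapp /lab.
  by have [_ _ ->] := inflation_vst_e hlam i0 hV e; rewrite inflationE.
- move=> i V i0 hV; rewrite labE /= (inflation_cf hlam i0 hV).
  case f: (vst_f i V) => [V'|] //; rewrite /omap /obind /oapp /lab.
  by have [_ _ ->] := inflation_vst_f hlam i0 hV f; rewrite inflationE.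
Qed.

(** * Cardinalities of finite sets *)

Lemma ncard_bij (T T' : choiceType) (A : set T) (A' : set T') (f : T -> T') :
  finite_set A -> finite_set A' -> set_bij A A' f -> ncard A = ncard A'.
Proof.
move=> fA fA' [homo inj surj]; rewrite /ncard -(size_map f); apply/eqP.
rewrite -uniq_size_uniq ?fset_uniq //.
  rewrite map_inj_in_uniq ?fset_uniq // => x y; rewrite !in_fset_set //.
  exact: inj.
move=> y; rewrite in_fset_set //; apply/idP/mapP => [|[x]].
  by rewrite inE => /surj[x Ax <-]; exists x; rewrite ?in_fset_set ?inE.
by rewrite in_fset_set // !inE => /homo Ax ->.
Qed.

Lemma index_bij (T : choiceType) (A : set T) : finite_set A ->
  set_bij A [set k | k < ncard A] (fun x => index x (fset_set A)).
Proof.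
move=> fA; have memA x : A x -> x \in (fset_set A : seq T).
  by move=> Ax; rewrite in_fset_set // mem_set.
split.
- by move=> x Ax; rewrite /= /ncard index_mem memA.
- move=> x y; rewrite !inE => Ax Ay E.
  by rewrite -(nth_index x (memA x Ax)) E nth_index // memA.
- move=> k /= kA; have [x0 _] : exists x0, x0 \in (fset_set A : seq T).
    move: kA; rewrite /ncard; case: (enum_fset _) => [//|x s] _.
    by exists x; rewrite mem_head.
  exists (nth x0 (fset_set A) k).
    have : nth x0 (fset_set A) k \in (fset_set A : seq T) by exact: mem_nth.
    by rewrite in_fset_set // inE.
  by rewrite index_uniq // fset_uniq.
Qed.

Lemma ncard_setX (T T' : choiceType) (A : set T) (A' : set T') :
  finite_set A -> finite_set A' -> ncard (A `*` A') = ncard A * ncard A'.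
Proof.
move=> fA fA'; rewrite /ncard fset_setX // -(size_allpairs (@pair T T')); apply/eqP.
rewrite eq_sym -uniq_size_uniq ?fset_uniq //.
  by apply: allpairs_uniq => //; rewrite ?fset_uniq // => -[x y] [x' y'] _ _ [-> ->].
move=> [x y]; rewrite in_fsetM /=; apply/andP/allpairsP => [[xA yA]|[[x' y'] /= [xA yA [-> ->]]]] //.
by exists (x, y).
Qed.

(** A box of the first column outside mu would need a positive entry at most 0. *)
Lemma Fcs_size lam mu F : is_part lam -> subparts lam mu -> Fcs lam mu F ->
  size lam = size mu.
Proof.
move=> hlam [pmu smu] hF; apply/eqP; rewrite eqn_leq; apply/andP; split.
  rewrite leqNgt; apply/negP => lt; have p := part_pos hlam lt.
  have := Fcs_flag hF p; rewrite leqNgt (Fcs_pos hF p).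
  by rewrite nth_default.
rewrite leqNgt; apply/negP => lt; have p := part_pos pmu lt.
by have := smu (size lam); rewrite [X in _ <= X]nth_default // leqNgt p.
Qed.

(** A highest weight tableau is determined by its shape, which is its weight; only the filling is
    left free. *)
Lemma highest_weight_bij n lam mu : is_part lam -> subparts lam mu -> size mu <= n ->
  set_bij (highest_weight n (VST_crystal n lam) mu) (Fcs lam mu)
    (fun V => (inflation V).2.2).
Proof.
move=> hlam hmu szn.
have hwP V : highest_weight n (VST_crystal n lam) mu V ->
    [/\ VST n lam V, shape (P (aw V)) = mu &
        forall r c, c < nth 0 mu r -> ent (P (aw V)) r c = r.+1].
  move=> [/= hV e0 wt]; have [hV1 len] := hV.
  have hwV : hw n (aw V) by move=> i i0; apply: (vst_e_none hlam hV1); exact: e0.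
  have [H1 H2] := hw_P (aw_pos hV1) (aw_le hV1 len) hwV.
  have Emu : shape (P (aw V)) = mu.
    apply: part_eq; [exact: P_part|exact: hmu.1|].
    by move=> r; rewrite H2 -wt (vst_wtE _ hlam hV1).
  by split=> //; rewrite -Emu.
split.
- move=> V /hwP[hV Emu _]; have [_ _] := inflation_carrier hlam hV.
  by rewrite inflationE /= Emu.
- move=> V V'; rewrite !inE => /hwP[hV Emu H] /hwP[hV' Emu' H'] EF.
  apply: (inflation_inj hlam hV hV'); move: EF; rewrite !inflationE /= Emu Emu' => ->.
  congr (_, (_, _)); apply: (@tableau_eq _ 0); rewrite Emu // => r c cr.
  by rewrite -[LHS]/(ent _ r c) -[RHS]/(ent _ r c) H ?H'.
- move=> F hF; have szl : size lam <= n by rewrite (Fcs_size hlam hmu hF).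
  have hV := vst_of_fill_VST F hlam.
  have len := vst_of_fill_entries F szl.
  have hwV := vst_of_fill_hw hlam hF szl.
  have [Emu EF] := vst_of_fill_infl hlam hmu hF szl.
  exists (vst_of_fill lam F); last by rewrite inflationE /= (vst_shape1 hV).
  split=> /=.
  + by split.
  + move=> i i0; case e: (vst_e i _) => [V'|] //.
    have /andP[i_gt _] := i0; have [_ st _] := vst_eP hlam hV i_gt e.
    by have := fstep_eps st; rewrite (hwV i i0).
  + move=> j; rewrite (vst_wtE _ hlam hV) -Emu infl_tabE sw0.
    by have [_ ->] := hw_P (aw_pos hV) (aw_le hV len) hwV.
Qed.

(** * Expansion of gbar in Schur functions, coefficient by coefficient *)

Section Series.

Variables (lam m : seq nat).
Hypothesis hlam : is_part lam.

Definition gbar_index : set vst :=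
  [set V | VSToo lam V /\ forall j, vst_wt V j.+1 = nth 0 m j].

Definition schur_index (mu : seq nat) : set tableau :=
  [set T | semistandard mu T /\ forall j, content T j.+1 = nth 0 m j].

(** Letters beyond the length of [m] have exponent 0, so a fixed monomial bounds the entries by
    [size m], and inflation is applied with this number as n. *)
Lemma gbar_index_VST V : gbar_index V -> VST (size m) lam V.
Proof.
move=> [hV wt]; split=> // r c; rewrite leqNgt; apply/negP => gt.
have cr : c < nth 0 lam r by apply: (ent_in hV); lia.
have [x xb xe] := mem_buoys hlam hV cr.
have := wt (ent V.1 r c).-1; rewrite (ltn_predK gt) nth_default; last by lia.
move/eqP; rewrite -leqn0 leqNgt -has_count => /hasP; apply.
by exists x; rewrite ?xe.
Qed.

Lemma schur_index_SSYT mu T : is_part mu -> schur_index mu T -> SSYT (size m) mu T.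
Proof.
move=> hmu [ssT wt]; split=> // r c; rewrite leqNgt; apply/negP => gt.
have [shT _ _ _] := ssT.
have cr : c < size (nth [::] T r).
  by rewrite ltnNge; apply/negP => ge; move: gt; rewrite /ent nth_default.
have := wt (ent T r c).-1; rewrite (ltn_predK gt) nth_default; last by lia.
move/eqP; rewrite -leqn0 leqNgt -has_count => /hasP; apply.
by exists (r, c); rewrite ?mem_rd_boxes ?shT //=.
Qed.

Lemma gbar_fiber_bij mu : subparts lam mu ->
  set_bij [set V | gbar_index V /\ (inflation V).1 = mu]
    (schur_index mu `*` Fcs lam mu) (fun V => (inflation V).2).
Proof.
move=> hmu; split.
- move=> V [gV Emu]; have hV := gbar_index_VST gV.
  have [_ [ss _] hF] := inflation_carrier hlam hV.
  move: Emu; rewrite inflationE /= => Emu; rewrite Emu in ss hF.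
  by split=> //=; split=> // j; rewrite P_content -(vst_wtE _ hlam hV.1); case: gV.
- move=> V V'; rewrite !inE => -[gV Emu] [gV' Emu'] E.
  apply: (inflation_inj hlam (gbar_index_VST gV) (gbar_index_VST gV')).
  by rewrite (surjective_pairing (inflation V)) (surjective_pairing (inflation V')) Emu Emu' E.
- move=> [T F] [/= sT hF]; have [ss wt] := sT.
  have [V hV E] := inflation_surj hlam hmu (schur_index_SSYT hmu.1 sT) hF.
  exists V; last exact: (congr1 snd E).
  split; last exact: (congr1 fst E).
  split; first exact: hV.1.
  move=> j; rewrite (vst_wtE _ hlam hV.1) -P_content.
  by move: E; rewrite inflationE => -[_ -> _].
Qed.

Lemma finite_gbar_fiber mu :
  finite_set [set V | gbar_index V /\ (inflation V).1 = mu].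
Proof. by apply: (sub_finite_set _ (finite_gbar_index m hlam)) => V []. Qed.

Lemma ncard_gbar_fiber mu : subparts lam mu ->
  ncard [set V | gbar_index V /\ (inflation V).1 = mu] =
  ncard (schur_index mu) * ncard (Fcs lam mu).
Proof.
move=> hmu; have fS : finite_set (schur_index mu) by exact: finite_schur_index hmu.1.
have fF := finite_Fcs lam mu.
rewrite (ncard_bij (finite_gbar_fiber mu) (finite_setX fS fF) (gbar_fiber_bij hmu)).
exact: ncard_setX.
Qed.

Local Open Scope ring_scope.

Lemma sum_const_fset (T : choiceType) (A : set T) (x : {poly int}) : finite_set A ->
  \sum_(y \in A) x = x *+ ncard A.
Proof.
move=> fA; rewrite fsbig_finite // big_const_seq count_predT.
exact: GRing.iter_addr_0.
Qed.

Lemma gbar_expansion : gbar lam m =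
  \sum_(mu \in subparts lam)
    'X^(sumn lam - sumn mu) * (ncard (Fcs lam mu))%:R * schur mu m.
Proof.
have fA := finite_gbar_index m hlam; have fM := finite_subparts lam.
rewrite /gbar (fsbig_finite _ _ fA) (fsbig_finite _ _ fM) -/gbar_index.
(* Sorts the terms by the shape of the insertion tableau. The inner sum has a single term, with the
   right exponent because the number of groups is the length of the anchor word, hence the size of
   that shape. *)
have sumE : \sum_(V <- fset_set gbar_index) ('X^(sumn lam - vst_size V) : {poly int}) =
    \sum_(V <- fset_set gbar_index) \sum_(mu <- fset_set (subparts lam) | mu == (inflation V).1)
       'X^(sumn lam - sumn mu).
  apply: eq_big_seq => V; rewrite in_fset_set // inE => gV.
  have hV := gbar_index_VST gV; have [hmu _ _] := inflation_carrier hlam hV.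
  rewrite -big_filter filter_pred1_uniq ?fset_uniq //; last first.
    by rewrite in_fset_set // inE inflationE.
  by rewrite big_seq1 inflationE /= P_size (vst_sizeE hlam hV.1).
rewrite sumE (exchange_big_dep xpredT) //=; apply: eq_big_seq => mu.
rewrite in_fset_set // inE => hmu.
rewrite big_const_seq GRing.iter_addr_0 /schur sum_const_fset; last first.
  exact: finite_schur_index hmu.1.
rewrite -/(schur_index mu) -GRing.mulrA -GRing.natrM GRing.mulr_natr; congr (_ *+ _).
rewrite mulnC -ncard_gbar_fiber // /ncard -size_filter; apply/eqP.
rewrite eq_sym -uniq_size_uniq ?filter_uniq ?fset_uniq // => V.
rewrite mem_filter !in_fset_set //; last exact: finite_gbar_fiber.
apply/andP/idP => [[/eqP Emu /set_mem gV]|/set_mem[gV <-]]; first by apply: mem_set.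
by split; [exact: eqxx|exact: mem_set].
Qed.

End Series.

(** * Assembling the isomorphisms *)

Lemma crystal_iso_trans n (T U W : Type) (C : crystal T) (D : crystal U) (E : crystal W)
    (phi : T -> U) (psi : U -> W) :
  crystal_iso n C D phi -> crystal_iso n D E psi -> crystal_iso n C E (psi \o phi).
Proof.
move=> [[cC _] [h1 i1 s1] w1 e1 f1] [[_ cE] [h2 i2 s2] w2 e2 f2].
have hD x : carrier C x -> carrier D (phi x) by move=> /h1.
split=> //.
- split.
  + by move=> x /h1 /h2.
  + move=> x y /set_mem Cx /set_mem Cy E2; apply: (i1 _ _ (mem_set Cx) (mem_set Cy)).
    exact: (i2 _ _ (mem_set (hD _ Cx)) (mem_set (hD _ Cy)) E2).
  + by move=> z /s2[y /s1[x Cx <-] <-]; exists x.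
- by move=> x Cx j; rewrite /= w2 ?w1 //; exact: hD.
- by move=> i x i0 Cx; rewrite /= e2 ?e1 //; [case: ce|exact: hD].
- by move=> i x i0 Cx; rewrite /= f2 ?f1 //; [case: cf|exact: hD].
Qed.

Lemma times_copies_iso n (I T : Type) (A : set I) (C : I -> crystal T) (k : I -> nat) :
  (forall x, A x -> crystal_closed n (C x)) ->
  crystal_iso n (crystal_sum A (fun x => crystal_times (C x) [set j | j < k x]))
    (crystal_sum A (fun x => crystal_copies (k x) (C x)))
    (fun x => (x.1, (x.2.2, x.2.1))).
Proof.
move=> clC; split.
- split=> i [x [t u]] y i0 [/= Ax [/= h1 h2]].
    case; [case E: ce => [t'|] //= [<-]|case E: cf => [t'|] //= [<-]];
      do 2 split=> //=; apply: (clC x Ax i _ _ i0 h1); by [left|right].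
  case; [case E: ce => [t'|] //= [<-]|case E: cf => [t'|] //= [<-]];
    do 2 split=> //=; apply: (clC x Ax i _ _ i0 h2); by [left|right].
- split.
  + by move=> [x [t u]] [/= Ax [/= h1 h2]].
  + by move=> [x [t u]] [x' [t' u']] _ _ /= [-> -> ->].
  + by move=> [x [u t]] [/= Ax [/= h1 h2]]; exists (x, (t, u)).
- by [].
- by move=> i [x [t u]] i0 _ /=; case: ce.
- by move=> i [x [t u]] i0 _ /=; case: cf.
Qed.

Local Open Scope classical_set_scope.
Local Open Scope ring_scope.

Theorem theorem5p16 (n : nat) (lam : seq nat)
    (hn : (2 <= n)%N) (hlam : is_part lam) :
  [/\ crystal_iso n (VST_crystal n lam)
        (crystal_sum (subparts lam)
           (fun mu => crystal_times (B n mu) (Fcs lam mu)))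
        inflation,
      crystal_isomorphic n (VST_crystal n lam)
        (crystal_sum (subparts lam)
           (fun mu => crystal_copies (ncard (Fcs lam mu)) (B n mu))),
      forall mu : seq nat, subparts lam mu -> (size mu <= n)%N ->
        ncard (highest_weight n (VST_crystal n lam) mu) = ncard (Fcs lam mu)
    & forall m : seq nat,
        gbar lam m =
        \sum_(mu \in subparts lam)
          'X^(sumn lam - sumn mu) * (ncard (Fcs lam mu))%:R * schur mu m].
Proof.
split.
- have -> : inflation = (fun V => ((inflation V).1, ((inflation V).2.1, (inflation V).2.2))).
    by apply: funext => V; rewrite inflationE.
  apply: (@inflation_iso n lam _ (Fcs lam) (fun _ F => F) hlam) => mu _.
  by split=> // F hF; exists F.
(* Numbering the fillings by their index turns the second factor into the number of a copy. *)
- have iso := @inflation_iso n lam _ (fun mu => [set k | (k < ncard (Fcs lam mu))%N])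
    (fun mu F => index F (fset_set (Fcs lam mu))) hlam
    (fun mu _ => index_bij (finite_Fcs lam mu)).
  eexists; apply: (crystal_iso_trans iso); apply: times_copies_iso => mu [pmu _].
  by move=> i T T' i0 hT; exact: SSYT_closed.
- move=> mu hmu szn; apply: (ncard_bij _ _ (highest_weight_bij hlam hmu szn)).
    exact: finite_highest_weight.
  exact: finite_Fcs.
- by move=> m; exact: gbar_expansion.
Qed.
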